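(* Suppose Assumptions 1--7, 9 and 10 listed in the context hold (with $\alpha>1$ from Assumption 9 and $\beta>0$ from Assumption 10), let $\epsilon_n>0$ with $\epsilon_n\to0$, and suppose all nonzero eigenvalues of $M=R_{XY}R_{XY}^*$ are distinct. Let $\phi_1,\dots,\phi_d$ solve the sequential maximization problem: for $k=1,\dots,d$, $\phi_k$ maximizes $\langle\phi,M\phi\rangle_{\mathcal H_X}$ over $\phi\in\mathcal H_X^0$ subject to $\langle\phi,\phi\rangle_{\mathcal H_X}=1$ and $\langle\phi,\phi_j\rangle_{\mathcal H_X}=0$ for $j=1,\dots,k-1$. Let $\widehat\phi_1,\dots,\widehat\phi_d$ solve the same problem with $M$ replaced by $\widehat M=\widehat R_{XY}\widehat R_{XY}^*$, where $\widehat R_{XY}=(\widehat\Sigma_{XX}+\epsilon_nI)^{-1}\widehat\Sigma_{XY}$. Set $s_j=\mathrm{sgn}\langle\widehat\phi_j,\phi_j\rangle_{\mathcal H_X}$ for $j=1,\dots,d$. Then, for each $j=1,\dots,d$, $\|\widehat\phi_j-s_j\phi_j\|_{\mathcal H_X}=O_p(r_n)$, where $$r_n=n^{-1/2}\epsilon_n^{(\beta\wedge1)-1}+\epsilon_n^{\beta\wedge1}+n^{-1}\epsilon_n^{-(3\alpha+1)/(2\alpha)}+n^{-1/2}\epsilon_n^{-(\alpha+1)/(2\alpha)}$$ and $a\wedge b=\min(a,b)$.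
   Context: Setting. $(\Omega,\mathcal F,P)$ is a probability space; $\Omega_X\subseteq\mathbb R^p$, $\Omega_Y\subseteq\mathbb R^q$; $X:\Omega\to\Omega_X$, $Y:\Omega\to\Omega_Y$ are Borel random vectors with distributions $P_X,P_Y$. $\kappa_X,\kappa_Y$ are positive definite kernels on $\Omega_X\times\Omega_X$, $\Omega_Y\times\Omega_Y$ with reproducing kernel Hilbert spaces $\mathcal H_X,\mathcal H_Y$. For Hilbert space elements, $(u\otimes v)w=\langle v,w\rangle u$. Mean elements: $\mu_X=E\{\kappa_X(\cdot,X)\}$, $\mu_Y=E\{\kappa_Y(\cdot,Y)\}$. Covariance operators: $\Sigma_{XX}=E[\{\kappa_X(\cdot,X)-\mu_X\}\otimes\{\kappa_X(\cdot,X)-\mu_X\}]:\mathcal H_X\to\mathcal H_X$, $\Sigma_{XY}=E[\{\kappa_X(\cdot,X)-\mu_X\}\otimes\{\kappa_Y(\cdot,Y)-\mu_Y\}]:\mathcal H_Y\to\mathcal H_X$, $\Sigma_{YX}=\Sigma_{XY}^*$. $\mathcal H_X^0=\overline{\mathrm{span}}\{\kappa_X(\cdot,x)-\mu_X:x\in\Omega_X\}$, which the paper identifies with $\overline{\mathrm{ran}}(\Sigma_{XX})$. For a bounded operator $A$, the Moore--Penrose inverse $A^\dagger:\mathrm{ran}(A)\to\ker(A)^\perp$ is the inverse of the restriction of $A$ to $\ker(A)^\perp$. The regression operator is $R_{XY}=\Sigma_{XX}^\dagger\Sigma_{XY}:\mathcal H_Y\to\mathcal H_X$; $R_{XY}^*=\Sigma_{YX}\Sigma_{XX}^\dagger$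 is its adjoint, extended by continuity to $\overline{\mathrm{ran}}(\Sigma_{XX})=\mathcal H_X^0$. Sample. $(X_1,Y_1),\dots,(X_n,Y_n)$ are i.i.d. copies of $(X,Y)$; $E_n$ denotes the sample average. $\widehat\mu_X=E_n\{\kappa_X(\cdot,X)\}$, $\widehat\mu_Y=E_n\{\kappa_Y(\cdot,Y)\}$, $\widehat\Sigma_{XX}=E_n[\{\kappa_X(\cdot,X)-\widehat\mu_X\}\otimes\{\kappa_X(\cdot,X)-\widehat\mu_X\}]$, $\widehat\Sigma_{XY}=E_n[\{\kappa_X(\cdot,X)-\widehat\mu_X\}\otimes\{\kappa_Y(\cdot,Y)-\widehat\mu_Y\}]$. Assumptions. 1. $\mathcal H_X$, $\mathcal H_Y$ are dense subsets of $L_2(P_X)$, $L_2(P_Y)$ modulo constants: for every $f\in L_2(P_X)$ there is $\{f_n\}\subset\mathcal H_X$ with $\mathrm{var}[f_n(X)-f(X)]\to0$, and similarly for $\mathcal H_Y$. 2. $\kappa_X$ and $\kappa_Y$ are bounded and continuous. 3. $\mathrm{ran}(\Sigma_{XY})\subseteq\mathrm{ran}(\Sigma_{XX})$. 4. $R_{XY}$ is a bounded operator. 5. The family of conditional distributions $\{P_{X|Y}(\cdot|y):y\in\Omega_Y\}$ is dominated by a $\sigma$-finite measure. 6. There exist $f_1,\dots,f_d\in\mathcal H_X$ such that $Y$ and $X$ are conditionally independent given $f_1(X),\dots,f_d(X)$, and $\sigma\{f_1(X),\dots,f_d(X)\}$ is minimal: whenever $g_1,\dots,g_{d'}\in\mathcal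 H_X$ are such that $Y$ and $X$ are conditionally independent given $g_1(X),\dots,g_{d'}(X)$, then $\sigma\{f_1(X),\dots,f_d(X)\}\subseteq\sigma\{g_1(X),\dots,g_{d'}(X)\}$. 7. $R_{XY}$ has rank $d$. 9. The eigenvalues $\lambda_1\ge\lambda_2\ge\cdots$ of $\Sigma_{XX}$ satisfy $\lambda_j\asymp j^{-\alpha}$ for all $j\in\mathbb N$ for some $\alpha>1$ (i.e. $\lambda_j/j^{-\alpha}$ and $j^{-\alpha}/\lambda_j$ are bounded). 10. There are $\beta>0$ and a bounded linear operator $S_{XY}:\mathcal H_Y\to\mathcal H_X$ with $\Sigma_{XY}=\Sigma_{XX}^{1+\beta}S_{XY}$. *)

(* Defs.v *)
From HB Require Import structures.
From mathcomp Require Import all_boot all_order all_algebra.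
From mathcomp Require Import all_classical all_reals all_analysis.

Set Implicit Arguments.
Unset Strict Implicit.
Unset Printing Implicit Defensive.

Import Order.TTheory GRing.Theory Num.Theory numFieldNormedType.Exports.

Local Open Scope classical_set_scope.
Local Open Scope ring_scope.

Notation borel T := (g_sigma_algebraType (@open T)).

Record hilbert (R : realType) := Hilbert {
  hspace :> completeNormedModType R ;
  hdot : {dot hspace for idfun} ;
  hdotE : forall u : hspace, hdot u u = `|u| ^+ 2 }.

Definition inner (R : realType) (U : hilbert R) (u v : U) : R := hdot U u v.

(* Reproducing kernel Hilbert space of functions on D: an element f stands for
   the function rk_eval f restricted to D, and rk_sec x is kappa(., x); the
   values of rk_eval f and rk_sec outside D carry no information. *)
Record rkhs (R : realType) (T : Type) (D : set T) (kappa : T -> T -> R) := Rkhs {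
  rk_space :> hilbert R ;
  rk_eval : rk_space -> T -> R ;
  rk_sec : T -> rk_space ;
  rk_evalP : forall (a : R) (f g : rk_space) x, D x ->
    rk_eval (a *: f + g) x = a * rk_eval f x + rk_eval g x ;
  rk_ext : forall f g : rk_space,
    (forall x, D x -> rk_eval f x = rk_eval g x) -> f = g ;
  rk_secE : forall x y, D x -> D y -> rk_eval (rk_sec y) x = kappa x y ;
  rk_reproducing : forall (f : rk_space) x, D x ->
    rk_eval f x = inner f (rk_sec x) }.

Definition pos_def_kernel (R : realType) (T : Type) (D : set T)
    (kappa : T -> T -> R) :=
  (forall x y, D x -> D y -> kappa x y = kappa y x) /\
  (forall (m : nat) (c : 'I_m -> R) (x : 'I_m -> T), (forall i, D (x i)) ->
    0 <= \sum_(i < m) \sum_(j < m) c i * c j * kappa (x i) (x j)).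

Section operators.
Context {R : realType}.
Implicit Types U V : hilbert R.

Definition tensor U V (u : U) (v : V) : V -> U := fun w => inner v w *: u.

Definition bounded_op U V (A : U -> V) := exists C : R, forall x, `|A x| <= C * `|x|.

(* adjoint, mp_inv and op_inv are total functions: they return the unique x with
   the stated property when there is one. Hence adjoint A is A^* for bounded
   linear A, mp_inv A is A^dagger : ran A -> (ker A)^perp (with value 0 off ran A),
   and op_inv A is the inverse of a bijective A. *)
Definition adjoint U V (A : U -> V) : V -> U := fun y =>
  xget 0 [set x : U | forall z, inner (A z) y = inner z x].

Definition mp_inv U V (A : U -> V) : V -> U := fun y =>
  xget 0 [set x : U | (forall z, A z = 0 -> inner x z = 0) /\ A x = y].

Definition op_inv U V (A : U -> V) : V -> U := fun y => xget 0 [set x : U | A x = y].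

Definition lin_span U (B : set U) : set U := [set v | exists (m : nat)
  (c : 'I_m -> R) (b : 'I_m -> U),
  (forall i, B (b i)) /\ v = \sum_(i < m) c i *: b i].

Definition has_rank U V (A : U -> V) (d : nat) := exists b : 'I_d -> V,
  (forall c : 'I_d -> R, \sum_(i < d) c i *: b i = 0 -> forall i, c i = 0) /\
  range A = lin_span (range b).

(* lam lists the nonzero eigenvalues of A (a self-adjoint compact nonnegative
   operator of infinite rank) in nonincreasing order with multiplicity, and e
   the matching orthonormal eigenvectors; the last clause says that nothing but
   the kernel is left out of the list. *)
Definition eigen_system U (A : U -> U) (lam : nat -> R) (e : nat -> U) :=
  [/\ forall i j, inner (e i) (e j) = (i == j)%:R,
      forall j, A (e j) = lam j *: e j,
      forall j, 0 < lam j,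
      forall i j, (i <= j)%N -> lam j <= lam i &
      forall f, (forall j, inner f (e j) = 0) -> A f = 0].

(* A^s f = sum_j lam_j^s <f, e_j> e_j, for an eigen_system lam e of A. *)
Definition spectral_power U (lam : nat -> R) (e : nat -> U) (s : R) : U -> U :=
  fun f => limn (series (fun j => (lam j `^ s * inner f (e j)) *: e j)).

Definition distinct_nonzero_eigenvalues U (A : U -> U) :=
  forall (l : R) (u v : U), l != 0 -> u != 0 ->
    A u = l *: u -> A v = l *: v -> exists c : R, v = c *: u.

Definition seq_maximizers U (D : set U) (A : U -> U) (d : nat) (phi : 'I_d -> U) :=
  forall k : 'I_d,
    let feasible (f : U) := [/\ D f, inner f f = 1 &
      forall j : 'I_d, (j < k)%N -> inner f (phi j) = 0] in
    feasible (phi k) /\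
    (forall f, feasible f -> inner f (A f) <= inner (phi k) (A (phi k))).

Definition emp_mean U (n : nat) (F : nat -> U) : U := n%:R^-1 *: \sum_(i < n) F i.

Definition emp_cov U V (n : nat) (F : nat -> U) (G : nat -> V) : V -> U := fun g =>
  n%:R^-1 *: \sum_(i < n) tensor (F i - emp_mean n F) (G i - emp_mean n G) g.

Definition emp_regression U V (n : nat) (eps : R)
    (F : nat -> U) (G : nat -> V) : V -> U :=
  op_inv (fun f => emp_cov n F F f + eps *: f) \o emp_cov n F G.

End operators.

Section stochastic.
Context {d} {Omega : measurableType d} {R : realType} (P : probability Omega R).

(* Expectation of a Hilbert-space valued random element in the weak (Pettis)
   sense, i.e. the Riesz representer of h |-> E<F, h>; covariance operators below are expectations of
   random operators taken pointwise. *)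
Definition hmean (U : hilbert R) (F : Omega -> U) : U :=
  xget 0 [set m : U | forall h : U,
    P.-integrable setT (fun w => (inner (F w) h)%:E) /\
    ('E_P[fun w => inner (F w) h] = (inner m h)%:E)%E].

Definition cov_op (U V : hilbert R) (F : Omega -> U) (G : Omega -> V) : V -> U :=
  fun g => hmean (fun w => tensor (F w - hmean F) (G w - hmean G) g).

Definition regression (U V : hilbert R) (F : Omega -> U) (G : Omega -> V) : V -> U :=
  mp_inv (cov_op F F) \o cov_op F G.

Definition cond_prob (G : set (set Omega)) (A : set Omega) (u : Omega -> R) :=
  [/\ forall B : set R, measurable B -> G (u @^-1` B),
      P.-integrable setT (EFin \o u) &
      forall C, G C -> (\int[P]_(w in C) (u w)%:E = P (A `&` C))%E].

Definition cond_indep d1 (T1 : measurableType d1) d2 (T2 : measurableType d2)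
    (X : Omega -> T1) (Y : Omega -> T2) (G : set (set Omega)) :=
  forall (A : set T1) (B : set T2), measurable A -> measurable B ->
  exists u v : Omega -> R,
    [/\ cond_prob G (X @^-1` A) u, cond_prob G (Y @^-1` B) v &
        cond_prob G (X @^-1` A `&` Y @^-1` B) (u \* v)].

(* Mutual independence of every finite subfamily follows from the initial
   segments by taking some of the C i to be the whole space. *)
Definition iid_copies d1 (T1 : measurableType d1)
    (Z : Omega -> T1) (Zs : nat -> Omega -> T1) :=
  (forall i (C : set T1), measurable C -> P (Zs i @^-1` C) = P (Z @^-1` C)) /\
  (forall (m : nat) (C : nat -> set T1), (forall i, measurable (C i)) ->
    P (\bigcap_(i < m) (Zs i @^-1` C i)) = (\prod_(i < m) P (Zs i @^-1` C i))%E).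

Definition dominated_cond_distr d1 (T1 : measurableType d1)
    d2 (T2 : measurableType d2) (X : Omega -> T1) (Y : Omega -> T2) (D : set T2) :=
  exists Q : R.-pker T2 ~> T1,
    (forall (A : set T1) (B : set T2), measurable A -> measurable B ->
      P (X @^-1` A `&` Y @^-1` B) = (\int[P]_(w in Y @^-1` B) Q (Y w) A)%E) /\
    exists nu : {measure set T1 -> \bar R},
      sigma_finite setT nu /\ forall y, D y -> Q y `<< nu.

(* Z_n = O_P(r_n); stated with a measurable superset of the exceptional event
   because nothing forces Z_n (built from arbitrarily selected maximizers) to be
   measurable. For measurable Z_n this is the usual definition. *)
Definition bigOp (Z : nat -> Omega -> R) (r : nat -> R) :=
  forall eta : R, 0 < eta -> exists C : R, \forall n \near \oo,
    exists E : set Omega, [/\ measurable E,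
      [set w | C * r n < `|Z n w|] `<=` E & (P E <= eta%:E)%E].

Section feature.
Context (p : nat) (D : set 'rV[R]_p) (kappa : 'rV[R]_p -> 'rV[R]_p -> R).
Context (H : rkhs D kappa) (X : {RV P >-> borel 'rV[R]_p}).

Definition bounded_kernel := exists C : R, forall x y, D x -> D y -> `|kappa x y| <= C.

Definition continuous_kernel :=
  {within D `*` D, continuous (fun z : 'rV[R]_p * 'rV[R]_p => kappa z.1 z.2)}.

Definition dense_L2_mod_constants :=
  forall f : borel 'rV[R]_p -> R, measurable_fun setT f ->
    (distribution P X).-integrable setT (fun x => (f x ^+ 2)%:E) ->
    exists fn : nat -> H,
      'V_P[fun w => rk_eval (fn n) (X w) - f (X w)] @[n --> \oo] --> 0%E.

Definition feature (w : Omega) : H := rk_sec H (X w).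

Definition centered_space : set H :=
  closure (lin_span [set rk_sec H x - hmean feature | x in D]).

Definition sigma_of (m : nat) (f : 'I_m -> H) : set (set Omega) :=
  g_sigma_preimage (fun i w => rk_eval (f i) (X w)).

End feature.

End stochastic.

Arguments centered_space {d Omega R P p D kappa} H X _.

(* Main.v *)
Require Import Defs.
From HB Require Import structures.
From mathcomp Require Import all_boot all_order all_algebra.
From mathcomp Require Import all_classical all_reals all_analysis.
From mathcomp Require Import measurable_realfun ring lra.

Set Implicit Arguments.
Unset Strict Implicit.
Unset Printing Implicit Defensive.

Import Order.TTheory GRing.Theory Num.Theory numFieldNormedType.Exports.

Local Open Scope classical_set_scope.
Local Open Scope ring_scope.

(** The rate is that of a Tikhonov-regularized regression in a Hilbert space,
    carried from operators to eigenvectors.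

    Stability of the maximizers. Sequential maximizers of a quadratic form over
    a subspace that contains the range of the operator are eigenvectors
    ([seq_maximizers_eigen]). Rank d makes the d values of the population
    problem positive and distinctness separates them, so Weyl's inequality and
    the spectral gap bound the distance between an empirical maximizer and the
    correctly signed population one by a constant times the distance of the
    regression operators ([regression_maximizers_stable]). That estimate is
    deterministic and needs no smallness, because two unit vectors are never
    further apart than 2.

    Error of the regression operator. Write S for the covariance operator of X,
    Sh for its empirical version, R for the regression operator and A for the
    resolvent (S + eps)^-1. The estimate x of R g solves
    (Sh + eps) x = Ch g, whence
      |x - R g| <= (1 + |Sh - S| / eps) |A (Ch g - Sh R g - eps R g)|
    ([resolvent_perturbation]). Since S R is the cross covariance, Ch - Sh R is
    an empirical covariance of the features of X with the residual
    Y-feature - R^* X-feature, which has mean zero ([emp_residual]).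

    - Bias: R g has coefficients lam_j^beta times those of a bounded operator,
      so eps A R g is of order eps^min(beta, 1) ([tikhonov_bias_op]).
    - Noise: A (Ch - Sh R) has expected squared Hilbert-Schmidt norm at most
      n^-1 times the sum of lam_j / (lam_j + eps)^2, which under polynomial
      decay is of order eps^-(1 + 1 / alpha) ([tensor_fluctuation],
      [resolvent_feature_second_moment], [polynomial_trace_bound]).
    - Sh - S is of order n^(-1/2) by the same second moment bound.

    The product of the two factors consists of the four terms of the rate
    ([regression_error_bound]).

    Two measurability points shape the development. The domains of the kernels
    are arbitrary sets, so sample points are regarded as random elements of the
    trace sigma-algebra ([trace_space]), for which kernel sections are
    measurable. Operator norms are replaced by sums of squares over countable
    total systems, which are measurable; such systems exist because the kernels
    are continuous on subsets of a separable space ([rkhs_countable_total]). *)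

(** * Inner products and bounded linear maps *)
Section inner_product.
Context {R : realType} {U : hilbert R}.
Implicit Types (a : R) (u v w : U).

Lemma innerC u v : inner u v = inner v u.
Proof. by rewrite /inner (hermC (hdot U)) expr0 mul1r. Qed.

Lemma innerPl a u v w : inner (a *: u + v) w = a * inner u w + inner v w.
Proof. by rewrite /inner linearPl. Qed.

Lemma innerDl u v w : inner (u + v) w = inner u w + inner v w.
Proof. by rewrite -{1}[u]scale1r innerPl mul1r. Qed.

Lemma inner0l w : inner 0 w = 0.
Proof. by rewrite /inner linear0l. Qed.

Lemma innerZl a u w : inner (a *: u) w = a * inner u w.
Proof. by rewrite -[a *: u]addr0 innerPl inner0l addr0. Qed.

Lemma innerNl u w : inner (- u) w = - inner u w.
Proof. by rewrite -scaleN1r innerZl mulN1r. Qed.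

Lemma innerBl u v w : inner (u - v) w = inner u w - inner v w.
Proof. by rewrite innerDl innerNl. Qed.

Lemma inner_suml I (r : seq I) (p : pred I) (f : I -> U) w :
  inner (\sum_(i <- r | p i) f i) w = \sum_(i <- r | p i) inner (f i) w.
Proof.
by apply: (big_morph (fun u => inner u w)) => [u v|]; rewrite ?innerDl ?inner0l.
Qed.

Lemma innerDr u v w : inner w (u + v) = inner w u + inner w v.
Proof. by rewrite innerC innerDl !(innerC _ w). Qed.

Lemma inner0r w : inner w 0 = 0.
Proof. by rewrite innerC inner0l. Qed.

Lemma innerZr a u w : inner w (a *: u) = a * inner w u.
Proof. by rewrite innerC innerZl innerC. Qed.

Lemma innerNr u w : inner w (- u) = - inner w u.
Proof. by rewrite innerC innerNl innerC. Qed.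

Lemma innerBr u v w : inner w (u - v) = inner w u - inner w v.
Proof. by rewrite innerDr innerNr. Qed.

Lemma inner_sumr I (r : seq I) (p : pred I) (f : I -> U) w :
  inner w (\sum_(i <- r | p i) f i) = \sum_(i <- r | p i) inner w (f i).
Proof. by rewrite innerC inner_suml; under eq_bigr do rewrite innerC. Qed.

Lemma inner_norm u : inner u u = `|u| ^+ 2.
Proof. exact: hdotE. Qed.

Lemma inner_ge0 u : 0 <= inner u u.
Proof. by rewrite inner_norm sqr_ge0. Qed.

Lemma inner_eq0 u : inner u u = 0 -> u = 0.
Proof. by rewrite inner_norm => /eqP; rewrite sqrf_eq0 normr_eq0 => /eqP. Qed.

Lemma inner_ext u v : (forall w, inner u w = inner v w) -> u = v.
Proof.
by move=> h; apply/subr0_eq/inner_eq0; rewrite innerBl h subrr.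
Qed.

Lemma norm_sqrD u v : `|u + v| ^+ 2 = `|u| ^+ 2 + 2 * inner u v + `|v| ^+ 2.
Proof. rewrite -!inner_norm innerDl !innerDr (innerC v u); ring. Qed.

Lemma norm_sqrB u v : `|u - v| ^+ 2 = `|u| ^+ 2 - 2 * inner u v + `|v| ^+ 2.
Proof. rewrite norm_sqrD innerNr normrN; ring. Qed.

Lemma inner_sqr_le u v : inner u v ^+ 2 <= `|u| ^+ 2 * `|v| ^+ 2.
Proof.
have [->|v0] := eqVneq v 0; first by rewrite inner0r normr0 !expr0n mulr0.
have v2 : 0 < `|v| ^+ 2 by rewrite exprn_gt0 ?normr_gt0.
have := inner_ge0 (u - (inner u v / `|v| ^+ 2) *: v).
rewrite innerBl !innerBr !innerZl !innerZr (innerC v u) !inner_norm.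
set a := inner u v; set b := `|v| ^+ 2 in v2 *; set c := `|u| ^+ 2.
have -> : c - a / b * a - (a / b * a - a / b * (a / b * b)) = (c * b - a ^+ 2) / b.
  by field; rewrite gt_eqF.
by rewrite pmulr_lge0 ?invr_gt0 // subr_ge0.
Qed.

Lemma inner_le u v : `|inner u v| <= `|u| * `|v|.
Proof.
rewrite -(@ler_pXn2r _ 2) ?nnegrE ?mulr_ge0 //.
by rewrite real_normK ?num_real // exprMn inner_sqr_le.
Qed.

Lemma inner_le_norm u v : inner u v <= `|u| * `|v|.
Proof. exact: le_trans (ler_norm _) (inner_le u v). Qed.

End inner_product.

Section linear_maps.
Context {R : realType}.

Section algebra.
Context {E F : lmodType R} {A : E -> F} (linA : linear A).

Lemma lin0 : A 0 = 0.
Proof.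
have := linA 1 0 0; rewrite !scale1r addr0 => /eqP.
by rewrite -subr_eq subrr eq_sym => /eqP.
Qed.

Lemma linD u v : A (u + v) = A u + A v.
Proof. by rewrite -{1}[u]scale1r linA scale1r. Qed.

Lemma linZ a u : A (a *: u) = a *: A u.
Proof. by rewrite -[a *: u]addr0 linA lin0 addr0. Qed.

Lemma linN u : A (- u) = - A u.
Proof. by rewrite -scaleN1r linZ scaleN1r. Qed.

Lemma linB u v : A (u - v) = A u - A v.
Proof. by rewrite linD linN. Qed.

Lemma lin_sum I (r : seq I) (p : pred I) (f : I -> E) :
  A (\sum_(i <- r | p i) f i) = \sum_(i <- r | p i) A (f i).
Proof. exact: (big_morph A linD lin0). Qed.

End algebra.

Lemma lin_cvg {E F : normedModType R} (A : E -> F) (u : nat -> E) (l : E) :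
  linear A -> (exists C, forall x, `|A x| <= C * `|x|) ->
  u @ \oo --> l -> (fun n => A (u n)) @ \oo --> A l.
Proof.
move=> linA [C bA] ul; apply/cvgrPdist_lt => e e0.
have C0 : 0 < `|C| + 1 by rewrite ltr_wpDl.
move/cvgrPdist_lt : ul => /(_ _ (divr_gt0 e0 C0)).
apply: filterS => n; rewrite ltr_pdivlMr // -(linB linA) => h.
apply: le_lt_trans (bA _) _; apply: le_lt_trans h; rewrite mulrC ler_wpM2l //.
by rewrite (le_trans (ler_norm _)) // lerDl.
Qed.

Lemma linear_innerl {U : hilbert R} (v : U) : linear (fun u => inner u v).
Proof. by move=> a x y; rewrite innerPl. Qed.

Lemma inner_cvgl {U : hilbert R} (u : nat -> U) (l v : U) :
  u @ \oo --> l -> (fun n => inner (u n) v) @ \oo --> inner l v.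
Proof.
apply: (@lin_cvg U R (fun x => inner x v)); first exact: linear_innerl.
by exists `|v| => x; rewrite mulrC inner_le.
Qed.

Lemma bounded_op_gt0 {U V : hilbert R} (A : U -> V) :
  bounded_op A -> exists2 C, 0 < C & forall x, `|A x| <= C * `|x|.
Proof.
move=> [C bA]; exists (`|C| + 1); first by rewrite ltr_wpDl.
move=> x; apply: le_trans (bA x) _; rewrite ler_wpM2r //.
by rewrite (le_trans (ler_norm _)) // lerDl.
Qed.

End linear_maps.

(** * Minimization of coercive quadratic functionals *)

(** The Cauchy criterion in the shape that parallelogram and Bessel estimates
    provide. *)
Lemma cauchy_sqr {R : realType} {V : completeNormedModType R} (x : nat -> V)
    (del : nat -> R) :
  del @ \oo --> (0 : R) -> (forall n m, `|x n - x m| ^+ 2 <= del n + del m) ->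
  cvgn x.
Proof.
move=> del0 xd; apply/cauchy_cvgP; apply: cauchy_exP => e e0.
have e2 : 0 < e ^+ 2 / 2 by rewrite divr_gt0 ?exprn_gt0.
move/cvgrPdist_lt : del0 => /(_ _ e2) [N _ HN].
exists (x N); exists N => // n /= Nn.
rewrite -ball_normE /ball_ /=.
rewrite -(@ltr_pXn2r _ 2) ?nnegrE ?normr_ge0 ?(ltW e0) //.
apply: le_lt_trans (xd _ _) _.
have := HN N (leqnn N); have := HN n Nn; rewrite /= !sub0r !normrN.
have := ler_norm (del N); have := ler_norm (del n); lra.
Qed.

Lemma sqr_cvg0 {R : realType} (g del : nat -> R) :
  del @ \oo --> (0 : R) -> (forall n, g n ^+ 2 <= del n) -> g @ \oo --> (0 : R).
Proof.
move=> del0 gd; apply/cvgrPdist_lt => e e0.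
move/cvgrPdist_lt : del0 => /(_ _ (exprn_gt0 2 e0)); apply: filterS => n.
rewrite !sub0r !normrN => h; rewrite -(@ltr_pXn2r _ 2) ?nnegrE ?(ltW e0) //.
rewrite real_normK ?num_real //; apply: le_lt_trans (gd n) _.
exact: le_lt_trans (ler_norm _) h.
Qed.

Lemma cvgM_harmonic {R : realType} (c : R) :
  (fun n : nat => c * n.+1%:R^-1) @ \oo --> (0 : R).
Proof.
by rewrite -[0 in X in _ --> X](mulr0 c); apply: cvgMl_tmp; exact: cvg_harmonic.
Qed.

Section variational.
Context {R : realType} {U : hilbert R}.
Implicit Types (K : set U) (B : U -> U) (L : U -> R).

(** The discriminant inequality; q + 1 in place of q covers a degenerate
    quadratic term. *)
Lemma quadratic_ge0_discr (d g q : R) : 0 <= q ->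
  (forall t, 0 <= d + 2 * t * g + t ^+ 2 * q) -> g ^+ 2 <= d * (q + 1).
Proof.
move=> q0 h; have q1 : 0 < q + 1 by rewrite ltr_wpDl.
have := h (- g / (q + 1)).
have -> : d + 2 * (- g / (q + 1)) * g + (- g / (q + 1)) ^+ 2 * q =
   (d * (q + 1) - g ^+ 2 - g ^+ 2 / (q + 1)) / (q + 1).
  by field; rewrite gt_eqF.
rewrite pmulr_lge0 ?invr_gt0 // => h2.
have : 0 <= g ^+ 2 / (q + 1) by rewrite divr_ge0 ?sqr_ge0 // ltW.
lra.
Qed.

(** Minimize <Bx, x> - 2 L x over K: coercivity and the parallelogram identity
    make minimizing sequences Cauchy, and the first variation vanishes at the
    limit. The Riesz representation, orthogonal projections and the solvability
    of regularized equations are all instances. *)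
Lemma coercive_solution K B L (c : R) :
  K 0 -> (forall a x y, K x -> K y -> K (a *: x + y)) -> closed K ->
  linear B -> bounded_op B -> (forall x y, inner (B x) y = inner x (B y)) ->
  0 < c -> (forall x, c * `|x| ^+ 2 <= inner (B x) x) ->
  linear (L : U -> R^o) -> (exists C, forall x, `|L x| <= C * `|x|) ->
  exists2 x, K x & forall h, K h -> inner (B x) h = L h.
Proof.
move=> K0 Klin Kcl linB_ bB symB c0 cB linL bL.
have [C' C'0 hL] : exists2 C, 0 < C & forall x, `|L x| <= C * `|x|.
  have [C hC] := bL; exists (`|C| + 1); first by rewrite ltr_wpDl.
  move=> x; apply: le_trans (hC x) _; rewrite ler_wpM2r //.
  by rewrite (le_trans (ler_norm _)) // lerDl.
pose J x := inner (B x) x - 2 * L x.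
have JD x h t : J (x + t *: h) =
    J x + 2 * t * (inner (B x) h - L h) + t ^+ 2 * inner (B h) h.
  rewrite /J (linD linB_) (linZ linB_) (linD linL) (linZ linL) innerDl !innerDr.
  rewrite !innerZl !innerZr /GRing.scale /= (_ : inner (B h) x = inner (B x) h).
    by ring.
  by rewrite symB innerC.
have Jlb x : - (C' ^+ 2 / c) <= J x.
  rewrite /J; apply: le_trans (_ : c * `|x| ^+ 2 - 2 * (C' * `|x|) <= _).
    have : 0 <= (c * `|x| - C') ^+ 2 / c by rewrite divr_ge0 ?sqr_ge0 // ltW.
    have -> : (c * `|x| - C') ^+ 2 / c = c * `|x| ^+ 2 - 2 * (C' * `|x|) + C' ^+ 2 / c.
      by field; rewrite gt_eqF.
    lra.
  have := cB x; have := hL x; have := ler_norm (L x); lra.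
pose S := [set J x | x in K].
have hS : has_inf S.
  split; first by exists (J 0); exists 0.
  by exists (- (C' ^+ 2 / c)) => _ [x _ <-].
have [x xP] : {x : nat -> U & forall n, K (x n) /\ J (x n) < inf S + n.+1%:R^-1}.
  apply: (@choice _ _ (fun n y => K y /\ J y < inf S + n.+1%:R^-1)) => n.
  have n0 : 0 < n.+1%:R^-1 :> R by rewrite invr_gt0.
  have [_ [y Ky <-] h] := inf_adherent n0 hS.
  by exists y.
have infS y : K y -> inf S <= J y.
  by move=> Ky; apply: ge_inf; [exact: hS.2|exists y].
(* Compare J at x n and x m with its value at their midpoint. *)
have xd n m : c / 4 * `|x n - x m| ^+ 2 <= n.+1%:R^-1 + m.+1%:R^-1.
  have [Kn Jn] := xP n; have [Km Jm] := xP m.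
  have Kmid : K (x m + 2^-1 *: (x n - x m)).
    have -> : x m + 2^-1 *: (x n - x m) = 2^-1 *: x n + (2^-1 *: x m + 0).
      rewrite scalerBr addr0 addrCA; congr (_ + _).
      rewrite -{1}[x m]scale1r -scalerBl; congr (_ *: _); lra.
    by apply: (Klin) => //; apply: Klin.
  have := infS _ Kmid; rewrite JD.
  have := JD (x m) (x n - x m) 1; rewrite scale1r addrC subrK => e1.
  have := cB (x n - x m).
  have : 0 <= c * `|x n - x m| ^+ 2 by rewrite mulr_ge0 ?sqr_ge0 // ltW.
  move: e1 Jn Jm; move: (J _) (J _) (inf S) => Jn Jm i0.
  move: (n.+1%:R^-1) (m.+1%:R^-1) (`|_| ^+ 2) (inner (B (x n - x m)) _) => a b N q.
  move: (inner _ _ - _) => g; lra.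
have xc : cvgn x.
  apply: (@cauchy_sqr _ _ x (fun n => 4 / c * n.+1%:R^-1)).
    exact: cvgM_harmonic.
  move=> n m; rewrite -mulrDr -ler_pdivrMl ?divr_gt0 //.
  by apply: le_trans (xd n m); rewrite invf_div.
exists (limn x).
  by apply: closed_cvg xc => //; apply: nearW => n; exact: (xP n).1.
move=> h Kh.
pose g n := inner (B (x n)) h - L h.
have gl : g @ \oo --> inner (B (limn x)) h - L h.
  apply: cvgB; last exact: cvg_cst.
  apply: (@lin_cvg _ U R (fun y => inner (B y) h)) xc.
    by move=> a u v; rewrite linB_ innerPl.
  have [D bD] := bB; exists (D * `|h|) => y.
  by rewrite mulrAC (le_trans (inner_le _ _)) // ler_wpM2r.
have g0 : g @ \oo --> (0 : R).
  have q0 : 0 <= inner (B h) h.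
    by apply: le_trans (cB h); rewrite mulr_ge0 // ?ltW // sqr_ge0.
  apply: (@sqr_cvg0 _ g (fun n => (inner (B h) h + 1) * n.+1%:R^-1)).
    exact: cvgM_harmonic.
  move=> n; rewrite mulrC; apply: quadratic_ge0_discr => // t.
  have [Kn Jn] := xP n.
  have : inf S <= J (x n + t *: h).
    by apply: infS; rewrite addrC; exact: Klin.
  by move: Jn; rewrite JD /g; move: (n.+1%:R^-1) => a; lra.
by apply/eqP; rewrite -subr_eq0; apply/eqP; apply: cvg_unique gl g0.
Qed.

End variational.

(** * Representation, projection, resolvents and adjoints *)
Section riesz.
Context {R : realType} {U : hilbert R}.
Implicit Types (K : set U) (B : U -> U).

Definition closed_subspace K :=
  [/\ K 0, forall a x y, K x -> K y -> K (a *: x + y) & closed K].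

Definition psd_op B :=
  [/\ linear B, bounded_op B, forall x y, inner (B x) y = inner x (B y) &
      forall x, 0 <= inner (B x) x].

Lemma closed_subspaceT : closed_subspace [set: U].
Proof. by split => //; exact: closedT. Qed.

Lemma riesz (L : U -> R) :
  linear (L : U -> R^o) -> (exists C, forall x, `|L x| <= C * `|x|) ->
  exists m : U, forall h, inner m h = L h.
Proof.
move=> linL bL; have [K0 Kl Kc] := closed_subspaceT.
have [m _ hm] : exists2 m : U, setT m & forall h, setT h -> inner m h = L h.
  apply: (@coercive_solution R U setT (fun x => x) L 1 K0 Kl Kc) => //.
    by exists 1 => x; rewrite mul1r.
  by move=> x; rewrite mul1r inner_norm.
by exists m => h; apply: hm.
Qed.

Lemma orthogonal_projection K (y : U) : closed_subspace K ->
  exists2 x, K x & forall h, K h -> inner x h = inner y h.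
Proof.
move=> [K0 Kl Kc].
apply: (@coercive_solution R U K (fun x => x) (inner y) 1 K0 Kl Kc) => //.
- by exists 1 => x; rewrite mul1r.
- by move=> x; rewrite mul1r inner_norm.
- by move=> a u v; rewrite innerDr innerZr.
- by exists `|y| => x; exact: inner_le.
Qed.

(** The residual of the projection onto K is one of the functionals f, so it is
    orthogonal to x as well as to K. *)
Lemma closed_subspace_biorth K (x : U) : closed_subspace K ->
  (forall f, (forall h, K h -> inner f h = 0) -> inner f x = 0) -> K x.
Proof.
move=> Kcs Kx; have [z Kz zx] := orthogonal_projection x Kcs.
have h0 h : K h -> inner (x - z) h = 0 by move=> Kh; rewrite innerBl zx ?subrr.
suff -> : x = z by [].
by apply/subr0_eq/inner_eq0; rewrite innerBr (Kx _ h0) h0 // subrr.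
Qed.

Lemma resolvent_exists B (eps : R) (y : U) : psd_op B -> 0 < eps ->
  exists x, B x + eps *: x = y.
Proof.
move=> [linB_ bB symB B0] e0; have [K0 Kl Kc] := closed_subspaceT.
have [x _ hx] : exists2 x : U, setT x &
    forall h, setT h -> inner (B x + eps *: x) h = inner y h; last first.
  by exists x; apply: inner_ext => w; exact: hx.
apply: (@coercive_solution R U setT (fun x => B x + eps *: x)
  (inner y) eps K0 Kl Kc) => //.
- move=> a u v; rewrite linB_ !scalerDr !addrA; congr (_ + _).
  by rewrite scalerA mulrC -scalerA addrAC.
- have [C bC] := bB; exists (C + eps) => x; apply: le_trans (ler_normD _ _) _.
  by rewrite mulrDl lerD // normrZ gtr0_norm.
- by move=> u v; rewrite innerDl innerDr symB innerZl innerZr.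
- by move=> x; rewrite innerDl innerZl inner_norm lerDr.
- by move=> a u v; rewrite innerDr innerZr.
- by exists `|y| => x; exact: inner_le.
Qed.

Lemma resolvent_le B (eps : R) (x : U) : psd_op B -> 0 < eps ->
  eps * `|x| <= `|B x + eps *: x|.
Proof.
move=> [_ _ _ B0] e0; have [->|x0] := eqVneq x 0; first by rewrite normr0 mulr0.
rewrite -(ler_pM2r (_ : 0 < `|x|)) ?normr_gt0 //.
apply: le_trans (inner_le_norm _ _).
by rewrite innerDl innerZl inner_norm -mulrA lerDr.
Qed.

Lemma op_inv_resolvent B (eps : R) (y : U) : psd_op B -> 0 < eps ->
  let x := op_inv (fun f => B f + eps *: f) y in B x + eps *: x = y.
Proof.
move=> psdB e0 /=; rewrite /op_inv.
by have := xgetPex 0 (resolvent_exists y psdB e0).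
Qed.

Lemma resolvent_inj B (eps : R) (x y : U) : psd_op B -> 0 < eps ->
  B x + eps *: x = B y + eps *: y -> x = y.
Proof.
move=> psdB e0 xy; have [linB_ _ _ _] := psdB.
apply/subr0_eq/eqP; rewrite -normr_eq0; apply/eqP/le_anti/andP; split => //.
rewrite -(pmulr_rle0 _ e0); apply: le_trans (resolvent_le _ psdB e0) _.
by rewrite (linB linB_) scalerBr addrACA -opprD xy subrr normr0.
Qed.

End riesz.

Section adjoint.
Context {R : realType} {U V : hilbert R} (A : U -> V).
Hypothesis (linA : linear A) (bA : bounded_op A).

Lemma adjointE z y : inner (A z) y = inner z (adjoint A y).
Proof.
rewrite /adjoint.
suff ex : exists x : U, forall z, inner (A z) y = inner z x.
  by have /= := xgetPex 0 ex.
have [||m hm] := @riesz R U (fun z => inner (A z) y).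
- by move=> a u v; rewrite linA innerPl.
- have [C bC] := bA; exists (C * `|y|) => x.
  by rewrite mulrAC; apply: le_trans (inner_le _ _) _; rewrite ler_wpM2r.
by exists m => x; rewrite (innerC x) hm.
Qed.

Lemma adjoint_linear : linear (adjoint A).
Proof.
move=> a u v; apply: inner_ext => w.
by rewrite innerPl !(innerC _ w) -!adjointE innerDr innerZr.
Qed.

Lemma adjoint_le C : 0 <= C -> (forall x, `|A x| <= C * `|x|) ->
  forall y, `|adjoint A y| <= C * `|y|.
Proof.
move=> C0 bC y; have [->|x0] := eqVneq (adjoint A y) 0.
  by rewrite normr0 mulr_ge0.
rewrite -(ler_pM2r (_ : 0 < `|adjoint A y|)) ?normr_gt0 //.
rewrite -expr2 -inner_norm -adjointE; apply: le_trans (inner_le_norm _ _) _.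
by rewrite mulrAC; apply: ler_wpM2r.
Qed.

Lemma adjoint_bounded : bounded_op (adjoint A).
Proof.
by have [C C0 bC] := bounded_op_gt0 bA; exists C; apply: adjoint_le; rewrite // ltW.
Qed.

End adjoint.

(** * Orthonormal systems *)
Section ortho_systems.
Context {R : realType} {U : hilbert R}.
Implicit Types (g : nat -> U) (c : nat -> R).

(** Zero vectors are allowed, so that Gram-Schmidt needs no independence. *)
Definition ortho_sys g := (forall i j, i != j -> inner (g i) (g j) = 0) /\
  forall i, inner (g i) (g i) = 1 \/ g i = 0.

(** The dual description of the closed span of g, which involves no limit. *)
Definition spanned_by g (x : U) :=
  forall f, (forall i, inner f (g i) = 0) -> inner f x = 0.

Definition total_sys g := forall x, spanned_by g x.

Lemma ortho_sum_inner g c n j : ortho_sys g ->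
  inner (\sum_(i < n) c i *: g i) (g j) = (j < n)%:R * (c j * inner (g j) (g j)).
Proof.
move=> [og _]; rewrite inner_suml; case: (ltnP j n) => jn.
  rewrite (bigD1 (Ordinal jn)) //= innerZl big1 ?addr0 ?mul1r // => i ij.
  by rewrite innerZl og ?mulr0 //; move: ij; rewrite -val_eqE.
rewrite mul0r big1 // => i _; rewrite innerZl og ?mulr0 //.
by rewrite neq_ltn (leq_trans (ltn_ord i)).
Qed.

Lemma ortho_coefE g x i : ortho_sys g ->
  inner x (g i) * inner (g i) (g i) = inner x (g i).
Proof. by move=> [_ /(_ i)[->|->]]; rewrite ?mulr1 // !inner0r mulr0. Qed.

Lemma ortho_gg g i : ortho_sys g -> 0 <= inner (g i) (g i) <= 1.
Proof. by move=> [_ /(_ i)[->|->]]; rewrite ?inner0r lexx ler01. Qed.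

Lemma ortho_sum_norm g c n : ortho_sys g ->
  `|\sum_(i < n) c i *: g i| ^+ 2 = \sum_(i < n) c i ^+ 2 * inner (g i) (g i).
Proof.
move=> og; rewrite -inner_norm inner_sumr; apply: eq_bigr => i _.
by rewrite innerZr ortho_sum_inner // ltn_ord mul1r mulrA expr2.
Qed.

Lemma bessel g x n : ortho_sys g ->
  \sum_(i < n) inner x (g i) ^+ 2 <= `|x| ^+ 2.
Proof.
move=> og; pose s := \sum_(i < n) inner x (g i) *: g i.
have xs : inner x s = \sum_(i < n) inner x (g i) ^+ 2.
  by rewrite inner_sumr; apply: eq_bigr => i _; rewrite innerZr expr2.
have := sqr_ge0 `|x - s|; rewrite norm_sqrB xs.
rewrite (ortho_sum_norm (fun i => inner x (g i))) //.
under [X in _ + X]eq_bigr => i _ do rewrite expr2 -mulrA ortho_coefE // -expr2.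
lra.
Qed.

(** The squared norms of the partial sums increase and stay below M, and their
    increments are the squared distances between partial sums. *)
Lemma ortho_series_cvg g c M : ortho_sys g ->
  (forall n, \sum_(i < n) c i ^+ 2 <= M) ->
  cvgn (fun n => \sum_(i < n) c i *: g i).
Proof.
move=> og cM; pose s n := \sum_(i < n) c i ^+ 2 * inner (g i) (g i).
have t0 i : 0 <= c i ^+ 2 * inner (g i) (g i) by rewrite mulr_ge0 ?sqr_ge0 ?inner_ge0.
have sS n : s n <= s n.+1 by rewrite /s big_ord_recr /= lerDl.
have snd : nondecreasing_seq s by exact/nondecreasing_seqP.
have sc : cvgn s.
  apply: nondecreasing_is_cvgn => //; exists M => _ [n _ <-].
  apply: le_trans (cM n); apply: ler_sum => i _.
  by rewrite ler_piMr ?sqr_ge0 //; have /andP[] := ortho_gg i og.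
have sl n : s n <= limn s by exact: nondecreasing_cvgn_le.
apply: (@cauchy_sqr _ _ _ (fun n => limn s - s n)).
  have : (fun n => limn s - s n) @ \oo --> limn s - limn s.
    by apply: cvgB; [exact: cvg_cst | exact: sc].
  by rewrite subrr.
have diff n m : (n <= m)%N ->
    `|(\sum_(i < m) c i *: g i) - \sum_(i < n) c i *: g i| ^+ 2 = s m - s n.
  move=> nm; rewrite norm_sqrB !ortho_sum_norm // -/(s m) -/(s n).
  rewrite inner_sumr.
  have -> : \sum_(i < n) inner (\sum_(i < m) c i *: g i) (c i *: g i) = s n.
    apply: eq_bigr => i _; rewrite innerZr ortho_sum_inner //.
    by rewrite (leq_trans (ltn_ord i)) // mul1r mulrA expr2.
  ring.
move=> n m; have := sl n; have := sl m; case/orP: (leq_total n m) => nm.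
  by rewrite distrC diff //; lra.
by rewrite diff //; lra.
Qed.

(** The limit y of the series has the coefficients of x, so x - y is orthogonal
    to g, hence to x and to y. *)
Lemma fourier_cvg g x : ortho_sys g -> spanned_by g x ->
  (fun n => \sum_(i < n) inner x (g i) *: g i) @ \oo --> x.
Proof.
move=> og gx; have h : cvgn (fun n => \sum_(i < n) inner x (g i) *: g i).
  apply: (@ortho_series_cvg g (fun i => inner x (g i)) (`|x| ^+ 2)) => // n.
  exact: bessel.
set y := limn (fun n => \sum_(i < n) inner x (g i) *: g i) in h *.
suff xy : x = y by rewrite [X in _ --> X]xy.
have yg j : inner y (g j) = inner x (g j).
  have c1 := inner_cvgl (v := g j) h.
  suff c2 : inner (\sum_(i < n) inner x (g i) *: g i) (g j) @[n --> \oo] -->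
      inner x (g j) by apply: cvg_unique c1 c2.
  apply: cvg_near_cst; exists j.+1 => // n /= jn.
  by rewrite (ortho_sum_inner (fun i => inner x (g i))) // jn mul1r ortho_coefE.
have x0 : inner (x - y) x = 0.
  by apply: gx => i; rewrite innerBl yg subrr.
have y0 : inner (x - y) y = 0.
  have c1 := inner_cvgl (v := x - y) h.
  rewrite innerC.
  suff c2 : inner (\sum_(i < n) inner x (g i) *: g i) (x - y) @[n --> \oo] -->
      (0 : R) by apply: cvg_unique c1 c2.
  apply: cvg_near_cst; exists 0%N => // n _.
  rewrite inner_suml big1 // => i _.
  by rewrite innerZl innerBr !(innerC (g i)) yg subrr mulr0.
by apply/subr0_eq/inner_eq0; rewrite innerBr x0 y0 subrr.
Qed.

Lemma parseval_cvg g x y : ortho_sys g -> spanned_by g x ->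
  (fun n => \sum_(i < n) inner x (g i) * inner y (g i)) @ \oo --> inner x y.
Proof.
move=> og gx; have := inner_cvgl (v := y) (fourier_cvg og gx).
apply: cvg_trans; apply: near_eq_cvg; near=> n.
rewrite inner_suml; apply: eq_bigr => i _.
by rewrite innerZl (innerC y).
Unshelve. all: by end_near.
Qed.

Lemma parseval g x : ortho_sys g -> spanned_by g x ->
  (\sum_(i <oo) (inner x (g i) ^+ 2)%:E = (`|x| ^+ 2)%:E)%E.
Proof.
move=> og gx; apply: cvg_lim => //.
rewrite -inner_norm.
under eq_fun do rewrite sumEFin big_mkord.
apply: cvg_EFin; first exact: nearW.
exact: parseval_cvg.
Qed.

End ortho_systems.

(** * Maximizers of a quadratic form and their perturbation *)
Section finite_families.
Context {R : realType}.

(** Fewer equations than unknowns: the source of every dimension count below. *)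
Lemma left_kernel_vector m k (N : 'I_m -> 'I_k -> R) : (k < m)%N ->
  exists2 c : 'I_m -> R, (exists i, c i != 0) &
    forall j, \sum_(i < m) c i * N i j = 0.
Proof.
move=> km; pose Q := \matrix_(i, j) N i j.
have : kermx Q != 0.
  rewrite kermx_eq0 /row_free neq_ltn; apply/orP; left.
  exact: leq_ltn_trans (rank_leq_col _) km.
case/rowV0Pn => v /sub_kermxP vQ v0.
exists (fun i => v 0 i).
  apply: contrapT => h; move/negP: v0; apply; apply/eqP/rowP => i.
  by rewrite mxE; apply: contrapT => /eqP vi; apply: h; exists i.
move=> j; have /rowP /(_ j) := vQ; rewrite !mxE => vj; rewrite -[RHS]vj.
by apply: eq_bigr => i _; rewrite !mxE.
Qed.

Lemma positive_family_lb (I : finType) (F : I -> R) : (forall i, 0 < F i) ->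
  exists2 m, 0 < m & forall i, m <= F i.
Proof.
move=> F0; have s0 : 0 <= \sum_i (F i)^-1.
  by apply: sumr_ge0 => i _; rewrite invr_ge0 ltW.
exists (1 + \sum_i (F i)^-1)^-1; first by rewrite invr_gt0 ltr_wpDr.
move=> i; rewrite -[F i]invrK lef_pV2 ?posrE ?invr_gt0 ?ltr_wpDr //.
rewrite (bigD1 i) //= addrCA lerDl addr_ge0 //.
by apply: sumr_ge0 => k _; rewrite invr_ge0 ltW.
Qed.

Context {U : hilbert R}.

Definition orthonormal_fam d (phi : 'I_d -> U) :=
  forall i j, inner (phi i) (phi j) = (i == j)%:R.

Lemma orthonormal_fam_coef d (phi : 'I_d -> U) c k : orthonormal_fam phi ->
  inner (\sum_(i < d) c i *: phi i) (phi k) = c k.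
Proof.
move=> on; rewrite inner_suml (bigD1 k) //= innerZl on eqxx mulr1 big1 ?addr0 //.
by move=> i ik; rewrite innerZl on (negPf ik) mulr0.
Qed.

Lemma pythagoras d (phi : 'I_d -> U) y : orthonormal_fam phi ->
  `|y| ^+ 2 = \sum_k inner y (phi k) ^+ 2 +
    `|y - \sum_k inner y (phi k) *: phi k| ^+ 2.
Proof.
move=> on; rewrite norm_sqrB inner_sumr -[X in _ - _ + X]inner_norm inner_sumr.
under [X in _ + (_ + X)]eq_bigr => k _ do
  rewrite innerZr (orthonormal_fam_coef (fun k => inner y (phi k))) // -expr2.
under [X in _ - 2 * X]eq_bigr => k _ do rewrite innerZr -expr2.
ring.
Qed.

Lemma lin_span_range d (b : 'I_d -> U) v : lin_span (range b) v ->
  exists c : 'I_d -> R, v = \sum_(i < d) c i *: b i.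
Proof.
move=> [m [c [b' [hb ->]]]].
have [s hs] : {s : 'I_m -> 'I_d & forall i, b (s i) = b' i}.
  by apply: (@choice _ _ (fun i k => b k = b' i)) => i; have [k _ hk] := hb i; exists k.
exists (fun k => \sum_(i < m | s i == k) c i).
under [RHS]eq_bigr do rewrite scaler_suml.
rewrite [LHS](partition_big s xpredT) //=; apply: eq_bigr => k _.
by apply: eq_bigr => i /eqP <-; rewrite hs.
Qed.

End finite_families.

Section maximizers.
Context {R : realType} {U : hilbert R} (K : set U) (M : U -> U).
Context (d : nat) (phi : 'I_d -> U).
Hypothesis Klin : forall a x y, K x -> K y -> K (a *: x + y).
Hypothesis K0 : K 0.
Hypothesis psdM : psd_op M.
Hypothesis KM : forall x, K (M x).
Hypothesis max_phi : seq_maximizers K M phi.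

Definition rayleigh_value (k : 'I_d) := inner (phi k) (M (phi k)).
Local Notation nu := rayleigh_value.

Lemma seq_maximizers_orthonormal : orthonormal_fam phi.
Proof.
move=> i j; have [[_ ni oi] _] := max_phi i; have [[_ nj oj] _] := max_phi j.
have [ij|ij|/ord_inj ij] := ltngtP i j.
- by rewrite innerC oj // -val_eqE /= ltn_eqF.
- by rewrite oi // -val_eqE /= gtn_eqF.
- by rewrite ij eqxx nj.
Qed.

(** Normalizing f makes it feasible for the k-th problem. *)
Lemma rayleigh_le (k : 'I_d) f : K f -> (forall j : 'I_d, (j < k)%N -> inner f (phi j) = 0) ->
  inner f (M f) <= nu k * `|f| ^+ 2.
Proof.
move=> Kf of_; have [->|f0] := eqVneq f 0.
  by rewrite inner0l normr0 expr0n mulr0.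
have n0 : `|f| != 0 by rewrite normr_eq0.
have [_ /(_ (`|f|^-1 *: f))] := max_phi k.
have [lM _ _ _] := psdM.
rewrite (linZ lM) !innerZl !innerZr inner_norm => h.
have -> : inner f (M f) = (`|f|^-1 * (`|f|^-1 * inner f (M f))) * `|f| ^+ 2 by field.
apply: ler_wpM2r; first exact: sqr_ge0.
apply: h; split.
- by rewrite -[_ *: f]addr0; apply: Klin.
- by field.
- by move=> j jk; rewrite innerZl of_ ?mulr0.
Qed.

Lemma rayleigh_value_anti (i j : 'I_d) : (i <= j)%N -> nu j <= nu i.
Proof.
move=> ij; have [[Kj nj oj] _] := max_phi j; have [_ hi] := max_phi i.
by apply: hi; split => // k ki; apply: oj; exact: leq_trans ki ij.
Qed.

(** First-order condition: the residual M phi - nu phi is itself an admissible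
    direction, so it vanishes. *)
Lemma seq_maximizers_eigen (k : 'I_d) : M (phi k) = nu k *: phi k.
Proof.
have [lM _ sM _] := psdM.
have [n] := ubnP k; elim: n k => // n IH k; rewrite ltnS => kn.
have [[Kk nk ok] _] := max_phi k.
have var h : K h -> (forall j : 'I_d, (j <= k)%N -> inner h (phi j) = 0) ->
    inner (M (phi k)) h = 0.
  move=> Kh oh.
  (* The absolute value gives a nonnegative quadratic coefficient without
     knowing the sign of the second variation. *)
  have q0 : 0 <= `|nu k * `|h| ^+ 2 - inner h (M h)| by exact: normr_ge0.
  have := @quadratic_ge0_discr _ 0 (- inner (M (phi k)) h) _ q0.
  rewrite mul0r sqrrN => H; apply/eqP; rewrite -sqrf_eq0; apply/eqP/le_anti.
  rewrite sqr_ge0 andbT; apply: H => t.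
  have orth (j : 'I_d) : (j < k)%N -> inner (t *: h + phi k) (phi j) = 0.
    by move=> jk; rewrite innerDl innerZl oh ?(ltnW jk) // ok // mulr0 addr0.
  have := rayleigh_le (Klin t Kh Kk) orth.
  rewrite (linD lM) (linZ lM) -inner_norm.
  rewrite !(innerDl, innerDr, innerZl, innerZr) (oh k) // (innerC (phi k) h) (oh k) //.
  rewrite nk -/(nu k) (innerC h (M (phi k))) -(sM (phi k) h) inner_norm.
  have : t ^+ 2 * (nu k * `|h| ^+ 2 - inner h (M h)) <=
      t ^+ 2 * `|nu k * `|h| ^+ 2 - inner h (M h)|.
    by rewrite ler_wpM2l ?sqr_ge0 // ler_norm.
  lra.
have orth (j : 'I_d) : (j <= k)%N -> inner (M (phi k) - nu k *: phi k) (phi j) = 0.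
  rewrite leq_eqVlt => /orP[/eqP/ord_inj ->|jk].
    by rewrite innerBl innerZl nk mulr1 (innerC _ (phi k)) subrr.
  rewrite innerBl innerZl ok // mulr0 subr0 sM IH ?(leq_trans jk) //.
  by rewrite innerZr ok // mulr0.
have Kg : K (M (phi k) - nu k *: phi k).
  by rewrite addrC -scaleNr; apply: Klin.
apply/subr0_eq/inner_eq0; rewrite {1}innerBl innerZl var //.
by rewrite innerC orth // mulr0 subrr.
Qed.

End maximizers.

Section perturbation.
Context {R : realType} {U : hilbert R} (K : set U) (d : nat).
Hypothesis Klin : forall a x y, K x -> K y -> K (a *: x + y).
Hypothesis K0 : K 0.

Lemma subspace_sum (I : finType) (c : I -> R) (b : I -> U) :
  (forall i, K (b i)) -> K (\sum_i c i *: b i).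
Proof.
move=> Kb; apply: (@big_rec _ K) => [|i x _ Kx]; [exact: K0 | exact: Klin].
Qed.

(** Weyl: some nonzero combination of the first j+1 vectors of phi meets
    the j constraints that define phi' j. *)
Lemma rayleigh_value_weyl (M M' : U -> U) (phi phi' : 'I_d -> U) (del : R)
    (j : 'I_d) :
  psd_op M -> (forall x, K (M x)) -> seq_maximizers K M phi ->
  psd_op M' -> seq_maximizers K M' phi' ->
  (forall x, `|M x - M' x| <= del * `|x|) ->
  rayleigh_value M phi j <= rayleigh_value M' phi' j + del.
Proof.
move=> psdM KM mphi psdM' mphi' MM'.
have on := seq_maximizers_orthonormal mphi.
pose w := widen_ord (ltn_ord j) : 'I_j.+1 -> 'I_d.
pose w' := widen_ord (ltnW (ltn_ord j)) : 'I_j -> 'I_d.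
have [c [i0 ci0] hc] := left_kernel_vector
  (fun i k => inner (phi (w i)) (phi' (w' k))) (ltnSn j).
pose f := \sum_(i < j.+1) c i *: phi (w i).
have onw : orthonormal_fam (phi \o w).
  by move=> i k; rewrite /= on -!val_eqE.
have Kf : K f by apply: subspace_sum => i; have [[]] := mphi (w i).
have fn : `|f| ^+ 2 = \sum_(i < j.+1) c i ^+ 2.
  rewrite -inner_norm {2}/f inner_sumr; apply: eq_bigr => i _.
  by rewrite innerZr (orthonormal_fam_coef c) // expr2.
have f0 : 0 < `|f| ^+ 2.
  rewrite fn (bigD1 i0) //= ltr_pwDl ?exprn_even_gt0 //.
  by apply: sumr_ge0 => i _; rewrite sqr_ge0.
have fM' : inner f (M' f) <= rayleigh_value M' phi' j * `|f| ^+ 2.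
  apply: (rayleigh_le Klin K0 psdM' mphi') => // k kj.
  have -> : k = w' (Ordinal kj) by exact: val_inj.
  rewrite inner_suml -[RHS](hc (Ordinal kj)).
  by apply: eq_bigr => i _; rewrite innerZl.
have fM : rayleigh_value M phi j * `|f| ^+ 2 <= inner f (M f).
  rewrite fn mulr_sumr; have [lM _ _ _] := psdM.
  rewrite [in M f]/f (lin_sum lM) inner_sumr; apply: ler_sum => i _.
  rewrite (linZ lM) (seq_maximizers_eigen Klin K0 psdM KM mphi) !innerZr.
  rewrite (orthonormal_fam_coef c) // [leRHS](_ : _ =
    rayleigh_value M phi (w i) * c i ^+ 2); last by rewrite mulrCA expr2.
  rewrite ler_wpM2r ?sqr_ge0 //.
  by apply: (rayleigh_value_anti mphi); exact: (ltn_ord i).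
have : inner f (M f) - inner f (M' f) <= del * `|f| ^+ 2.
  rewrite -innerBr; apply: le_trans (inner_le_norm _ _) _.
  by rewrite mulrC expr2 mulrA ler_wpM2r.
by move=> h; rewrite -(ler_pM2r f0) mulrDl; lra.
Qed.

Lemma maximizer_dist_le2 (u v : U) : inner u u = 1 -> inner v v = 1 ->
  `|u - Num.sg (inner u v) *: v| <= 2.
Proof.
move=> u1 v1; have n1 (x : U) : inner x x = 1 -> `|x| = 1.
  by rewrite inner_norm => /eqP; rewrite sqrp_eq1 // => /eqP.
apply: le_trans (ler_normB _ _) _; rewrite normrZ (n1 _ u1) (n1 _ v1) mulr1.
by rewrite normr_sg [2]mulr2n lerD // lern1 leq_b1.
Qed.

(** The sign turns the inner product into its absolute value a <= 1, and
    1 - a <= 1 - a ^ 2; a zero sign costs norm 1, which the factor 2 absorbs. *)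
Lemma maximizer_dist_sqr (u v : U) : inner u u = 1 -> inner v v = 1 ->
  `|u - Num.sg (inner u v) *: v| ^+ 2 <= 2 * (1 - inner u v ^+ 2).
Proof.
move=> u1 v1; rewrite -inner_norm !(innerBl, innerBr, innerZl, innerZr) u1 v1.
rewrite (innerC v u).
have c1 : `|inner u v| <= 1.
  rewrite -(@expr_le1 _ 2) // real_normK ?num_real //.
  by apply: le_trans (inner_sqr_le _ _) _; rewrite -!inner_norm u1 v1 mulr1.
move: c1; case: (sgrP (inner u v)) => [->|c0|c0].
- by lra.
- by move: c0; nra.
- by move: c0; nra.
Qed.

(** On the complement of phi j the operator M - nu' j is bounded below by half
    the spectral gap, while M - nu' j and M - M' agree at phi' j. This needs an
    error of at most half the gap; otherwise the distance 2 is already a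
    multiple of the error. *)
Lemma maximizers_stable (M : U -> U) (phi : 'I_d -> U) :
  psd_op M -> (forall x, K (M x)) -> seq_maximizers K M phi ->
  (forall k, 0 < rayleigh_value M phi k) ->
  (forall i k, i != k -> rayleigh_value M phi i != rayleigh_value M phi k) ->
  (forall f, (forall k, inner f (phi k) = 0) -> M f = 0) ->
  exists2 C, 0 < C & forall (M' : U -> U) (phi' : 'I_d -> U) (del : R),
    psd_op M' -> (forall x, K (M' x)) -> seq_maximizers K M' phi' ->
    0 <= del -> (forall x, `|M x - M' x| <= del * `|x|) ->
    forall j, `|phi' j - Num.sg (inner (phi' j) (phi j)) *: phi j| <= C * del.
Proof.
move=> psdM KM mphi nu0 nuD Moff; have [lM _ sM _] := psdM.
set nu := rayleigh_value M phi in nu0 nuD *.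
have on := seq_maximizers_orthonormal mphi.
have ev := seq_maximizers_eigen Klin K0 psdM KM mphi.
have [g g0 gP] : exists2 g, 0 < g & forall p : 'I_d * 'I_d,
    g <= if p.1 == p.2 then nu p.1 else `|nu p.1 - nu p.2|.
  apply: positive_family_lb => -[i k] /=; case: eqVneq => // ik.
  by rewrite normr_gt0 subr_eq0 nuD.
(* For del > g / 2 the bound 2 is below 4 / g * del; otherwise the squared
   distance is at most 2 * (2 * del / g) ^ 2. *)
exists (4 / g); first by rewrite divr_gt0.
move=> M' phi' del psdM' KM' mphi' del0 MM' j.
have [[_ nj' _] _] := mphi' j; have [[_ nj _] _] := mphi j.
have [del_g|g_del] := leP del (g / 2); last first.
  apply: le_trans (maximizer_dist_le2 nj' nj) _.
  by rewrite mulrAC ler_pdivlMr //; lra.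
have MM'' x : `|M' x - M x| <= del * `|x| by rewrite distrC.
have w1 := rayleigh_value_weyl j psdM KM mphi psdM' mphi' MM'.
have w2 := rayleigh_value_weyl j psdM' KM' mphi' psdM mphi MM''.
have ev' := seq_maximizers_eigen Klin K0 psdM' KM' mphi' j.
set nu' := rayleigh_value M' phi' j in w1 w2 ev'; rewrite -/nu in w1 w2.
set x := phi' j in nj' ev' *; pose y := M x - nu' *: x.
have yn : `|y| <= del.
  by rewrite /y -ev' -[leRHS]mulr1; have := MM' x; move: nj';
     rewrite inner_norm => /eqP; rewrite sqrp_eq1 // => /eqP ->.
pose xo := x - \sum_k inner x (phi k) *: phi k.
have Mxo : M xo = 0.
  apply: Moff => k; rewrite innerBl (orthonormal_fam_coef (fun k => inner x (phi k))) //.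
  by rewrite subrr.
have yk k : inner y (phi k) = (nu k - nu') * inner x (phi k).
  by rewrite innerBl innerZl sM ev innerZr mulrBl.
have yo : y - \sum_k inner y (phi k) *: phi k = - nu' *: xo.
  have Mx : M x = \sum_k (nu k * inner x (phi k)) *: phi k.
    rewrite -[x in LHS](subrK (\sum_k inner x (phi k) *: phi k)) -/xo (linD lM) Mxo add0r.
    rewrite (lin_sum lM); apply: eq_bigr => k _.
    by rewrite (linZ lM) ev scalerA mulrC.
  have Sy : \sum_k inner y (phi k) *: phi k =
      M x - nu' *: (\sum_k inner x (phi k) *: phi k).
    rewrite Mx scaler_sumr -sumrB; apply: eq_bigr => k _.
    by rewrite yk mulrBl scalerBl scalerA.
  by rewrite Sy /y /xo opprB addrC addrA subrK scaleNr scalerBr opprB.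
have := pythagoras x on; have := pythagoras y on.
rewrite yo -/xo normrZ exprMn -inner_norm -[in X in _ -> X]inner_norm nj'.
rewrite (bigD1 j) //= [X in _ -> 1 = X + _ -> _](bigD1 j) //= => y2 x2.
have gj k : k != j -> (g / 2) ^+ 2 <= (nu k - nu') ^+ 2.
  move=> kj; have := gP (k, j); rewrite /= (negPf kj).
  case: ger0P => h1 h2.
    have h3 : g / 2 <= nu k - nu' by move: w2 del_g h2; lra.
    by rewrite ler_pXn2r ?nnegrE //; lra.
  have h3 : g / 2 <= - (nu k - nu') by move: w1 del_g h2; lra.
  by rewrite -[leRHS]sqrrN ler_pXn2r ?nnegrE //; lra.
have gn : (g / 2) ^+ 2 <= nu' ^+ 2.
  have := gP (j, j); rewrite /= eqxx => h.
  have h3 : g / 2 <= nu' by move: w1 del_g h; lra.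
  by rewrite ler_pXn2r ?nnegrE //; lra.
have s1 : (g / 2) ^+ 2 * (\sum_(k | k != j) inner x (phi k) ^+ 2) <=
    \sum_(k | k != j) inner y (phi k) ^+ 2.
  rewrite mulr_sumr; apply: ler_sum => k kj.
  by rewrite yk [leRHS]exprMn; apply: ler_wpM2r; [exact: sqr_ge0 | exact: gj].
have s2 : (g / 2) ^+ 2 * `|xo| ^+ 2 <= `|- nu'| ^+ 2 * `|xo| ^+ 2.
  by rewrite ler_wpM2r ?sqr_ge0 // normrN real_normK ?num_real.
have y2' : inner y y <= del ^+ 2 by rewrite inner_norm ler_pXn2r ?nnegrE.
have yj := sqr_ge0 (inner y (phi j)).
have main : (g / 2) ^+ 2 * (1 - inner x (phi j) ^+ 2) <= del ^+ 2 by nra.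
have C0 : 0 <= 4 / g * del by rewrite mulr_ge0 // divr_ge0 // ltW.
rewrite -(@ler_pXn2r _ 2) ?nnegrE //.
apply: le_trans (maximizer_dist_sqr nj' nj) _.
rewrite -/x exprMn expr_div_n mulrAC ler_pdivlMr ?exprn_gt0 //.
have := sqr_ge0 del; nra.
Qed.

End perturbation.

(** * Regression operators of finite rank *)
Section regression_perturbation.
Context {R : realType} {U V : hilbert R}.

Lemma psd_op_gram (A : V -> U) : linear A -> bounded_op A -> psd_op (A \o adjoint A).
Proof.
move=> lA bA; split => /=.
- by move=> a x y /=; rewrite (adjoint_linear lA bA) lA.
- have [C C0 hC] := bounded_op_gt0 bA; exists (C * C) => x /=.
  apply: le_trans (hC _) _; rewrite -mulrA ler_pM2l //.
  by apply: adjoint_le => //; exact: ltW.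
- by move=> x y /=; rewrite (innerC x) !(adjointE lA bA); exact: innerC.
- by move=> x /=; rewrite adjointE // inner_ge0.
Qed.

Lemma gram_perturbation (A A' : V -> U) (r rho : R) :
  linear A -> (forall y, `|A y| <= r * `|y|) -> 0 <= r ->
  linear A' -> 0 <= rho -> (forall y, `|A' y - A y| <= rho * `|y|) -> rho <= 1 ->
  forall x, `|A (adjoint A x) - A' (adjoint A' x)| <= (2 * r + 1) * rho * `|x|.
Proof.
move=> lA rA r0 lA' rho0 dA rho1 x.
have bA : bounded_op A by exists r.
have rA' y : `|A' y| <= (r + rho) * `|y|.
  rewrite -[A' y](subrK (A y)) mulrDl addrC; apply: le_trans (ler_normD _ _) _.
  by rewrite lerD.
have bA' : bounded_op A' by exists (r + rho).
pose B y := A y - A' y.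
have lB : linear B.
  by move=> a u v; rewrite /B lA lA' scalerBr addrACA opprD.
have rB y : `|B y| <= rho * `|y| by rewrite /B distrC.
have bB : bounded_op B by exists rho.
have aB : adjoint A x - adjoint A' x = adjoint B x.
  by apply: inner_ext => w; rewrite innerBl !(innerC _ w) -!adjointE // innerBl.
have -> : A (adjoint A x) - A' (adjoint A' x) =
    A (adjoint B x) + B (adjoint A' x).
  by rewrite -aB (linB lA) /B addrA subrK.
apply: le_trans (ler_normD _ _) _.
have h1 : `|A (adjoint B x)| <= r * (rho * `|x|).
  by apply: le_trans (rA _) _; rewrite ler_wpM2l // adjoint_le.
have h2 : `|B (adjoint A' x)| <= rho * ((r + rho) * `|x|).
  by apply: le_trans (rB _) _; rewrite ler_wpM2l // adjoint_le // addr_ge0.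
have : rho * (rho * `|x|) <= rho * `|x| by rewrite ler_wpM2l // ler_piMl.
lra.
Qed.

Variables (K : set U) (d : nat).
Hypothesis Klin : forall a x y, K x -> K y -> K (a *: x + y).
Hypothesis K0 : K 0.

(** Dimension count: d+1 vectors of a d-dimensional range are dependent. *)
Lemma full_orthonormal_range (A : V -> U) (phi : 'I_d -> U) :
  linear A -> has_rank A d -> orthonormal_fam phi -> (forall k, range A (phi k)) ->
  forall f, range A f -> (forall k, inner f (phi k) = 0) -> f = 0.
Proof.
move=> lA [b [_ rAb]] on rphi f rf of_.
have co v : range A v -> exists c : 'I_d -> R, v = \sum_(i < d) c i *: b i.
  by rewrite rAb; exact: lin_span_range.
pose x (i : 'I_d.+1) := if unlift ord_max i is Some k then phi k else f.
have [N hN] : {N : 'I_d.+1 -> 'I_d -> R &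
    forall i, x i = \sum_(k < d) N i k *: b k}.
  apply: (@choice _ _ (fun i (c : 'I_d -> R) => x i = \sum_(k < d) c k *: b k)) => i.
  by apply: co; rewrite /x; case: unlift => [k|].
have [c [i0 ci0] hc] := left_kernel_vector N (ltnSn d).
have cx : \sum_i c i *: x i = 0.
  under eq_bigr do rewrite hN scaler_sumr.
  rewrite exchange_big big1 //= => k _.
  under eq_bigr do rewrite scalerA.
  by rewrite -scaler_suml hc scale0r.
move: cx; rewrite (bigD1 ord_max) //= /x unlift_none.
have -> : \sum_(i < d.+1 | i != ord_max) c i *: x i =
    \sum_(k < d) c (lift ord_max k) *: phi k.
  rewrite (reindex_omap (lift ord_max) (unlift ord_max)) /=; last first.
    by move=> i; case: unliftP => [k ->|->] //=; rewrite eqxx.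
  apply: eq_big => k; first by rewrite liftK eqxx eq_sym neq_lift.
  by rewrite /x liftK.
move=> cf.
have ck k : c (lift ord_max k) = 0.
  rewrite -(orthonormal_fam_coef (fun k => c (lift ord_max k)) k on).
  have := congr1 (fun z => inner z (phi k)) cf.
  by rewrite innerDl innerZl of_ mulr0 add0r inner0l.
have cm : c ord_max != 0.
  by move: ci0; case: (unliftP ord_max i0) => [k ->|->] //; rewrite ck eqxx.
move: cf; rewrite big1 ?addr0 => [/eqP|k _]; last by rewrite ck scale0r.
by rewrite scaler_eq0 (negPf cm) => /eqP.
Qed.

(** If the k-th value vanished, some nonzero vector of the d-dimensional range
    of A, orthogonal to the first k maximizers, would be killed by the adjoint;
    but the range of A is orthogonal to the kernel of the adjoint. *)
Lemma gram_maximizers_positive (A : V -> U) (phi : 'I_d -> U) :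
  linear A -> bounded_op A -> (forall y, K (A y)) -> has_rank A d ->
  seq_maximizers K (A \o adjoint A) phi ->
  forall k, 0 < rayleigh_value (A \o adjoint A) phi k.
Proof.
move=> lA bA KA [b [bfree rAb]] mphi k.
have psdM := psd_op_gram lA bA; have [_ _ _ M0] := psdM.
have nu0 : 0 <= rayleigh_value (A \o adjoint A) phi k.
  by rewrite /rayleigh_value innerC.
rewrite lt_neqAle nu0 andbT; apply/negP => /eqP nuk.
pose w := widen_ord (ltnW (ltn_ord k)) : 'I_k -> 'I_d.
have [c [i0 ci0] hc] := left_kernel_vector (fun i j => inner (b i) (phi (w j))) (ltn_ord k).
pose f := \sum_i c i *: b i.
have [y _ yf] : range A f.
  by rewrite rAb; exists d, c, b; split => // i; exists i.
have Kf : K f by rewrite -yf.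
have fk (j : 'I_d) : (j < k)%N -> inner f (phi j) = 0.
  move=> jk; have -> : j = w (Ordinal jk) by exact: val_inj.
  by rewrite inner_suml -[RHS](hc (Ordinal jk)); apply: eq_bigr => i _; rewrite innerZl.
have := rayleigh_le Klin K0 psdM mphi Kf fk.
rewrite -nuk mul0r /= innerC adjointE // => h.
have af : adjoint A f = 0 by apply: inner_eq0; apply/le_anti; rewrite h inner_ge0.
have f0 : f = 0 by apply: inner_eq0; rewrite -{1}yf adjointE // af inner0r.
by move: ci0; rewrite (bfree c f0) eqxx.
Qed.

(** The maximizers form an orthonormal basis of the range of A, so that
    A A^* vanishes on their complement and [maximizers_stable] applies. For
    rho <= 1 the error of A A^* is linear in rho; for rho > 1 the distance 2
    is at most 2 * rho. *)
Lemma regression_maximizers_stable (A : V -> U) (phi : 'I_d -> U) :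
  linear A -> bounded_op A -> (forall y, K (A y)) -> has_rank A d ->
  distinct_nonzero_eigenvalues (A \o adjoint A) ->
  seq_maximizers K (A \o adjoint A) phi ->
  exists2 C, 0 < C & forall (A' : V -> U) (phi' : 'I_d -> U) (rho : R),
    linear A' -> (forall y, K (A' y)) ->
    seq_maximizers K (A' \o adjoint A') phi' ->
    0 <= rho -> (forall y, `|A' y - A y| <= rho * `|y|) ->
    forall j, `|phi' j - Num.sg (inner (phi' j) (phi j)) *: phi j| <= C * rho.
Proof.
move=> lA bA KA rkA distA mphi.
have psdM := psd_op_gram lA bA.
have KM x : K ((A \o adjoint A) x) by exact: KA.
have nu0 := gram_maximizers_positive lA bA KA rkA mphi.
have on := seq_maximizers_orthonormal mphi.
have ev := seq_maximizers_eigen Klin K0 psdM KM mphi.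
have phi1 k : inner (phi k) (phi k) = 1 by rewrite on eqxx.
have phin0 k : phi k != 0.
  by apply/eqP => h; have := phi1 k; rewrite h inner0l => /eqP; rewrite eq_sym oner_eq0.
have nuD i k : i != k ->
    rayleigh_value (A \o adjoint A) phi i != rayleigh_value (A \o adjoint A) phi k.
  move=> ik; apply/eqP => nuik.
  have evk := ev k; rewrite -nuik in evk.
  have [c hc] := distA _ _ _ (lt0r_neq0 (nu0 i)) (phin0 i) (ev i) evk.
  have := on i k; rewrite (negPf ik) hc innerZr phi1 mulr1 => c0.
  by move: (phin0 k); rewrite hc c0 scale0r eqxx.
have rphi k : range A (phi k).
  exists (adjoint A ((rayleigh_value (A \o adjoint A) phi k)^-1 *: phi k)) => //.
  rewrite (linZ (adjoint_linear lA bA)) (linZ lA).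
  have /= -> := ev k; rewrite scalerA mulVf ?scale1r //.
  exact: lt0r_neq0.
have [lM _ sM _] := psdM.
have Moff f : (forall k, inner f (phi k) = 0) -> (A \o adjoint A) f = 0.
  move=> of_; apply: (full_orthonormal_range lA rkA on rphi).
    by exists (adjoint A f).
  by move=> k; rewrite sM ev innerZr of_ mulr0.
have [C C0 HC] := maximizers_stable Klin K0 psdM KM mphi nu0 nuD Moff.
have [r r0 rA] := bounded_op_gt0 bA.
exists (C * (2 * r + 1) + 2).
  by rewrite addr_gt0 // mulr_gt0 // addr_gt0 // mulr_gt0.
move=> A' phi' rho lA' KA' mphi' rho0 dA j.
have C1 : 0 <= C * (2 * r + 1) by rewrite mulr_ge0 ?addr_ge0 ?mulr_ge0 ?ltW.
have bA' : bounded_op A'.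
  exists (r + rho) => y; rewrite -[A' y](subrK (A y)) mulrDl addrC.
  by apply: le_trans (ler_normD _ _) _; rewrite lerD.
have [rho1|rho1] := leP rho 1; last first.
  have [[_ n1 _] _] := mphi' j; have [[_ n2 _] _] := mphi j.
  apply: le_trans (maximizer_dist_le2 n1 n2) _.
  rewrite mulrDl; apply: le_trans (_ : 2 * rho <= _).
    by rewrite ler_peMr // ltW.
  by rewrite lerDr mulr_ge0.
have del0 : 0 <= (2 * r + 1) * rho.
  by rewrite mulr_ge0 // addr_ge0 // mulr_ge0 // ltW.
have := HC _ phi' ((2 * r + 1) * rho) (psd_op_gram lA' bA') _ mphi' del0 _ j.
rewrite mulrA => h; rewrite mulrDl; apply: le_trans (h _ _) _.
- by move=> x; exact: KA'.
- by apply: gram_perturbation => //; exact: ltW.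
- by rewrite lerDl mulr_ge0.
Qed.

End regression_perturbation.

(** * Countable total systems in a reproducing kernel space *)
Section gram_schmidt.
Context {R : realType} {U : hilbert R} (v : nat -> U).

(** [gs_prefix n] is the orthonormalization of the first n vectors, extended by
    zero; keeping a whole function makes the recursion structural. *)
Fixpoint gs_prefix (n : nat) : nat -> U :=
  if n is m.+1 then
    let r := v m - \sum_(i < m) inner (v m) (gs_prefix m i) *: gs_prefix m i in
    fun i => if i == m then `|r|^-1 *: r else gs_prefix m i
  else fun=> 0.

Definition gram_schmidt i := gs_prefix i.+1 i.
Local Notation g := gram_schmidt.

Lemma gs_prefixE n i : (i < n)%N -> gs_prefix n i = g i.
Proof.
elim: n => // n IH; rewrite ltnS leq_eqVlt => /orP[/eqP-> //|ltin].
by rewrite -IH //= ltn_eqF.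
Qed.

Let res n := v n - \sum_(i < n) inner (v n) (g i) *: g i.

Lemma gram_schmidtE n : g n = `|res n|^-1 *: res n.
Proof.
rewrite /g /= eqxx; suff -> : \sum_(i < n) inner (v n) (gs_prefix n i) *: gs_prefix n i =
  \sum_(i < n) inner (v n) (g i) *: g i by [].
by apply: eq_bigr => i _; rewrite gs_prefixE.
Qed.

Lemma gram_schmidt_norm i : inner (g i) (g i) = 1 \/ g i = 0.
Proof.
rewrite gram_schmidtE; have [->|r0] := eqVneq (res i) 0.
  by right; rewrite scaler0.
left; rewrite innerZl innerZr inner_norm expr2 mulrA mulrACA.
by rewrite -!mulrA mulVKf ?normr_eq0 // mulVf ?normr_eq0.
Qed.

Lemma gram_schmidt_ortho : ortho_sys g.
Proof.
split; last exact: gram_schmidt_norm.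
have low n : forall j, (j < n)%N -> inner (g n) (g j) = 0.
  have [m] := ubnP n; elim: m n => // m IH n; rewrite ltnS => nm j jn.
  rewrite gram_schmidtE innerZl innerBl inner_suml (bigD1 (Ordinal jn)) //=.
  rewrite innerZl big1 ?addr0.
    case: (gram_schmidt_norm j) => [->|->]; first by rewrite mulr1 subrr mulr0.
    by rewrite !inner0r mulr0 subrr mulr0.
  move=> i; rewrite -val_eqE /= => ij; rewrite innerZl.
  have [lij|lji|] := ltngtP i j; last by move=> e; rewrite e eqxx in ij.
    by rewrite (innerC (g i)) (IH _ (leq_trans jn nm) _ lij) mulr0.
  by rewrite (IH _ (leq_trans (ltn_ord i) nm) _ lji) mulr0.
move=> i j; rewrite neq_ltn => /orP[h|h]; last exact: low.
by rewrite innerC low.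
Qed.

Lemma gram_schmidt_span f : (forall i, inner f (g i) = 0) -> forall i, inner f (v i) = 0.
Proof.
move=> fg n; rewrite -[v n](subrK (\sum_(i < n) inner (v n) (g i) *: g i)) innerDr.
rewrite -/(res n) inner_sumr big1 ?addr0; last by move=> i _; rewrite innerZr fg mulr0.
have [->|r0] := eqVneq (res n) 0; first by rewrite inner0r.
have -> : res n = `|res n| *: g n.
  by rewrite gram_schmidtE scalerA mulfV ?scale1r // normr_eq0.
by rewrite innerZr fg mulr0.
Qed.

End gram_schmidt.

Section rkhs_continuity.
Context {R : realType} {p : nat} {D : set 'rV[R]_p}.
Context {kappa : 'rV[R]_p -> 'rV[R]_p -> R} (H : rkhs D kappa).

Lemma inner_section x y : D x -> D y -> inner (rk_sec H x) (rk_sec H y) = kappa y x.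
Proof. by move=> Dx Dy; rewrite -rk_reproducing // rk_secE. Qed.

Lemma section_norm_sqr x : D x -> `|rk_sec H x| ^+ 2 = kappa x x.
Proof. by move=> Dx; rewrite -inner_norm inner_section. Qed.

(** The squared distance of two sections is a combination of three values of
    the kernel. *)
Lemma section_continuous x (e : R) : continuous_kernel D kappa -> D x -> 0 < e ->
  \forall y \near x, D y -> `|rk_sec H x - rk_sec H y| < e.
Proof.
move=> /subspace_continuousP /(_ (x, x)) /= kc Dx e0.
have /cvgrPdist_lt /(_ (e ^+ 2 / 4)) := kc (conj Dx Dx).
have e4 : 0 < e ^+ 2 / 4 by rewrite divr_gt0 ?exprn_gt0.
move=> /(_ e4) [[B1 B2] /= [nB1 nB2] B12].
have nB : nbhs x (B1 `&` B2) by exact: filterI.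
have Bx : B1 x by exact: nbhs_singleton.
apply: filterS nB => y [B1y B2y] Dy.
have h1 : `|kappa x x - kappa x y| < e ^+ 2 / 4 := B12 (x, y) (conj Bx B2y) (conj Dx Dy).
have h2 : `|kappa x x - kappa y y| < e ^+ 2 / 4 := B12 (y, y) (conj B1y B2y) (conj Dy Dy).
rewrite -(@ltr_pXn2r _ 2) ?nnegrE ?(ltW e0) //.
rewrite norm_sqrB innerC inner_section // !section_norm_sqr //.
move: h1 h2 => /=; move: (kappa x x) (kappa x y) (kappa y y) => a b c.
rewrite !ltr_norml => /andP[h1 h2] /andP[h3 h4].
lra.
Qed.

Lemma rational_near (x : 'rV[R]_p) (e : R) : 0 < e ->
  exists q : 'rV[rat]_p, ball (map_mx ratr q : 'rV[R]_p) e x.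
Proof.
move=> e0; have [q hq] : {q : 'I_p -> rat & forall i, ball (ratr (q i) : R) e (x 0 i)}.
  apply: (@choice _ _ (fun i r => ball (ratr r : R) e (x 0 i))) => i.
  have [|r] := @rat_in_itvoo R (x 0 i - e) (x 0 i + e); first by lra.
  rewrite in_itv /= => /andP[h1 h2]; exists r.
  by rewrite -ball_normE /ball_ /= ltr_norml; lra.
exists (\row_i q i); split => // i j; rewrite !mxE ord1; exact: hq.
Qed.

(** A function of H is continuous, so it is determined by its values on a
    countable dense subset of D; the points are chosen near rational ones. *)
Lemma rkhs_countable_total : continuous_kernel D kappa ->
  exists2 g : nat -> H, ortho_sys g & total_sys g.
Proof.
move=> kc.
pose near_pt (t : 'rV[rat]_p * nat) : H :=
  if pselect (exists y, D y /\ ball (map_mx ratr t.1 : 'rV[R]_p) (t.2.+1%:R^-1) y)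
    is left h then rk_sec H (sval (cid h)) else 0.
pose v n : H := if unpickle n is Some t then near_pt t else 0.
exists (gram_schmidt v); first exact: gram_schmidt_ortho.
move=> f w hw.
suff -> : w = 0 by rewrite inner0l.
have wv := gram_schmidt_span hw.
apply: rk_ext => x Dx; rewrite !rk_reproducing // inner0l.
apply/eqP; rewrite -normr_eq0; apply/eqP/le_anti; rewrite normr_ge0 andbT.
apply/ler_addgt0Pr => e e0; rewrite add0r.
have w1 : 0 < `|w| + 1 by rewrite ltr_wpDl.
have /nbhs_ballP [del /= del0 hdel] := section_continuous kc Dx (divr_gt0 e0 w1).
have [k hk] : exists k : nat, k.+1%:R^-1 < del / 2.
  have [|k] := @ltr_add_invr R 0 (del / 2); first by rewrite divr_gt0.
  by rewrite add0r; exists k.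
have k0 : 0 < k.+1%:R^-1 :> R by rewrite invr_gt0.
have [q xq] := rational_near x k0.
have := wv (pickle (q, k)); rewrite /v pickleK /near_pt.
case: pselect => [h|[]]; last by exists x.
case: cid => y [Dy yq] /= wy.
have xy : ball x del y.
  rewrite (splitr del); apply: ball_triangle (_ : ball _ _ (map_mx ratr q : 'rV[R]_p)) _.
    by apply: ball_sym; apply: le_ball xq; exact: ltW.
  by apply: le_ball yq; exact: ltW.
have := hdel _ xy Dy; rewrite -[inner w _]subr0 -wy -innerBr => lt_xy.
apply: le_trans (inner_le _ _) _.
apply: le_trans (_ : (`|w| + 1) * (e / (`|w| + 1)) <= _); last first.
  by rewrite mulrC divfK // gt_eqF.
by apply: ler_pM => //; [rewrite lerDl | exact: ltW].
Qed.

End rkhs_continuity.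

(** * Expectations of bounded functions and independence *)
Section bounded_measurable.
Context {d} {T : measurableType d} {R : realType}.
Implicit Types a b : T -> R.

Definition bounded_mfun a := measurable_fun setT a /\ exists M, forall x, `|a x| <= M.

Lemma bounded_mfun_cst (c : R) : bounded_mfun (fun=> c).
Proof. by split; [exact: measurable_cst | exists `|c|]. Qed.

Lemma bounded_mfunD a b : bounded_mfun a -> bounded_mfun b ->
  bounded_mfun (fun x => a x + b x).
Proof.
move=> [ma [M aM]] [mb [N bN]]; split; first exact: measurable_funD.
by exists (M + N) => x; apply: le_trans (ler_normD _ _) _; rewrite lerD.
Qed.

Lemma bounded_mfunM a b : bounded_mfun a -> bounded_mfun b ->
  bounded_mfun (fun x => a x * b x).
Proof.
move=> [ma [M aM]] [mb [N bN]]; split; first exact: measurable_funM.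
by exists (M * N) => x; rewrite normrM ler_pM.
Qed.

Lemma bounded_mfunZ c a : bounded_mfun a -> bounded_mfun (fun x => c * a x).
Proof. exact: bounded_mfunM (bounded_mfun_cst c). Qed.

Lemma bounded_mfunB a b : bounded_mfun a -> bounded_mfun b ->
  bounded_mfun (fun x => a x - b x).
Proof.
move=> ba bb; have := bounded_mfunD ba (bounded_mfunZ (-1) bb).
by under eq_fun do rewrite mulN1r.
Qed.

Lemma bounded_mfun_sqr a : bounded_mfun a -> bounded_mfun (fun x => a x ^+ 2).
Proof.
by move=> ba; under eq_fun do rewrite expr2; exact: bounded_mfunM.
Qed.

Lemma bounded_mfun_sum n (f : nat -> T -> R) : (forall i, bounded_mfun (f i)) ->
  bounded_mfun (fun x => \sum_(i < n) f i x).
Proof.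
move=> bf; elim: n => [|n IH].
  by under eq_fun do rewrite big_ord0; exact: bounded_mfun_cst.
by under eq_fun do rewrite big_ord_recr /=; exact: bounded_mfunD.
Qed.

Lemma bounded_mfun_integrable (mu : {finite_measure set T -> \bar R}) a :
  bounded_mfun a -> mu.-integrable setT (EFin \o a).
Proof.
move=> [ma [M aM]]; apply: measurable_bounded_integrable => //.
  exact: fin_num_fun_lty.
exists M; split; first exact: num_real.
by move=> x Mx y _ /=; apply: le_trans (aM y) (ltW Mx).
Qed.

Context (P : probability T R).

Definition expect a : R := \int[P]_w a w.

Lemma EFin_expect a : bounded_mfun a -> (\int[P]_w (a w)%:E)%E = (expect a)%:E.
Proof.
move=> ba; rewrite /expect /Rintegral fineK //.
exact: integrable_fin_num (bounded_mfun_integrable P ba).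
Qed.

Lemma expectD a b : bounded_mfun a -> bounded_mfun b ->
  expect (fun x => a x + b x) = expect a + expect b.
Proof. by move=> ba bb; rewrite /expect RintegralD //; exact: bounded_mfun_integrable. Qed.

Lemma expectB a b : bounded_mfun a -> bounded_mfun b ->
  expect (fun x => a x - b x) = expect a - expect b.
Proof. by move=> ba bb; rewrite /expect RintegralB //; exact: bounded_mfun_integrable. Qed.

Lemma expectZ c a : bounded_mfun a -> expect (fun x => c * a x) = c * expect a.
Proof. by move=> ba; rewrite /expect RintegralZl //; exact: bounded_mfun_integrable. Qed.

Lemma expect_cst c : expect (fun=> c) = c.
Proof. by rewrite /expect Rintegral_cst // [X in fine X](@probability_setT _ _ _ P) mulr1. Qed.

Lemma expect_ge0 a : (forall x, 0 <= a x) -> 0 <= expect a.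
Proof. by move=> a0; exact: Rintegral_ge0. Qed.

Lemma expect_le a b : bounded_mfun a -> bounded_mfun b -> (forall x, a x <= b x) ->
  expect a <= expect b.
Proof. by move=> ba bb ab; apply: le_Rintegral => //; exact: bounded_mfun_integrable. Qed.

Lemma expect_sum n (f : nat -> T -> R) : (forall i, bounded_mfun (f i)) ->
  expect (fun x => \sum_(i < n) f i x) = \sum_(i < n) expect (f i).
Proof.
move=> bf; elim: n => [|n IH].
  by under eq_fun do rewrite big_ord0; rewrite expect_cst big_ord0.
under eq_fun do rewrite big_ord_recr /=.
by rewrite big_ord_recr expectD // ?IH //; exact: bounded_mfun_sum.
Qed.

Lemma expect_norm_le a M : bounded_mfun a -> (forall x, `|a x| <= M) ->
  `|expect a| <= M.
Proof.
move=> ba aM; rewrite ler_norml; apply/andP; split.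
  rewrite -(expect_cst (- M)); apply: expect_le => //; first exact: bounded_mfun_cst.
  by move=> x; have := aM x; rewrite ler_norml => /andP[].
rewrite -(expect_cst M); apply: expect_le => //; first exact: bounded_mfun_cst.
by move=> x; apply: le_trans (ler_norm _) (aM x).
Qed.

End bounded_measurable.

Lemma bounded_mfun_comp d d' (S : measurableType d) (T : measurableType d')
    (R : realType) (f : S -> T) (a : T -> R) :
  measurable_fun setT f -> bounded_mfun a -> bounded_mfun (fun s => a (f s)).
Proof.
move=> mf [ma [M aM]]; split; last by exists M.
exact: measurableT_comp.
Qed.

Section independence.
Context {d} {Omega : measurableType d} {R : realType} (P : probability Omega R).
Context {d'} {T : measurableType d'}.

Lemma expect_distribution (Z : {mfun Omega >-> T}) (a : T -> R) :
  bounded_mfun a ->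
  (\int[distribution P Z]_x (a x)%:E = (expect P (a \o Z))%:E)%E.
Proof.
move=> ba; have baZ : bounded_mfun (a \o Z).
  by apply: (bounded_mfun_comp _ ba); exact: measurable_funPT.
rewrite -EFin_expect // (@integral_distribution _ _ _ _ _ P Z (EFin \o a)) //.
  exact/measurable_EFinP/ba.1.
exact: (bounded_mfun_integrable P baZ).
Qed.

Lemma expect_eq_distr (Z W : Omega -> T) (a : T -> R) :
  measurable_fun setT Z -> measurable_fun setT W ->
  (forall C, measurable C -> P (Z @^-1` C) = P (W @^-1` C)) ->
  bounded_mfun a -> expect P (a \o Z) = expect P (a \o W).
Proof.
move=> mZ mW ZW ba.
have := expect_distribution (mfun_Sub (mem_set mZ)) ba.
have := expect_distribution (mfun_Sub (mem_set mW)) ba.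
rewrite /= => hW hZ; apply: EFin_inj; rewrite -hZ -hW.
by apply: eq_measure_integral => C mC _; exact: ZW.
Qed.

(** The joint law agrees with the product of the marginals on rectangles, hence
    everywhere, and Fubini's theorem applies. *)
Lemma expectM_indep (Z W : Omega -> T) (a b : T -> R) :
  measurable_fun setT Z -> measurable_fun setT W ->
  (forall A B, measurable A -> measurable B ->
    P (Z @^-1` A `&` W @^-1` B) = (P (Z @^-1` A) * P (W @^-1` B))%E) ->
  bounded_mfun a -> bounded_mfun b ->
  expect P (fun w => a (Z w) * b (W w)) = expect P (a \o Z) * expect P (b \o W).
Proof.
move=> mZ mW ZW ba bb.
pose Z' : {mfun Omega >-> T} := mfun_Sub (mem_set mZ).
pose W' : {mfun Omega >-> T} := mfun_Sub (mem_set mW).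
have mV : measurable_fun setT (fun w => (Z w, W w)) by exact: measurable_fun_pair.
pose V' : {mfun Omega >-> (T * T)%type} := mfun_Sub (mem_set mV).
pose m1 := distribution P Z'; pose m2 := distribution P W'.
pose f (z : T * T) := a z.1 * b z.2.
have bf : bounded_mfun f.
  by apply: bounded_mfunM; [apply: (bounded_mfun_comp _ ba) | apply: (bounded_mfun_comp _ bb)].
have eqm : forall C, measurable C -> (m1 \x m2)%E C = distribution P V' C.
  by apply: product_measure_unique => A B mA mB; rewrite -ZW.
have intf : (m1 \x m2)%E.-integrable setT (EFin \o f).
  have /integrableP[mf intf] := bounded_mfun_integrable (distribution P V') bf.
  apply/integrableP; split => //; apply: le_lt_trans intf.
  rewrite le_eqVlt; apply/orP; left; apply/eqP.
  by apply: eq_measure_integral => C mC _; exact: eqm.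
have E1 : (\int[P]_w (f (V' w))%:E = \int[(m1 \x m2)%E]_z (f z)%:E)%E.
  rewrite -(@integral_distribution _ _ _ _ _ P V' (EFin \o f)) //.
  - by apply: eq_measure_integral => C mC _; exact/esym/eqm.
  - by apply/measurable_EFinP; case: bf.
  - exact: (bounded_mfun_integrable P (bounded_mfun_comp mV bf)).
have E2 := integral12_prod_meas1 intf.
rewrite /fubini_F /= in E2.
have ea := expect_distribution Z' ba; have eb := expect_distribution W' bb.
rewrite /= in ea eb; rewrite -/m1 in ea; rewrite -/m2 in eb.
apply: EFin_inj; rewrite -EFin_expect; last first.
  by apply: bounded_mfunM; [exact: (bounded_mfun_comp mZ ba) | exact: (bounded_mfun_comp mW bb)].
rewrite [LHS]E1 -E2 /f /=.
under eq_integral => x _.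
  under eq_integral => y _ do rewrite EFinM.
  rewrite integralZl //; last exact: bounded_mfun_integrable.
  rewrite eb.
  over.
by rewrite integralZr ?ea //; exact: bounded_mfun_integrable.
Qed.

End independence.

(** * Second moments of Hilbert-valued averages *)
Lemma markov_set {d} {Omega : measurableType d} {R : realType}
    (P : probability Omega R) (N : Omega -> \bar R) (K c : R) :
  measurable_fun setT N -> (forall w, 0 <= N w)%E ->
  (\int[P]_w N w <= c%:E)%E -> 0 < K ->
  measurable [set w | (K%:E < N w)%E] /\ (P [set w | (K%:E < N w)%E] <= (c / K)%:E)%E.
Proof.
move=> mN N0 Nc K0.
have mE : measurable [set w | (K%:E < N w)%E].
  by rewrite -[X in measurable X]setTI; exact: emeasurable_fun_o_infty.
split => //; rewrite -(@lee_pmul2l _ K%:E) ?lte_fin // -EFinM mulrC divfK ?gt_eqF //.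
apply: le_trans Nc; rewrite -integral_cst //.
apply: le_trans (_ : (\int[P]_(w in [set w | (K%:E < N w)%E]) N w <= _)%E).
  apply: ge0_le_integral => //.
  - by move=> w _; rewrite lee_fin ltW.
  - exact: measurable_funTS.
  - by move=> w /= /ltW.
by apply: ge0_subset_integral.
Qed.

Section random_vectors.
Context {d} {T : measurableType d} {R : realType} {U : hilbert R}.

Definition bounded_rvec (F : T -> U) :=
  (forall h, measurable_fun setT (fun t => inner (F t) h)) /\
  exists M, forall t, `|F t| <= M.

Lemma bounded_rvec_inner F h : bounded_rvec F -> bounded_mfun (fun t => inner (F t) h).
Proof.
move=> [mF [M FM]]; split => //; exists (M * `|h|) => t.
by apply: le_trans (inner_le _ _) _; rewrite ler_wpM2r.
Qed.

Lemma bounded_rvec_cst (m : U) : bounded_rvec (fun=> m).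
Proof. by split; [move=> h; exact: measurable_cst | exists `|m|]. Qed.

Lemma bounded_rvecD F G : bounded_rvec F -> bounded_rvec G ->
  bounded_rvec (fun t => F t + G t).
Proof.
move=> [mF [M FM]] [mG [N GN]]; split.
  by move=> h; under eq_fun do rewrite innerDl; exact: measurable_funD.
by exists (M + N) => t; apply: le_trans (ler_normD _ _) _; rewrite lerD.
Qed.

Lemma bounded_rvecZ (a : T -> R) F : bounded_mfun a -> bounded_rvec F ->
  bounded_rvec (fun t => a t *: F t).
Proof.
move=> [ma [M aM]] [mF [N FN]]; split.
  by move=> h; under eq_fun do rewrite innerZl; exact: measurable_funM.
by exists (M * N) => t; rewrite normrZ ler_pM.
Qed.

Lemma bounded_rvecB F G : bounded_rvec F -> bounded_rvec G ->
  bounded_rvec (fun t => F t - G t).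
Proof.
move=> bF bG; have := bounded_rvecD bF (bounded_rvecZ (bounded_mfun_cst (-1)) bG).
by under eq_fun do rewrite scaleN1r.
Qed.

Lemma bounded_rvec_sum n (F : nat -> T -> U) : (forall i, bounded_rvec (F i)) ->
  bounded_rvec (fun t => \sum_(i < n) F i t).
Proof.
move=> bF; elim: n => [|n IH].
  by under eq_fun do rewrite big_ord0; exact: bounded_rvec_cst.
by under eq_fun do rewrite big_ord_recr /=; exact: bounded_rvecD.
Qed.

Context {u : nat -> U} (ou : ortho_sys u) (tu : total_sys u).

(** Only the scalar products with fixed vectors are assumed measurable; a
    countable total system makes the norm measurable through Parseval. *)
Lemma bounded_rvec_norm_sqr F : bounded_rvec F -> bounded_mfun (fun t => `|F t| ^+ 2).
Proof.
move=> bF; split.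
  apply/measurable_EFinP => /=.
  have -> : EFin \o (fun t => `|F t| ^+ 2) =
      (fun t => \sum_(i <oo) (inner (F t) (u i) ^+ 2)%:E)%E.
    by apply/funext => t /=; rewrite parseval.
  apply: ge0_emeasurable_sum => [i t _ _|i _]; first by rewrite lee_fin sqr_ge0.
  by apply/measurable_EFinP; case: (bounded_mfun_sqr (bounded_rvec_inner (u i) bF)).
have [_ [M FM]] := bF; exists (M ^+ 2) => t.
rewrite ger0_norm ?sqr_ge0 // ler_pXn2r ?nnegrE //.
exact: le_trans (FM t).
Qed.

Lemma expect_norm_sqr (P : probability T R) F : bounded_rvec F ->
  ((expect P (fun t => `|F t| ^+ 2))%:E =
   \sum_(i <oo) (expect P (fun t => inner (F t) (u i) ^+ 2))%:E)%E.
Proof.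
move=> bF; rewrite -EFin_expect; last exact: bounded_rvec_norm_sqr.
have bs i := bounded_mfun_sqr (bounded_rvec_inner (u i) bF).
under eq_integral do rewrite -(parseval ou (tu _)).
rewrite integral_nneseries //.
- by apply: eq_eseriesr => i _; rewrite EFin_expect.
- by move=> i; apply/measurable_EFinP; case: (bs i).
- by move=> i t _; rewrite lee_fin sqr_ge0.
Qed.

End random_vectors.

Lemma bounded_rvec_comp d d' (S : measurableType d) (T : measurableType d')
    (R : realType) (U : hilbert R) (f : S -> T) (F : T -> U) :
  measurable_fun setT f -> bounded_rvec F -> bounded_rvec (fun s => F (f s)).
Proof.
move=> mf [mF [M FM]]; split; last by exists M.
by move=> h; apply: (measurableT_comp (mF h)).
Qed.

Lemma bounded_rvec_op d (T : measurableType d) (R : realType) (U V : hilbert R)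
    (A : U -> V) (F : T -> U) :
  linear A -> bounded_op A -> bounded_rvec F -> bounded_rvec (fun t => A (F t)).
Proof.
move=> lA bA [mF [M FM]]; split.
  by move=> h; under eq_fun do rewrite adjointE //; exact: mF.
have [C C0 hC] := bounded_op_gt0 bA.
by exists (C * M) => t; apply: le_trans (hC _) _; rewrite ler_pM2l.
Qed.

Section hilbert_schmidt.
Context {R : realType} {U V : hilbert R} {v : nat -> V}.
Context (ov : ortho_sys v) (tv : total_sys v).

(** Parseval's identity and the Cauchy-Schwarz inequality bound the adjoint term
    by term, and an operator has the norm of its adjoint. *)
Lemma hilbert_schmidt_bound (A : V -> U) (K : R) : linear A -> bounded_op A ->
  (\sum_(m <oo) (`|A (v m)| ^+ 2)%:E <= K%:E)%E ->
  forall g, `|A g| ^+ 2 <= K * `|g| ^+ 2.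
Proof.
move=> lA bA AK g.
have aK h : `|adjoint A h| ^+ 2 <= `|h| ^+ 2 * K.
  rewrite -lee_fin -(parseval ov (tv _)) EFinM.
  apply: le_trans (lee_wpmul2l _ AK); last by rewrite lee_fin sqr_ge0.
  rewrite -nneseriesZl; last by move=> m _; rewrite lee_fin sqr_ge0.
  apply: lee_nneseries => m _; first by rewrite lee_fin sqr_ge0.
  by rewrite lee_fin innerC -adjointE // mulrC inner_sqr_le.
have K0 : 0 <= K.
  rewrite -lee_fin; apply: le_trans AK; apply: nneseries_ge0 => m _ _.
  by rewrite lee_fin sqr_ge0.
have [->|Ag0] := eqVneq (A g) 0; first by rewrite normr0 expr0n mulr_ge0 ?sqr_ge0.
have N0 : 0 < `|A g| ^+ 2 by rewrite exprn_gt0 ?normr_gt0.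
rewrite -(ler_pM2r N0) -expr2 -{1}[`|A g| ^+ 2]inner_norm adjointE //.
apply: le_trans (inner_sqr_le _ _) _.
rewrite [leRHS](_ : _ = `|g| ^+ 2 * (`|A g| ^+ 2 * K)); last by ring.
by rewrite ler_wpM2l ?sqr_ge0.
Qed.

End hilbert_schmidt.

Section sampling.
Context {d} {Omega : measurableType d} {R : realType} (P : probability Omega R).
Context {d'} {T : measurableType d'}.
Context (Z : Omega -> T) (Zs : nat -> Omega -> T).

(** The variance of an average sees the sample only through pairs. *)
Definition pairwise_iid :=
  [/\ measurable_fun setT Z, forall i, measurable_fun setT (Zs i),
      forall i C, measurable C -> P (Zs i @^-1` C) = P (Z @^-1` C) &
      forall i k, i != k -> forall A B, measurable A -> measurable B ->
        P (Zs i @^-1` A `&` Zs k @^-1` B) = (P (Zs i @^-1` A) * P (Zs k @^-1` B))%E].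

Hypothesis iidZ : pairwise_iid.

(** After centring, the cross terms of the expanded square vanish. *)
Lemma expect_emp_mean_sqr n (a : T -> R) (c : R) : (0 < n)%N ->
  bounded_mfun a -> c = expect P (a \o Z) ->
  expect P (fun w => (n%:R^-1 * (\sum_(i < n) a (Zs i w)) - c) ^+ 2) <=
    n%:R^-1 * expect P (fun w => a (Z w) ^+ 2).
Proof.
move=> n0 ba cE; have [mZ mZs dZ iZ] := iidZ.
have nR0 : n%:R != 0 :> R by rewrite pnatr_eq0 -lt0n.
pose b t := a t - c.
have bb : bounded_mfun b by apply: bounded_mfunB => //; exact: bounded_mfun_cst.
have bbi i : bounded_mfun (fun w => b (Zs i w)) by exact: bounded_mfun_comp.
have baZ : bounded_mfun (fun w => a (Z w)) by exact: bounded_mfun_comp.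
have Eb : expect P (b \o Z) = 0.
  rewrite /b /comp expectB //; last exact: bounded_mfun_cst.
  by rewrite expect_cst cE subrr.
have Ebi i : expect P (b \o Zs i) = 0.
  by rewrite -Eb; apply: expect_eq_distr => // C mC; exact: dZ.
pose s2 := expect P (fun w => b (Z w) ^+ 2).
have Ebb i k : expect P (fun w => b (Zs i w) * b (Zs k w)) = (i == k)%:R * s2.
  have [<-|ik] := eqVneq i k; last first.
    by rewrite mul0r expectM_indep ?Ebi ?mul0r //; exact: iZ.
  rewrite mul1r /s2; under eq_fun do rewrite -expr2.
  apply: (@expect_eq_distr _ _ _ P _ _ _ _ (fun t => b t ^+ 2)) => //.
    by move=> C mC; exact: dZ.
  exact: bounded_mfun_sqr.
have -> : (fun w => (n%:R^-1 * (\sum_(i < n) a (Zs i w)) - c) ^+ 2) =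
    (fun w => n%:R^-1 ^+ 2 * \sum_(i < n) \sum_(k < n) b (Zs i w) * b (Zs k w)).
  apply/funext => w.
  have -> : n%:R^-1 * (\sum_(i < n) a (Zs i w)) - c = n%:R^-1 * \sum_(i < n) b (Zs i w).
    by rewrite /b sumrB sumr_const card_ord mulrBr -(mulr_natl c) mulKf.
  by rewrite exprMn expr2 [X in _ * X]expr2 big_distrlr.
have bik i : bounded_mfun (fun w => \sum_(k < n) b (Zs i w) * b (Zs k w)).
  apply: (@bounded_mfun_sum _ _ _ n (fun k w => b (Zs i w) * b (Zs k w))) => k.
  exact: bounded_mfunM.
rewrite expectZ; last exact: (@bounded_mfun_sum _ _ _ n
  (fun i w => \sum_(k < n) b (Zs i w) * b (Zs k w))).
rewrite (@expect_sum _ _ _ P n (fun i w => \sum_(k < n) b (Zs i w) * b (Zs k w))) //.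
have -> : \sum_(i < n) expect P (fun w => \sum_(k < n) b (Zs i w) * b (Zs k w)) = n%:R * s2.
  rewrite mulr_natl -[in RHS](card_ord n) -sumr_const; apply: eq_bigr => i _.
  rewrite (@expect_sum _ _ _ P n (fun k w => b (Zs i w) * b (Zs k w))); last first.
    by move=> k; exact: bounded_mfunM.
  rewrite (bigD1 i) //= Ebb eqxx mul1r big1 ?addr0 // => k ki.
  by rewrite Ebb eq_sym val_eqE (negPf ki) mul0r.
rewrite expr2 mulrA mulfVK // ler_pM2l ?invr_gt0 ?ltr0n //.
have -> : s2 = expect P (fun w => a (Z w) ^+ 2) - c ^+ 2.
  have -> : s2 = expect P (fun w => (a (Z w) ^+ 2 - (2 * c) * a (Z w)) + c ^+ 2).
    by congr expect; apply/funext => w; rewrite /b; ring.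
  rewrite expectD; last 2 first.
  - by apply: bounded_mfunB; [exact: bounded_mfun_sqr|exact: bounded_mfunZ].
  - exact: bounded_mfun_cst.
  rewrite expectB; last 2 first.
  - exact: bounded_mfun_sqr.
  - exact: bounded_mfunZ.
  rewrite expectZ // expect_cst.
  by rewrite -[expect P (fun w => a (Z w))]cE; ring.
by rewrite gerDl oppr_le0 sqr_ge0.
Qed.

Context {U : hilbert R} {u : nat -> U} (ou : ortho_sys u) (tu : total_sys u).

Lemma bounded_rvec_emp_mean n (F : T -> U) : bounded_rvec F ->
  bounded_rvec (fun w => emp_mean n (fun i => F (Zs i w))).
Proof.
move=> bF; have [_ mZs _ _] := iidZ; apply: bounded_rvecZ.
  exact: bounded_mfun_cst.
apply: (@bounded_rvec_sum _ _ _ _ n (fun i w => F (Zs i w))) => i.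
exact: bounded_rvec_comp.
Qed.

(** The scalar bound, summed over the coordinates of a total system. *)
Lemma expect_emp_mean_norm_sqr n (F : T -> U) (m : U) : (0 < n)%N ->
  bounded_rvec F -> (forall h, inner m h = expect P (fun w => inner (F (Z w)) h)) ->
  expect P (fun w => `|emp_mean n (fun i => F (Zs i w)) - m| ^+ 2) <=
    n%:R^-1 * expect P (fun w => `|F (Z w)| ^+ 2).
Proof.
move=> n0 bF mE; have [mZ mZs _ _] := iidZ.
rewrite -lee_fin EFinM (expect_norm_sqr ou tu); last first.
  by apply: bounded_rvecB; [exact: bounded_rvec_emp_mean | exact: bounded_rvec_cst].
rewrite (expect_norm_sqr ou tu); last exact: bounded_rvec_comp.
rewrite -nneseriesZl; last first.
  by move=> i _; rewrite lee_fin; apply: expect_ge0 => w; exact: sqr_ge0.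
apply: lee_nneseries => i _.
  by move=> _; rewrite lee_fin; apply: expect_ge0 => w; exact: sqr_ge0.
rewrite -EFinM lee_fin.
apply: le_trans (@expect_emp_mean_sqr n (fun t => inner (F t) (u i)) _ n0
  (bounded_rvec_inner (u i) bF) (mE (u i))).
rewrite le_eqVlt; apply/orP; left; apply/eqP; congr expect; apply/funext => w.
by rewrite innerBl /emp_mean innerZl inner_suml.
Qed.

End sampling.

(** * Covariance operators and their spectrum *)
Lemma nneseries_le {R : realType} (f : nat -> R) (C : R) : (forall i, 0 <= f i) ->
  (forall n, \sum_(i < n) f i <= C) -> (\sum_(i <oo) (f i)%:E <= C%:E)%E.
Proof.
move=> f0 fC; apply: lime_le.
  by apply: is_cvg_nneseries => i _ _; rewrite lee_fin.
by apply: nearW => n; rewrite big_mkord sumEFin lee_fin.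
Qed.

Section tensors.
Context {d} {Omega : measurableType d} {R : realType} (P : probability Omega R).
Context {d'} {T : measurableType d'}.
Context (Z : Omega -> T) (Zs : nat -> Omega -> T) (iidZ : pairwise_iid P Z Zs).
Context {U V : hilbert R} {u : nat -> U} {v : nat -> V}.
Context (ou : ortho_sys u) (tu : total_sys u) (ov : ortho_sys v) (tv : total_sys v).

(** The Pettis expectation of the tensors of F (Z) and G (Z), for features that
    are already centred. *)
Definition weak_cov (F : T -> U) (G : T -> V) (C : V -> U) := forall g h,
  inner (C g) h = expect P (fun w => inner (G (Z w)) g * inner (F (Z w)) h).

Lemma weak_cov_linear F G C : bounded_rvec F -> bounded_rvec G ->
  weak_cov F G C -> linear C.
Proof.
move=> bF bG hC a g1 g2; have [mZ _ _ _] := iidZ.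
have bFZ := bounded_rvec_comp mZ bF; have bGZ := bounded_rvec_comp mZ bG.
apply: inner_ext => h; rewrite innerPl !hC.
have b1 := bounded_mfunM (bounded_rvec_inner g1 bGZ) (bounded_rvec_inner h bFZ).
have b2 := bounded_mfunM (bounded_rvec_inner g2 bGZ) (bounded_rvec_inner h bFZ).
rewrite -expectZ // -expectD //; last exact: bounded_mfunZ.
congr expect; apply/funext => w; rewrite innerDr innerZr; ring.
Qed.

Lemma weak_cov_bounded F G C : bounded_rvec F -> bounded_rvec G ->
  weak_cov F G C -> bounded_op C.
Proof.
move=> bF bG hC; have [mZ _ _ _] := iidZ.
have bFZ := bounded_rvec_comp mZ bF; have bGZ := bounded_rvec_comp mZ bG.
have [_ [M FM]] := bFZ; have [_ [N GN]] := bGZ.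
exists (N * M) => g; have [->|Cg0] := eqVneq (C g) 0.
  have [w] : exists w : Omega, True by exists point.
  have M0 := le_trans (normr_ge0 _) (FM w); have N0 := le_trans (normr_ge0 _) (GN w).
  by rewrite normr0 !mulr_ge0.
rewrite -(ler_pM2r (_ : 0 < `|C g|)) ?normr_gt0 // -expr2 -inner_norm hC.
apply: le_trans (ler_norm _) _; apply: expect_norm_le.
  by apply: bounded_mfunM; apply: bounded_rvec_inner.
move=> w; rewrite normrM [leRHS](_ : _ = (N * `|g|) * (M * `|C g|)); last by ring.
by apply: ler_pM => //; apply: le_trans (inner_le _ _) _; rewrite ler_wpM2r.
Qed.

(** N is the squared Hilbert-Schmidt norm of the fluctuation. Unlike the
    operator norm it is visibly measurable, and its expectation is a sum of
    second moments of averages of vectors. *)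
Lemma tensor_fluctuation n F G C c : (0 < n)%N ->
  bounded_rvec F -> bounded_rvec G -> weak_cov F G C ->
  (forall t, `|G t| ^+ 2 <= c) ->
  exists N : Omega -> \bar R, [/\ measurable_fun setT N, forall w, (0 <= N w)%E,
    (\int[P]_w N w <= (c * (n%:R^-1 * expect P (fun w => `|F (Z w)| ^+ 2)))%:E)%E &
    forall w K, (N w <= K%:E)%E -> forall g,
      `|emp_mean n (fun i => tensor (F (Zs i w)) (G (Zs i w)) g) - C g| ^+ 2
        <= K * `|g| ^+ 2].
Proof.
move=> n0 bF bG hC Gc; have [mZ mZs _ _] := iidZ.
have bFZ := bounded_rvec_comp mZ bF; have bGZ := bounded_rvec_comp mZ bG.
pose Fm m t := tensor (F t) (G t) (v m).
have bFm m : bounded_rvec (Fm m) by apply: bounded_rvecZ => //; exact: bounded_rvec_inner.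
pose A w g := emp_mean n (fun i => tensor (F (Zs i w)) (G (Zs i w)) g) - C g.
have bAm m : bounded_mfun (fun w => `|A w (v m)| ^+ 2).
  apply: (bounded_rvec_norm_sqr ou tu); apply: bounded_rvecB.
    exact: (bounded_rvec_emp_mean iidZ n (bFm m)).
  exact: bounded_rvec_cst.
have lC := weak_cov_linear bF bG hC; have bC := weak_cov_bounded bF bG hC.
exists (fun w => \sum_(m <oo) (`|A w (v m)| ^+ 2)%:E)%E; split.
- apply: ge0_emeasurable_sum => [m w _ _|m _]; first by rewrite lee_fin sqr_ge0.
  by apply/measurable_EFinP; case: (bAm m).
- by move=> w; apply: nneseries_ge0 => m _ _; rewrite lee_fin sqr_ge0.
- have mA m : measurable_fun setT (fun w => (`|A w (v m)| ^+ 2)%:E).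
    by apply/measurable_EFinP; case: (bAm m).
  rewrite integral_nneseries //.
  under eq_eseriesr do rewrite EFin_expect //.
  have h1 m : expect P (fun w => `|A w (v m)| ^+ 2) <=
      n%:R^-1 * expect P (fun w => inner (G (Z w)) (v m) ^+ 2 * `|F (Z w)| ^+ 2).
    apply: le_trans (expect_emp_mean_norm_sqr iidZ ou tu (m := C (v m)) n0 (bFm m) _) _.
      by move=> h; rewrite hC; congr expect; apply/funext => w; rewrite innerZl.
    rewrite le_eqVlt; apply/orP; left; apply/eqP; congr (_ * expect _ _).
    by apply/funext => w; rewrite /Fm normrZ exprMn real_normK ?num_real.
  apply: nneseries_le => [m|k]; first by apply: expect_ge0 => w; exact: sqr_ge0.
  apply: (@le_trans _ _ (\sum_(m < k) n%:R^-1 *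
      expect P (fun w => inner (G (Z w)) (v m) ^+ 2 * `|F (Z w)| ^+ 2))).
    by apply: ler_sum => m _; exact: h1.
  have bF2 := bounded_rvec_norm_sqr ou tu bFZ.
  have bGm m : bounded_mfun (fun w => inner (G (Z w)) (v m) ^+ 2 * `|F (Z w)| ^+ 2).
    by apply: bounded_mfunM => //; apply: bounded_mfun_sqr; exact: bounded_rvec_inner.
  rewrite -mulr_sumr mulrCA ler_pM2l ?invr_gt0 ?ltr0n //.
  rewrite -(@expect_sum _ _ _ P k (fun m w => inner (G (Z w)) (v m) ^+ 2 * `|F (Z w)| ^+ 2)) //.
  rewrite -expectZ //; apply: expect_le.
  + exact: (@bounded_mfun_sum _ _ _ k
      (fun m w => inner (G (Z w)) (v m) ^+ 2 * `|F (Z w)| ^+ 2)).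
  + exact: bounded_mfunZ.
  + move=> w; rewrite -mulr_suml ler_wpM2r ?sqr_ge0 //.
    exact: le_trans (bessel _ _ ov) (Gc _).
- move=> w K; apply: (hilbert_schmidt_bound ov tv).
    move=> a g1 g2; rewrite /A /emp_mean lC.
    rewrite scalerBr addrACA -opprD; congr (_ - _).
    rewrite !scaler_sumr -big_split /=; apply: eq_bigr => i _.
    rewrite /tensor innerDr innerZr scalerDl scalerDr !scalerA; congr (_ + _).
    by congr (_ *: _); ring.
  have [D hD] := bC; exists ((n%:R^-1 * \sum_(i < n) (`|F (Zs i w)| * `|G (Zs i w)|)) + D) => g.
  rewrite /A mulrDl; apply: le_trans (ler_normB _ _) _; rewrite lerD //.
  rewrite /emp_mean normrZ ger0_norm ?invr_ge0 ?ler0n // -mulrA ler_wpM2l ?invr_ge0 ?ler0n //.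
  apply: le_trans (ler_norm_sum _ _ _) _; rewrite mulr_suml; apply: ler_sum => i _.
  by rewrite /tensor normrZ mulrC -mulrA ler_wpM2l // inner_le.
Qed.

End tensors.

Section resolvent_trace.
Context {R : realType} {U : hilbert R} (S : U -> U) (lam : nat -> R) (e : nat -> U).
Hypothesis (psdS : psd_op S) (eigS : eigen_system S lam e).

Lemma eigen_ortho : ortho_sys e.
Proof.
have [on _ _ _ _] := eigS; split => [i j /negPf ij|i]; first by rewrite on ij.
by left; rewrite on eqxx.
Qed.

Lemma range_spanned x : spanned_by e (S x).
Proof.
have [_ _ _ _ ker] := eigS; have [_ _ sS _] := psdS.
by move=> f fe; rewrite -sS ker ?inner0l // => j.
Qed.

Lemma inner_eigen x j : inner (S x) (e j) = lam j * inner x (e j).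
Proof.
have [_ ev _ _ _] := eigS; have [_ _ sS _] := psdS.
by rewrite sS ev innerZr.
Qed.

Context (eps : R) (eps0 : 0 < eps).

Lemma resolvent_coef x y j : S x + eps *: x = y ->
  inner x (e j) = inner y (e j) / (lam j + eps).
Proof.
move=> <-; have [_ _ lam0 _ _] := eigS.
rewrite innerDl innerZl inner_eigen -mulrDl mulrC mulKf // gt_eqF //.
exact: addr_gt0.
Qed.

(** In the eigenbasis x has the coordinates of y divided by lam_j + eps. *)
Lemma resolvent_trace x y : S x + eps *: x = y ->
  ((inner (S x) x)%:E =
   \sum_(j <oo) (lam j / (lam j + eps) ^+ 2 * inner y (e j) ^+ 2)%:E)%E.
Proof.
move=> xy; apply/esym/cvg_lim => //.
have [_ _ lam0 _ _] := eigS.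
under eq_fun => n.
  rewrite sumEFin big_mkord (eq_bigr (fun j : 'I_n => inner (S x) (e j) * inner x (e j))).
    over.
  move=> j _; rewrite inner_eigen (resolvent_coef _ xy) //; field.
  by rewrite gt_eqF // addr_gt0.
apply: cvg_EFin; first exact: nearW.
exact: (parseval_cvg eigen_ortho (range_spanned x)).
Qed.

End resolvent_trace.

(** * Power estimates for the bias and for the effective dimension *)
Section power_estimates.
Context {R : realType}.

Lemma gt0_powRD (a r s : R) : 0 < a -> a `^ (r + s) = a `^ r * a `^ s.
Proof. by move=> a0; rewrite powRD // (gt_eqF a0) implybT. Qed.

Lemma gt0_powRVE (a r : R) : 0 < a -> a^-1 * a `^ r = a `^ (r - 1).
Proof. by move=> a0; rewrite addrC gt0_powRD // powR_inv1 // ltW. Qed.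

Lemma gt0_powR_sqr (a r : R) : 0 < a -> (a `^ r) ^+ 2 = a `^ (2 * r).
Proof. by move=> a0; rewrite expr2 -gt0_powRD // mulr2n mulrDl mul1r. Qed.

(** For beta <= 1 the product of eps ^ (1 - beta) and l ^ beta is at most
    max (l, eps); for beta > 1 one power of l cancels and the others are at
    most those of L, which is saturation at the order eps. *)
Lemma tikhonov_bias (l L eps beta : R) : 0 < l -> l <= L -> 0 < eps -> 0 < beta ->
  eps * l `^ beta / (l + eps) <= (1 + L `^ (beta - 1)) * eps `^ Num.min beta 1.
Proof.
move=> l0 lL e0 b0; have le0 : 0 < l + eps by exact: addr_gt0.
rewrite ler_pdivrMr //.
have [b1|b1] := leP beta 1.
  apply: le_trans (_ : eps `^ beta * (l + eps) <= _); last first.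
    by rewrite (ler_wpM2r (ltW le0)) // ler_peMl ?powR_ge0 // lerDl powR_ge0.
  have [lle|elt] := leP l eps.
    rewrite mulrC; apply: ler_pM; rewrite ?powR_ge0 ?(ltW e0) //; last by rewrite lerDr ltW.
    by apply: ge0_ler_powR; rewrite ?nnegrE // ltW.
  have -> : eps * l `^ beta = eps `^ beta * (eps `^ (1 - beta) * l `^ beta).
    by rewrite mulrA -gt0_powRD // addrC subrK powRr1 // ltW.
  rewrite ler_wpM2l ?powR_ge0 //; apply: le_trans (_ : l <= _); last by rewrite lerDl ltW.
  rewrite -[leRHS](powRr1 (ltW l0)) -[in leRHS](subrK beta 1) (gt0_powRD _ _ l0).
  rewrite ler_wpM2r ?powR_ge0 //.
  by apply: ge0_ler_powR; rewrite ?nnegrE ?subr_ge0 // ltW.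
rewrite powRr1 ?(ltW e0) // mulrC mulrAC ler_wpM2r ?(ltW e0) //.
rewrite mulrC -[beta in leLHS](subrK 1) (gt0_powRD _ _ l0) (powRr1 (ltW l0)) mulrC.
have h : l `^ (beta - 1) <= L `^ (beta - 1).
  by apply: ge0_ler_powR; rewrite ?nnegrE ?subr_ge0 // ltW // (lt_le_trans l0).
have p0 := powR_ge0 l (beta - 1); nra.
Qed.

(** An increment of the antiderivative of t ^ (- alpha), estimated by
    the inequalities ln t <= t - 1 and 1 + y <= exp y. *)
Lemma powR_telescope (alpha : R) (j : nat) : 1 < alpha -> (0 < j)%N ->
  (alpha - 1) * j.+1%:R `^ (- alpha) <= j%:R `^ (1 - alpha) - j.+1%:R `^ (1 - alpha).
Proof.
move=> a1 j0; have jR : 0 < j%:R :> R by rewrite ltr0n.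
have j1R : 0 < j.+1%:R :> R by rewrite ltr0n.
pose t : R := j%:R / j.+1%:R.
have t0 : 0 < t by rewrite divr_gt0.
have tE : 1 - t = j.+1%:R^-1.
  rewrite /t -[X in X - _](mulfV (lt0r_neq0 j1R)) -mulrBl -natrB ?leqnSn //.
  by rewrite subSnn mul1r.
have jt : j%:R = j.+1%:R * t :> R by rewrite /t mulrC divfK // gt_eqF.
rewrite [in leRHS]jt powRM ?(ltW j1R) ?(ltW t0) //.
rewrite [leRHS](_ : _ = j.+1%:R `^ (1 - alpha) * (t `^ (1 - alpha) - 1)); last by ring.
rewrite (gt0_powRD 1 (- alpha) j1R) powRr1 ?(ltW j1R) //.
rewrite [leRHS](_ : _ = (j.+1%:R * (t `^ (1 - alpha) - 1)) * j.+1%:R `^ (- alpha)); last first.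
  by ring.
rewrite ler_wpM2r ?powR_ge0 // -ler_pdivrMl // mulrC -[_^-1]tE mulrC.
have lnt : ln t <= t - 1.
  by have := @le_ln1Dx R (t - 1); rewrite (addrC 1) subrK; apply; move: t0; lra.
have -> : t `^ (1 - alpha) = expR ((1 - alpha) * ln t) by rewrite /powR gt_eqF.
have := expR_ge1Dx ((1 - alpha) * ln t); nra.
Qed.

(** Split the sum at J close to eps ^ (- 1 / alpha), where lam_j is of the order
    of eps: each of the first J terms is at most 1 / eps, and each later one at
    most lam_j / eps ^ 2, whose sum telescopes. *)
Lemma polynomial_trace_bound (alpha c : R) (lam : nat -> R) : 1 < alpha ->
  (forall j, 0 < lam j) -> (forall j, lam j <= c * j.+1%:R `^ (- alpha)) ->
  exists2 C, 0 < C & forall eps n, 0 < eps -> eps <= 1 ->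
    \sum_(j < n) lam j / (lam j + eps) ^+ 2 <= C * eps `^ (- ((alpha + 1) / alpha)).
Proof.
move=> a1 lam0 lamc; have a0 : 0 < alpha by lra.
have c0 : 0 < c.
  have := lt_le_trans (lam0 0%N) (lamc 0%N).
  by rewrite pmulr_lgt0 // powR_gt0.
pose C2 := c / (alpha - 1) * 2 `^ (alpha - 1).
have C20 : 0 < C2 by rewrite mulr_gt0 ?divr_gt0 ?powR_gt0 // subr_gt0.
exists (1 + C2); first by rewrite addr_gt0.
move=> eps n e0 e1.
pose x := eps `^ (- alpha^-1).
have x1 : 1 <= x.
  rewrite /x powRN -[leLHS]invr1 lef_pV2 ?posrE ?powR_gt0 //.
  rewrite -[leRHS](powRr0 eps); apply: ger_powR; rewrite ?e0 //.
  by rewrite invr_ge0 ltW.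
have x0 : 0 < x by lra.
pose J := Num.truncn x.
have /andP[Jx xJ] : J%:R <= x < J.+1%:R by apply: truncn_itv; lra.
have J0 : (0 < J)%N.
  by rewrite lt0n; apply/eqP => J0; move: xJ; rewrite J0; lra.
have JR : 1 <= J%:R :> R by rewrite ler1n.
have xJ2 : x / 2 <= J%:R.
  by move: xJ; rewrite -natr1; lra.
have lep j : 0 < lam j + eps by rewrite addr_gt0.
pose t j := lam j / (lam j + eps) ^+ 2.
have t1 j : t j <= eps^-1.
  rewrite /t ler_pdivrMr ?exprn_gt0 // -ler_pdivrMl ?invr_gt0 // invrK.
  have := lam0 j; nra.
have t2 j : t j <= c / eps ^+ 2 * j.+1%:R `^ (- alpha).
  rewrite mulrAC; apply: le_trans (_ : lam j / eps ^+ 2 <= _); last first.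
    by rewrite ler_wpM2r ?lamc // invr_ge0 sqr_ge0.
  rewrite /t ler_wpM2l ?(ltW (lam0 j)) // lef_pV2 ?posrE ?exprn_gt0 //.
  by rewrite ler_pXn2r ?nnegrE ?ltW // ltrDr.
pose B := c / ((alpha - 1) * eps ^+ 2).
have B0 : 0 < B by rewrite divr_gt0 // mulr_gt0 ?subr_gt0 ?exprn_gt0.
have tB j : (0 < j)%N -> t j <= B * (j%:R `^ (1 - alpha) - j.+1%:R `^ (1 - alpha)).
  move=> j0; apply: le_trans (t2 j) _.
  apply: le_trans (ler_wpM2l (ltW B0) (powR_telescope a1 j0)).
  rewrite mulrA ler_wpM2r ?powR_ge0 // /B le_eqVlt; apply/orP; left; apply/eqP.
  by field; rewrite !gt_eqF // subr_gt0.
have sum1 : \sum_(j < J) t j <= J%:R / eps.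
  rewrite mulr_natl -[in leRHS](card_ord J) -sumr_const; apply: ler_sum => j _.
  exact: t1.
have sum2 m : \sum_(j < J + m) t j <=
    J%:R / eps + B * (J%:R `^ (1 - alpha) - (J + m)%:R `^ (1 - alpha)).
  elim: m => [|m IH]; first by rewrite addn0 subrr mulr0 addr0.
  rewrite addnS big_ord_recr /=.
  have tJm : t (J + m)%N <= B * ((J + m)%:R `^ (1 - alpha) - (J + m).+1%:R `^ (1 - alpha)).
    by apply: tB; rewrite addn_gt0 J0.
  by apply: le_trans (lerD IH tJm) _; rewrite -addrA -mulrDr addrA subrK.
have sum3 : \sum_(j < n) t j <= J%:R / eps + B * J%:R `^ (1 - alpha).
  apply: le_trans (_ : \sum_(j < J + n) t j <= _).
    rewrite addnC big_split_ord /= lerDl; apply: sumr_ge0 => j _.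
    by rewrite divr_ge0 ?sqr_ge0 // ltW.
  apply: le_trans (sum2 n) _; rewrite lerD2l ler_wpM2l ?(ltW B0) //.
  by rewrite gerDl oppr_le0 powR_ge0.
apply: le_trans sum3 _.
have eE : eps `^ (- ((alpha + 1) / alpha)) = x / eps.
  rewrite [RHS]mulrC /x gt0_powRVE //; congr (_ `^ _); by field; rewrite gt_eqF.
rewrite eE mulrDl mul1r lerD //.
  by rewrite ler_wpM2r // invr_ge0 ltW.
have xa : x `^ (1 - alpha) = x * eps.
  rewrite gt0_powRD // powRr1 ?(ltW x0) //; congr (_ * _).
  by rewrite /x -powRrM mulrNN mulVf ?powRr1 ?(ltW e0) // gt_eqF.
have J1 : J%:R `^ (1 - alpha) <= (x / 2) `^ (1 - alpha).
  rewrite -[1 - alpha]opprB !powRN lef_pV2 ?posrE ?powR_gt0 //; try lra.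
  by apply: ge0_ler_powR; rewrite ?nnegrE ?subr_ge0 //; lra.
apply: le_trans (ler_wpM2l (ltW B0) J1) _.
rewrite powRM ?(ltW x0) // xa -powR_inv1 // -powRrM mulN1r opprB /B /C2.
rewrite le_eqVlt; apply/orP; left; apply/eqP.
by field; rewrite !gt_eqF // subr_gt0.
Qed.

End power_estimates.

(** * Tikhonov regularization *)
Section resolvent.
Context {R : realType} {U : hilbert R} (S : U -> U) (eps : R).
Hypothesis (psdS : psd_op S) (eps0 : 0 < eps).

Definition resolvent : U -> U := op_inv (fun f => S f + eps *: f).
Local Notation A := resolvent.

Lemma resolventK y : S (A y) + eps *: A y = y.
Proof. exact: op_inv_resolvent. Qed.

Lemma resolvent_linear : linear A.
Proof.
have [lS _ _ _] := psdS; move=> a x y; apply: (resolvent_inj psdS eps0).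
rewrite resolventK lS scalerDr addrACA scalerA (mulrC eps) -scalerA -scalerDr.
by rewrite !resolventK.
Qed.

Lemma resolvent_norm y : `|A y| <= eps^-1 * `|y|.
Proof.
by rewrite ler_pdivlMl // -{2}[y]resolventK; exact: resolvent_le.
Qed.

Lemma resolvent_bounded : bounded_op A.
Proof. by exists eps^-1; exact: resolvent_norm. Qed.

Lemma resolvent_sym x y : inner (A x) y = inner x (A y).
Proof.
have [_ _ sS _] := psdS.
by rewrite -{1}[y]resolventK -{2}[x]resolventK innerDl innerDr sS innerZl innerZr.
Qed.

(** The difference x - r solves the empirical equation with right-hand side
    y = c - Sh r - eps r. Replacing its solution by A y, where A belongs to S,
    leaves a remainder that solves the empirical equation with right-hand side
    (S - Sh) A y, and the empirical resolvent has norm at most 1 / eps. *)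
Lemma resolvent_perturbation (Sh : U -> U) (a : R) (x r c : U) :
  psd_op Sh -> (forall z, `|Sh z - S z| <= a * `|z|) -> Sh x + eps *: x = c ->
  `|x - r| <= (1 + a / eps) * `|A (c - Sh r - eps *: r)|.
Proof.
move=> psdSh ha xc; have [lSh _ _ _] := psdSh.
set z := A _.
have hz : S z + eps *: z = c - Sh r - eps *: r by exact: resolventK.
have e1 : Sh (x - r - z) + eps *: (x - r - z) = S z - Sh z.
  rewrite !(linB lSh) !scalerBr -xc in hz *.
  have -> : Sh x - Sh r - Sh z + (eps *: x - eps *: r - eps *: z) =
    (Sh x + eps *: x - Sh r - eps *: r) - Sh z - eps *: z.
    rewrite [LHS]addrACA -opprD addrACA -!opprD.
    by rewrite -!addrA -!opprD !addrA; congr (_ - _); rewrite -!addrA; congr (_ + _).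
  by rewrite -hz addrAC addrK.
have h2 : `|x - r - z| <= a / eps * `|z|.
  rewrite mulrAC ler_pdivlMr // mulrC; apply: le_trans (resolvent_le _ psdSh eps0) _.
  by rewrite e1 distrC.
rewrite -[x - r](subrK z) mulrDl mul1r addrC.
by apply: le_trans (ler_normD _ _) _; rewrite lerD2l.
Qed.

Context (lam : nat -> R) (e : nat -> U) (eigS : eigen_system S lam e).

Lemma resolvent_spanned y : spanned_by e y -> spanned_by e (A y).
Proof.
move=> ye f fe; have := ye f fe; rewrite -{1}[y]resolventK innerDr innerZr.
rewrite (range_spanned psdS eigS (A y) fe) add0r => /eqP.
by rewrite mulf_eq0 gt_eqF //= => /eqP.
Qed.

Lemma tikhonov_bias_op (beta : R) (r z : U) : 0 < beta -> spanned_by e r ->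
  (forall j, inner r (e j) = lam j `^ beta * inner z (e j)) ->
  `|A (eps *: r)| <= (1 + lam 0%N `^ (beta - 1)) * eps `^ Num.min beta 1 * `|z|.
Proof.
move=> b0 re rz; have oe := eigen_ortho eigS; have [_ _ lam0 lamd _] := eigS.
set c := (1 + _) * _; have c0 : 0 <= c.
  by rewrite mulr_ge0 ?powR_ge0 // addr_ge0 ?powR_ge0.
have cz : 0 <= c * `|z| by rewrite mulr_ge0.
rewrite -(@ler_pXn2r _ 2) ?nnegrE // [leRHS]exprMn.
have se : spanned_by e (A (eps *: r)).
  apply: resolvent_spanned => f fe; by rewrite innerZr re ?mulr0.
rewrite -lee_fin -(parseval oe se).
apply: nneseries_le => [j|n]; first exact: sqr_ge0.
apply: le_trans (_ : c ^+ 2 * \sum_(j < n) inner z (e j) ^+ 2 <= _); last first.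
  by rewrite ler_wpM2l ?sqr_ge0 // bessel.
rewrite mulr_sumr; apply: ler_sum => j _.
rewrite (resolvent_coef psdS eigS eps0 _ (resolventK (eps *: r))) innerZl rz.
rewrite [X in X ^+ 2 <= _](_ : _ =
  (eps * lam j `^ beta / (lam j + eps)) * inner z (e j)); last by ring.
rewrite exprMn ler_wpM2r ?sqr_ge0 // ler_pXn2r ?nnegrE //.
  exact: tikhonov_bias (lam0 j) (lamd _ _ (leq0n j)) eps0 b0.
by rewrite divr_ge0 ?mulr_ge0 ?powR_ge0 ?addr_ge0 ?ltW.
Qed.

End resolvent.

Section spectral_power.
Context {R : realType} {U : hilbert R} (S : U -> U) (lam : nat -> R) (e : nat -> U).
Hypothesis (eigS : eigen_system S lam e).

Lemma spectral_power_coef (s : R) (x : U) j : 0 <= s ->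
  inner (spectral_power lam e s x) (e j) = lam j `^ s * inner x (e j).
Proof.
move=> s0; have oe := eigen_ortho eigS; have [_ _ lam0 lamd _] := eigS.
pose c i := lam i `^ s * inner x (e i).
have cv : cvgn (fun n => \sum_(i < n) c i *: e i).
  apply: (@ortho_series_cvg _ _ e c ((lam 0%N `^ s) ^+ 2 * `|x| ^+ 2)) => // n.
  apply: le_trans (_ : (lam 0%N `^ s) ^+ 2 * \sum_(i < n) inner x (e i) ^+ 2 <= _); last first.
    by rewrite ler_wpM2l ?sqr_ge0 // bessel.
  rewrite mulr_sumr; apply: ler_sum => i _; rewrite /c exprMn ler_wpM2r ?sqr_ge0 //.
  rewrite ler_pXn2r ?nnegrE ?powR_ge0 //; apply: ge0_ler_powR; rewrite ?nnegrE ?(ltW (lam0 _)) //.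
  exact: lamd.
rewrite /spectral_power.
have -> : series (fun i => (lam i `^ s * inner x (e i)) *: e i) =
    (fun n => \sum_(i < n) c i *: e i).
  by apply/funext => n; rewrite /series /= big_mkord.
have c1 := inner_cvgl (v := e j) cv.
suff c2 : inner (\sum_(i < n) c i *: e i) (e j) @[n --> \oo] --> c j.
  by apply: cvg_unique c1 c2.
apply: cvg_near_cst; exists j.+1 => // n /= jn.
have [on _ _ _ _] := eigS.
by rewrite (ortho_sum_inner c) // jn mul1r on eqxx mulr1.
Qed.

End spectral_power.

(** * Empirical means and covariances *)
Section empirical_mean.
Context {R : realType} {U : hilbert R} (n : nat) (n0 : (0 < n)%N).

Lemma emp_mean_shift (f : nat -> U) (m : U) :
  emp_mean n (fun i => f i - m) = emp_mean n f - m.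
Proof.
rewrite /emp_mean sumrB scalerBr sumr_const card_ord -[m *+ n]scaler_nat scalerA mulVf ?scale1r //.
by rewrite pnatr_eq0 -lt0n.
Qed.

Lemma emp_mean_inner (f : nat -> U) x :
  inner (emp_mean n f) x = n%:R^-1 * \sum_(i < n) inner (f i) x.
Proof. by rewrite /emp_mean innerZl inner_suml. Qed.

End empirical_mean.

Section empirical_covariance.
Context {R : realType} {U V : hilbert R} (n : nat) (n0 : (0 < n)%N).

Lemma emp_mean_op (A : U -> V) (f : nat -> U) : linear A ->
  A (emp_mean n f) = emp_mean n (fun i => A (f i)).
Proof. by move=> lA; rewrite /emp_mean (linZ lA) (lin_sum lA). Qed.

Lemma emp_cov_shift (f : nat -> U) (g : nat -> V) (m : U) (m' : V) :
  emp_cov n (fun i => f i - m) (fun i => g i - m') = emp_cov n f g.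
Proof.
apply/funext => x; rewrite /emp_cov; congr (_ *: _); apply: eq_bigr => i _.
have h (W : zmodType) (a b c : W) : a - c - (b - c) = a - b.
  by rewrite opprB addrA subrK.
by rewrite !emp_mean_shift // !h.
Qed.

Lemma emp_covE (f : nat -> U) (g : nat -> V) x : emp_cov n f g x =
  emp_mean n (fun i => tensor (f i) (g i) x) - tensor (emp_mean n f) (emp_mean n g) x.
Proof.
have nR : n%:R != 0 :> R by rewrite pnatr_eq0 -lt0n.
rewrite /emp_cov /tensor.
have -> : \sum_(i < n) inner (g i - emp_mean n g) x *: (f i - emp_mean n f) =
    \sum_(i < n) inner (g i) x *: f i - (n%:R * inner (emp_mean n g) x) *: emp_mean n f.
  have fn : \sum_(i < n) f i = n%:R *: emp_mean n f.
    by rewrite /emp_mean scalerA mulfV ?scale1r.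
  have az : \sum_(i < n) inner (g i - emp_mean n g) x = 0.
    rewrite -inner_suml sumrB sumr_const card_ord -[emp_mean n g *+ n]scaler_nat.
    by rewrite /emp_mean scalerA mulfV // scale1r subrr inner0l.
  under eq_bigr => i _ do rewrite scalerBr.
  rewrite sumrB -scaler_suml az scale0r subr0.
  under eq_bigr => i _ do rewrite innerBl scalerBl.
  by rewrite sumrB -scaler_sumr fn scalerA mulrC.
by rewrite /emp_mean scalerBr scalerA mulKf // /emp_mean.
Qed.

Lemma emp_cov_linear (f : nat -> U) (g : nat -> V) : linear (emp_cov n f g).
Proof.
move=> a x y; rewrite /emp_cov [a *: (_ *: _)]scalerA mulrC -scalerA -scalerDr.
congr (_ *: _); rewrite scaler_sumr -big_split /=; apply: eq_bigr => i _.
by rewrite /tensor innerDr innerZr scalerDl scalerA.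
Qed.

Lemma emp_cov_bounded (f : nat -> U) (g : nat -> V) : bounded_op (emp_cov n f g).
Proof.
exists (n%:R^-1 * \sum_(i < n) (`|f i - emp_mean n f| * `|g i - emp_mean n g|)) => x.
rewrite /emp_cov normrZ ger0_norm ?invr_ge0 ?ler0n // -mulrA ler_wpM2l ?invr_ge0 ?ler0n //.
apply: le_trans (ler_norm_sum _ _ _) _; rewrite mulr_suml; apply: ler_sum => i _.
by rewrite /tensor normrZ mulrC -mulrA ler_wpM2l // inner_le.
Qed.

End empirical_covariance.

Lemma emp_cov_psd {R : realType} {U : hilbert R} n (f : nat -> U) :
  psd_op (emp_cov n f f).
Proof.
split.
- exact: emp_cov_linear.
- exact: emp_cov_bounded.
- move=> x y; rewrite /emp_cov innerZl innerZr inner_suml inner_sumr.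
  congr (_ * _); apply: eq_bigr => i _; rewrite /tensor innerZl innerZr.
  by rewrite mulrC (innerC x).
- move=> x; rewrite /emp_cov innerZl inner_suml mulr_ge0 ?invr_ge0 ?ler0n //.
  by apply: sumr_ge0 => i _; rewrite /tensor innerZl -expr2 sqr_ge0.
Qed.

(** * Error of the empirical regression operator *)
Definition regression_rate {R : realType} (alpha b : R) (n : nat) (eps : R) : R :=
  n%:R `^ (- (1 / 2)) * eps `^ (b - 1) + eps `^ b
    + n%:R^-1 * eps `^ (- ((3 * alpha + 1) / (2 * alpha)))
    + n%:R `^ (- (1 / 2)) * eps `^ (- ((alpha + 1) / (2 * alpha))).

Section regression_error.
Context {d} {Omega : measurableType d} {R : realType} (P : probability Omega R).
Context {d'} {T : measurableType d'}.
Context (Z : Omega -> T) (Zs : nat -> Omega -> T) (iidZ : pairwise_iid P Z Zs).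
Context {U V : hilbert R} {u : nat -> U} {v : nat -> V}.
Context (ou : ortho_sys u) (tu : total_sys u) (ov : ortho_sys v) (tv : total_sys v).

Lemma weak_cov_psd (F : T -> U) (S : U -> U) : bounded_rvec F ->
  weak_cov P Z F F S -> psd_op S.
Proof.
move=> bF hS; split.
- exact: (weak_cov_linear iidZ bF bF hS).
- exact: (weak_cov_bounded iidZ bF bF hS).
- move=> x y; rewrite hS innerC hS; congr expect; apply/funext => w; exact: mulrC.
- by move=> x; rewrite hS; apply: expect_ge0 => w; rewrite -expr2 sqr_ge0.
Qed.

Lemma markov_event (N : Omega -> \bar R) (B t eta : R) :
  measurable_fun setT N -> (forall w, 0 <= N w)%E -> 0 < B -> 0 < t -> 0 < eta ->
  (\int[P]_w N w <= (B * t)%:E)%E ->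
  exists E, [/\ measurable E, (P E <= (eta / 4)%:E)%E &
    forall w, ~ E w -> (N w <= (4 * B / eta * t)%:E)%E].
Proof.
move=> mN N0 B0 t0 eta0 iN.
have K0 : 0 < 4 * B / eta * t by rewrite mulr_gt0 // divr_gt0 // mulr_gt0.
have [mE PE] := markov_set mN N0 iN K0.
exists [set w | ((4 * B / eta * t)%:E < N w)%E]; split => //.
  apply: le_trans PE _; rewrite lee_fin le_eqVlt; apply/orP; left; apply/eqP.
  by field; rewrite !gt_eqF.
by move=> w /= /negP; rewrite -leNgt.
Qed.

(** Expand the norm over the total system u, each term over the eigenvectors,
    and exchange the sums: Parseval's identity for e_j removes u. *)
Lemma resolvent_feature_second_moment (F : T -> U) (S : U -> U) lam e eps C :
  bounded_rvec F -> weak_cov P Z F F S -> eigen_system S lam e -> 0 < eps ->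
  (forall n, \sum_(j < n) lam j / (lam j + eps) ^+ 2 <= C) ->
  expect P (fun w => `|resolvent S eps (F (Z w))| ^+ 2) <= C.
Proof.
move=> bF hS eigS e0 sC; have psdS := weak_cov_psd bF hS.
have [mZ _ _ _] := iidZ; have bFZ := bounded_rvec_comp mZ bF.
have lA := resolvent_linear psdS e0; have bA := resolvent_bounded psdS e0.
have [on _ lam0 _ _] := eigS.
pose t j := lam j / (lam j + eps) ^+ 2.
have t0 j : 0 <= t j by rewrite divr_ge0 ?sqr_ge0 // ltW.
have hl l : ((expect P (fun w => inner (resolvent S eps (F (Z w))) (u l) ^+ 2))%:E =
    \sum_(j <oo) (t j * inner (u l) (e j) ^+ 2)%:E)%E.
  rewrite -(resolvent_trace psdS eigS e0 (resolventK psdS e0 (u l))) hS; congr EFin.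
  by congr expect; apply/funext => w; rewrite resolvent_sym // expr2.
rewrite -lee_fin (expect_norm_sqr ou tu); last exact: bounded_rvec_op.
under eq_eseriesr do rewrite hl.
rewrite nneseries_interchange; last first.
  by move=> l j; rewrite lee_fin mulr_ge0 ?sqr_ge0.
have hj j : (\sum_(l <oo) (t j * inner (u l) (e j) ^+ 2)%:E = (t j)%:E)%E.
  under eq_eseriesr do rewrite EFinM innerC.
  rewrite nneseriesZl; last by move=> l _; rewrite lee_fin sqr_ge0.
  by rewrite parseval // -inner_norm on eqxx mule1.
under eq_eseriesr do rewrite hj.
exact: nneseries_le.
Qed.

Context (F : T -> U) (G : T -> V) (bF : bounded_rvec F) (bG : bounded_rvec G).
Hypothesis cF : forall h, expect P (fun w => inner (F (Z w)) h) = 0.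
Context (S : U -> U) (C : V -> U) (hS : weak_cov P Z F F S) (hC : weak_cov P Z F G C).
Context (lam : nat -> R) (e : nat -> U) (eigS : eigen_system S lam e).
Context (alpha beta c : R) (alpha1 : 1 < alpha) (beta0 : 0 < beta).
Hypothesis lam_decay : forall j, lam j <= c * j.+1%:R `^ (- alpha).
Context (A : V -> U) (linA : linear A) (bA : bounded_op A).
Hypothesis SA : forall g, S (A g) = C g.
Hypothesis Aspan : forall g, spanned_by e (A g).
Context (W : V -> U) (bW : bounded_op W).
Hypothesis AW : forall g j, inner (A g) (e j) = lam j `^ beta * inner (W g) (e j).

Let residual t := G t - adjoint A (F t).

Let psdS : psd_op S. Proof. exact: weak_cov_psd bF hS. Qed.

(** The noise of the regression is the empirical covariance of F with the
    residual of G, because A g enters through its inner products with F. *)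
Lemma emp_residual n w g : (0 < n)%N ->
  emp_cov n (fun i => F (Zs i w)) (fun i => G (Zs i w)) g -
    emp_cov n (fun i => F (Zs i w)) (fun i => F (Zs i w)) (A g) =
  emp_mean n (fun i => tensor (F (Zs i w)) (residual (Zs i w)) g) -
    tensor (emp_mean n (fun i => F (Zs i w))) (emp_mean n (fun i => residual (Zs i w))) g.
Proof.
move=> n0; rewrite !emp_covE //.
have -> : emp_mean n (fun i => tensor (F (Zs i w)) (residual (Zs i w)) g) =
    emp_mean n (fun i => tensor (F (Zs i w)) (G (Zs i w)) g) -
    emp_mean n (fun i => tensor (F (Zs i w)) (F (Zs i w)) (A g)).
  rewrite /emp_mean -scalerBr -sumrB; congr (_ *: _); apply: eq_bigr => i _.
  by rewrite /tensor innerBl -scalerBl innerC [inner (adjoint _ _) _]innerC -adjointE //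
    [inner (A g) _]innerC [inner g _]innerC.
have -> : tensor (emp_mean n (fun i => F (Zs i w))) (emp_mean n (fun i => residual (Zs i w))) g =
    tensor (emp_mean n (fun i => F (Zs i w))) (emp_mean n (fun i => G (Zs i w))) g -
    tensor (emp_mean n (fun i => F (Zs i w))) (emp_mean n (fun i => F (Zs i w))) (A g).
  rewrite /tensor -scalerBl; congr (_ *: _); rewrite !emp_mean_inner -mulrBr -sumrB.
  congr (_ * _); apply: eq_bigr => i _.
  by rewrite innerBl [inner (adjoint _ _) _]innerC -adjointE // [inner (A g) _]innerC.
by rewrite !opprD !opprK addrACA.
Qed.

(** Markov's inequality is applied to four second moments: the fluctuation of
    the covariance of F, the mean of F, and the same two quantities after the
    resolvent is applied to F, with the residual in place of the second factor.
    Outside the union of the four events the estimate is deterministic. *)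
Lemma regression_error_bound (eta : R) : 0 < eta ->
  exists2 K, 0 < K & forall n eps, (0 < n)%N -> 0 < eps -> eps <= 1 ->
  exists E, [/\ measurable E, (P E <= eta%:E)%E &
    forall w, ~ E w -> forall g x,
      let f i := F (Zs i w) in let h i := G (Zs i w) in
      emp_cov n f f x + eps *: x = emp_cov n f h g ->
      `|x - A g| <= K * regression_rate alpha (Num.min beta 1) n eps * `|g|].
Proof.
move=> eta0; have [mZ mZs _ _] := iidZ; have [_ _ lam0 _ _] := eigS.
have laA := adjoint_linear linA bA; have baA := adjoint_bounded linA bA.
have bV : bounded_rvec residual by apply: bounded_rvecB => //; exact: bounded_rvec_op.
have [_ [M FM]] := bF; have [_ [MV VM]] := bV.
have [CW CW0 hCW] := bounded_op_gt0 bW.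
have [Cl Cl0 hCl] := polynomial_trace_bound alpha1 lam0 lam_decay.
pose t0 : T := Z point.
have M0 : 0 <= M := le_trans (normr_ge0 _) (FM t0).
have MV0 : 0 <= MV := le_trans (normr_ge0 _) (VM t0).
have FM2 t : `|F t| ^+ 2 <= M ^+ 2 by rewrite ler_pXn2r ?nnegrE.
have VM2 t : `|residual t| ^+ 2 <= MV ^+ 2 by rewrite ler_pXn2r ?nnegrE.
have bFZ := bounded_rvec_comp mZ bF.
have EF : expect P (fun w => `|F (Z w)| ^+ 2) <= M ^+ 2.
  rewrite -[leRHS](expect_cst P); apply: expect_le => //.
    exact: (bounded_rvec_norm_sqr ou tu bFZ).
  exact: bounded_mfun_cst.
(* One constant that dominates the four expectations. *)
pose B := M ^+ 2 * M ^+ 2 + M ^+ 2 + MV ^+ 2 * Cl + Cl.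
have [b1 b2 b3 b4] : [/\ M ^+ 2 * M ^+ 2 <= B, M ^+ 2 <= B, MV ^+ 2 * Cl <= B & Cl <= B].
  have p1 : 0 <= M ^+ 2 * M ^+ 2 by rewrite mulr_ge0 ?sqr_ge0.
  have p2 := sqr_ge0 M.
  have p3 : 0 <= MV ^+ 2 * Cl by rewrite mulr_ge0 ?sqr_ge0 // ltW.
  by rewrite /B; split; lra.
have B0 : 0 < B by exact: lt_le_trans Cl0 b4.
pose K := 4 * B / eta.
have K0 : 0 < K by rewrite divr_gt0 // mulr_gt0.
pose k := Num.sqrt K.
have k0 : 0 < k by rewrite sqrtr_gt0.
have k2 : k ^+ 2 = K by rewrite sqr_sqrtr // ltW.
pose p := k * (1 + M); pose q := k * (1 + MV).
pose Cb := (1 + lam 0%N `^ (beta - 1)) * CW.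
have p0 : 0 <= p by rewrite mulr_ge0 ?addr_ge0 // ltW.
have q0 : 0 < q by rewrite mulr_gt0 // ltr_wpDr.
have Cb0 : 0 <= Cb by rewrite mulr_ge0 ?addr_ge0 ?powR_ge0 // ltW.
exists (q + Cb + p * q + p * Cb).
  have pq0 : 0 <= p * q by rewrite mulr_ge0 // ltW.
  by have pC0 : 0 <= p * Cb; [rewrite mulr_ge0 | lra].
move=> n eps n0 e0 e1.
pose b := Num.min beta 1.
pose s : R := n%:R `^ (- (1 / 2)).
have nR0 : 0 < n%:R :> R by rewrite ltr0n.
have s0 : 0 < s by exact: powR_gt0.
have s2 : s ^+ 2 = n%:R^-1.
  by rewrite /s gt0_powR_sqr // mulrN mulrCA divff // mulr1 powR_inv1 // ltW.
pose del := eps `^ (- ((alpha + 1) / (2 * alpha))).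
have del0 : 0 < del by exact: powR_gt0.
have alphaN0 : alpha != 0 by apply: lt0r_neq0; exact: lt_trans ltr01 alpha1.
have d2 : del ^+ 2 = eps `^ (- ((alpha + 1) / alpha)).
  by rewrite /del gt0_powR_sqr //; congr (_ `^ _); field.
have tr m : \sum_(j < m) lam j / (lam j + eps) ^+ 2 <= Cl * del ^+ 2.
  by rewrite d2; exact: hCl.
have lR := resolvent_linear psdS e0; have bR := resolvent_bounded psdS e0.
pose AF t := resolvent S eps (F t).
have bAF : bounded_rvec AF by exact: bounded_rvec_op.
have EAF := resolvent_feature_second_moment bF hS eigS e0 tr.
(* The residual is uncorrelated with F, since S A = C. *)
have cov0 : weak_cov P Z AF residual (fun=> 0).
  move=> g h; rewrite inner0l; apply/esym.
  have -> : (fun w => inner (residual (Z w)) g * inner (AF (Z w)) h) =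
     (fun w => inner (G (Z w)) g * inner (F (Z w)) (resolvent S eps h) -
       inner (F (Z w)) (A g) * inner (F (Z w)) (resolvent S eps h)).
    apply/funext => w; rewrite /residual /AF resolvent_sym // innerBl mulrBl.
    by rewrite [inner (adjoint _ _) _]innerC -adjointE // [inner (A g) _]innerC.
  rewrite expectB; last 2 first.
  - by apply: bounded_mfunM; apply: bounded_rvec_inner => //; exact: bounded_rvec_comp.
  - by apply: bounded_mfunM; apply: bounded_rvec_inner => //; exact: bounded_rvec_comp.
  by rewrite -hC -hS SA subrr.
have [N1 [mN1 N10 iN1 hN1]] := tensor_fluctuation iidZ ou tu ou tu n0 bF bF hS FM2.
have [N3 [mN3 N30 iN3 hN3]] := tensor_fluctuation iidZ ou tu ov tv n0 bAF bV cov0 VM2.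
pose Fm w := emp_mean n (fun i => F (Zs i w)).
have bFm : bounded_rvec Fm by exact: (bounded_rvec_emp_mean iidZ n bF).
have bRFm : bounded_rvec (fun w => resolvent S eps (Fm w)) by exact: bounded_rvec_op.
pose N2 w := (`|Fm w| ^+ 2)%:E; pose N4 w := (`|resolvent S eps (Fm w)| ^+ 2)%:E.
have mN2 : measurable_fun setT N2.
  by apply/measurable_EFinP; case: (bounded_rvec_norm_sqr ou tu bFm).
have mN4 : measurable_fun setT N4.
  by apply/measurable_EFinP; case: (bounded_rvec_norm_sqr ou tu bRFm).
have N20 w : (0 <= N2 w)%E by rewrite lee_fin sqr_ge0.
have N40 w : (0 <= N4 w)%E by rewrite lee_fin sqr_ge0.
have ni0 : 0 < n%:R^-1 :> R by rewrite invr_gt0.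
have dn0 : 0 < n%:R^-1 * del ^+ 2 by rewrite mulr_gt0 // exprn_gt0.
have {}iN1 : (\int[P]_w N1 w <= (B * n%:R^-1)%:E)%E.
  apply: le_trans iN1 _; rewrite lee_fin mulrCA mulrC ler_wpM2r ?(ltW ni0) //.
  by apply: le_trans b1; rewrite ler_wpM2l ?sqr_ge0.
have iN2 : (\int[P]_w N2 w <= (B * n%:R^-1)%:E)%E.
  rewrite EFin_expect; last exact: (bounded_rvec_norm_sqr ou tu bFm).
  rewrite lee_fin; have := expect_emp_mean_norm_sqr iidZ ou tu (m := 0) n0 bF _.
  under eq_fun do rewrite subr0.
  move=> h; apply: le_trans (h _) _; first by move=> x; rewrite inner0l cF.
  by rewrite mulrC ler_wpM2r ?(ltW ni0) // (le_trans EF).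
have {}iN3 : (\int[P]_w N3 w <= (B * (n%:R^-1 * del ^+ 2))%:E)%E.
  apply: le_trans iN3 _; rewrite lee_fin.
  apply: le_trans (_ : MV ^+ 2 * (n%:R^-1 * (Cl * del ^+ 2)) <= _).
    by rewrite !ler_wpM2l ?sqr_ge0 ?(ltW ni0).
  by rewrite [leLHS](_ : _ = MV ^+ 2 * Cl * (n%:R^-1 * del ^+ 2)) ?ler_wpM2r ?(ltW dn0) //; ring.
have iN4 : (\int[P]_w N4 w <= (B * (n%:R^-1 * del ^+ 2))%:E)%E.
  rewrite EFin_expect; last exact: (bounded_rvec_norm_sqr ou tu bRFm).
  rewrite lee_fin; have := expect_emp_mean_norm_sqr iidZ ou tu (m := 0) n0 bAF _.
  have -> : (fun w => `|emp_mean n (fun i => AF (Zs i w)) - 0| ^+ 2) =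
      (fun w => `|resolvent S eps (Fm w)| ^+ 2).
    by apply/funext => w; rewrite subr0 /Fm emp_mean_op.
  move=> h; apply: le_trans (h _) _.
    move=> x; rewrite inner0l -(cF (resolvent S eps x)); congr expect.
    by apply/funext => w; rewrite /AF resolvent_sym.
  apply: le_trans (_ : n%:R^-1 * (Cl * del ^+ 2) <= _); first by rewrite ler_wpM2l ?(ltW ni0).
  by rewrite mulrCA ler_wpM2r ?(ltW dn0).
have [E1 [mE1 PE1 hE1]] := markov_event mN1 N10 B0 ni0 eta0 iN1.
have [E2 [mE2 PE2 hE2]] := markov_event mN2 N20 B0 ni0 eta0 iN2.
have [E3 [mE3 PE3 hE3]] := markov_event mN3 N30 B0 dn0 eta0 iN3.
have [E4 [mE4 PE4 hE4]] := markov_event mN4 N40 B0 dn0 eta0 iN4.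
have m12 : measurable (E1 `|` E2) by exact: measurableU.
have m34 : measurable (E3 `|` E4) by exact: measurableU.
exists ((E1 `|` E2) `|` (E3 `|` E4)); split.
- exact: measurableU.
- have -> : eta = (eta / 4 + eta / 4) + (eta / 4 + eta / 4) by lra.
  apply: le_trans (@measureU2 _ _ _ P _ _ m12 m34) _; rewrite EFinD; apply: leeD.
    apply: le_trans (@measureU2 _ _ _ P _ _ mE1 mE2) _.
    by rewrite EFinD; exact: leeD.
  apply: le_trans (@measureU2 _ _ _ P _ _ mE3 mE4) _.
  by rewrite EFinD; exact: leeD.
move=> w /not_orP[/not_orP[/hE1 w1 /hE2 w2] /not_orP[/hE3 w3 /hE4 w4]] g x f h xg.
rewrite -/K in w1 w2 w3 w4.
have s1 (y : R) (z : R) : 0 <= z -> y ^+ 2 <= K * n%:R^-1 * z ^+ 2 -> y <= k * s * z.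
  move=> z0 yz; apply: le_trans (ler_norm _) _.
  rewrite -(@ler_pXn2r _ 2) ?nnegrE ?mulr_ge0 ?(ltW k0) ?(ltW s0) //.
  by rewrite real_normK ?num_real // !exprMn k2 s2.
have s3 (y : R) (z : R) : 0 <= z -> y ^+ 2 <= K * (n%:R^-1 * del ^+ 2) * z ^+ 2 ->
    y <= k * s * del * z.
  move=> z0 yz; rewrite -[_ * del * z]mulrA; apply: s1; first by rewrite mulr_ge0 // ltW.
  by rewrite exprMn mulrA -[_ * _ * del ^+ 2]mulrA.
have Fmn : `|Fm w| <= k * s.
  by rewrite -[leRHS]mulr1; apply: s1 => //; rewrite expr1n mulr1 -lee_fin.
have RFmn : `|resolvent S eps (Fm w)| <= k * s * del.
  by rewrite -[leRHS]mulr1; apply: s3 => //; rewrite expr1n mulr1 -lee_fin.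
have emp_le (H : hilbert R) (y : nat -> H) N : (forall i, `|y i| <= N) -> `|emp_mean n y| <= N.
  move=> yN; rewrite /emp_mean normrZ gtr0_norm // ler_pdivrMl //.
  apply: le_trans (ler_norm_sum _ _ _) _; rewrite mulr_natl -[in leRHS](card_ord n) -sumr_const.
  by apply: ler_sum => i _; exact: yN.
have FmM : `|Fm w| <= M by exact: emp_le.
pose Vm := emp_mean n (fun i => residual (Zs i w)).
have VmM : `|Vm| <= MV by exact: emp_le.
have hS1 z : `|emp_cov n f f z - S z| <= p * s * `|z|.
  rewrite emp_covE // addrAC; apply: le_trans (ler_normB _ _) _.
  have h1 := hN1 w _ w1 z.
  have h2 : `|emp_mean n (fun i => tensor (f i) (f i) z) - S z| <= k * s * `|z|.
    exact: s1.
  have h3 : `|tensor (emp_mean n f) (emp_mean n f) z| <= k * s * M * `|z|.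
    rewrite /tensor normrZ -/(Fm w) mulrC -[leRHS]mulrA.
    apply: ler_pM => //; apply: le_trans (inner_le _ _) _; exact: ler_wpM2r.
  by apply: le_trans (lerD h2 h3) _; rewrite le_eqVlt; apply/orP; left; apply/eqP; rewrite /p; ring.
apply: le_trans (resolvent_perturbation psdS e0 (A g) (emp_cov_psd n f) hS1 xg) _.
have hD : `|resolvent S eps (emp_cov n f h g - emp_cov n f f (A g) - eps *: A g)| <=
    (q * (s * del) + Cb * eps `^ b) * `|g|.
  rewrite emp_residual // !(linB lR).
  have h3 : `|resolvent S eps (emp_mean n (fun i => tensor (f i) (residual (Zs i w)) g))| <=
     k * s * del * `|g|.
    apply: s3 => //; have := hN3 w _ w3 g; rewrite subr0 emp_mean_op //.
    have -> // : (fun i => resolvent S eps (tensor (f i) (residual (Zs i w)) g)) =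
       (fun i => tensor (AF (Zs i w)) (residual (Zs i w)) g).
    by apply/funext => i; rewrite /tensor (linZ lR).
  have h4 : `|resolvent S eps (tensor (emp_mean n f) Vm g)| <= k * s * del * MV * `|g|.
    rewrite /tensor (linZ lR) normrZ mulrC -[leRHS]mulrA.
    apply: ler_pM => //; apply: le_trans (inner_le _ _) _; exact: ler_wpM2r.
  have h5 : `|resolvent S eps (eps *: A g)| <= Cb * eps `^ b * `|g|.
    apply: le_trans (tikhonov_bias_op psdS e0 eigS beta0 (Aspan g) (AW g)) _.
    rewrite /Cb -/b [leRHS](_ : _ = (1 + lam 0%N `^ (beta - 1)) * eps `^ b * (CW * `|g|)); last by ring.
    by rewrite ler_wpM2l // mulr_ge0 ?addr_ge0 ?powR_ge0.
  apply: le_trans (ler_normB _ _) _; apply: le_trans (lerD (ler_normB _ _) (lexx _)) _.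
  apply: le_trans (lerD (lerD h3 h4) h5) _.
  by rewrite le_eqVlt; apply/orP; left; apply/eqP; rewrite /q; ring.
have a0 : 0 <= 1 + p * s / eps.
  have sge0 := ltW s0; have eige0 : 0 <= eps^-1 by rewrite invr_ge0 ltW.
  by apply: addr_ge0 => //; apply: mulr_ge0 => //; exact: mulr_ge0.
apply: le_trans (ler_wpM2l a0 hD) _; rewrite mulrA ler_wpM2r //.
rewrite /regression_rate -/b -/s -/del.
have -> : eps `^ (b - 1) = eps^-1 * eps `^ b by rewrite gt0_powRVE.
have -> : eps `^ (- ((3 * alpha + 1) / (2 * alpha))) = eps^-1 * del.
  by rewrite /del gt0_powRVE //; congr (_ `^ _); field.
rewrite -s2.
set eb := eps `^ b; set ei := eps^-1.
have eb0 : 0 <= eb by exact: powR_ge0.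
have ei0 : 0 <= ei by rewrite invr_ge0 ltW.
have x1 : 0 <= s * (ei * eb) by rewrite !mulr_ge0 // ltW.
have x2 : 0 <= s ^+ 2 * (ei * del) by rewrite !mulr_ge0 ?sqr_ge0 // ltW.
have x3 : 0 <= s * del by rewrite mulr_ge0 // ltW.
rewrite [leLHS](_ : _ = q * (s * del) + Cb * eb + p * q * (s ^+ 2 * (ei * del))
  + p * Cb * (s * (ei * eb))); last by ring.
have c1 := ltW q0; have c2 : 0 <= p * q by rewrite mulr_ge0.
have c3 : 0 <= p * Cb by rewrite mulr_ge0.
set tot := q + Cb + p * q + p * Cb.
have t1 : q <= tot by rewrite /tot; lra.
have t2 : Cb <= tot by rewrite /tot; lra.
have t3 : p * q <= tot by rewrite /tot; lra.
have t4 : p * Cb <= tot by rewrite /tot; lra.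
rewrite [leRHS](_ : _ = tot * (s * del) + tot * eb + tot * (s ^+ 2 * (ei * del))
  + tot * (s * (ei * eb))); last by ring.
by rewrite !lerD // ler_wpM2r.
Qed.

End regression_error.

(** * Random elements of a nonmeasurable domain *)

(** T with the sets that agree on D with a measurable set. It is an alias of T
    rather than a subtype, so that maps and samples need no repackaging. *)
Definition trace_space {d} {T : measurableType d} (D : set T) : Type := T.

Section trace_sigma_algebra.
Context {d} {T : measurableType d} (D : set T).

Definition trace_measurable : set (set T) :=
  [set A | exists2 C, measurable C & A `&` D = C `&` D].

Let trace0 : trace_measurable set0.
Proof. by exists set0. Qed.

Let traceC A : trace_measurable A -> trace_measurable (~` A).
Proof.
move=> [C mC AC]; exists (~` C); first exact: measurableC.
apply/seteqP; split=> x [nx Dx]; split => // h; apply: nx.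
  by have [] : (A `&` D) x by rewrite AC.
by have [] : (C `&` D) x by rewrite -AC.
Qed.

Let trace_bigcup (A : (set T)^nat) : (forall i, trace_measurable (A i)) ->
  trace_measurable (\bigcup_i A i).
Proof.
move=> mA; have [C hC] : {C : (set T)^nat &
    forall i, measurable (C i) /\ A i `&` D = C i `&` D}.
  apply: (@choice _ _ (fun i C => measurable C /\ A i `&` D = C `&` D)) => i.
  by have [C mC AC] := mA i; exists C.
exists (\bigcup_i C i); first by apply: bigcupT_measurable => i; case: (hC i).
by rewrite !setI_bigcupl; apply: eq_bigcupr => i _; case: (hC i).
Qed.

HB.instance Definition _ := Pointed.on (trace_space D).

HB.instance Definition _ := @isMeasurable.Build default_measure_display
  (trace_space D) trace_measurable trace0 traceC trace_bigcup.

Lemma measurable_to_trace {d'} {Omega : measurableType d'} (Z : Omega -> T) :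
  measurable_fun setT Z -> (forall w, D (Z w)) ->
  measurable_fun setT (Z : Omega -> trace_space D).
Proof.
move=> mZ DZ _ A [C mC AC]; have -> : Z @^-1` A = Z @^-1` C.
  apply/seteqP; split=> w /= h.
    by have [] : (C `&` D) (Z w) by rewrite -AC.
  by have [] : (A `&` D) (Z w) by rewrite AC.
exact: mZ.
Qed.

Lemma measurable_from_trace {R : realType} (f g : T -> R) :
  (forall z, D z -> f z = g z) ->
  (forall x, exists2 C, measurable C & forall z, D z -> (C z <-> x < g z)) ->
  measurable_fun setT (f : trace_space D -> R).
Proof.
move=> fg hg mT; apply: (measurability _ (RGenOInfty.measurableE R)) => //.
move=> _ [_ [x ->] <-]; rewrite setTI.
have [C mC hC] := hg x; exists C => //.
apply/seteqP; split=> z [h Dz]; split => //.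
  by apply/hC => //; move: h; rewrite /= in_itv /= andbT fg.
by rewrite /= in_itv /= andbT fg //; apply/hC.
Qed.

End trace_sigma_algebra.

Section sections_measurable.
Context {R : realType} {p : nat} {D : set 'rV[R]_p}.
Context {kappa : 'rV[R]_p -> 'rV[R]_p -> R} (H : rkhs D kappa).

(** On D the superlevel set of a continuous function is cut out by an open set,
    although D itself need not be measurable. *)
Lemma section_superlevel (a : H) (h : H) (x : R) : continuous_kernel D kappa ->
  exists2 O : set (borel 'rV[R]_p), measurable O &
    forall y, D y -> (O y <-> x < inner (rk_sec H y - a) h).
Proof.
move=> kc; pose A := [set y : 'rV[R]_p | D y -> x < inner (rk_sec H y - a) h].
exists (A^°).
  by apply: sub_sigma_algebra; exact: open_interior.
move=> y Dy; split.
  by move=> /interior_subset /(_ Dy).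
move=> xy; have e0 : 0 < inner (rk_sec H y - a) h - x by rewrite subr_gt0.
have h0 : 0 < `|h| + 1 by rewrite ltr_wpDl.
have := section_continuous H kc Dy (divr_gt0 e0 h0).
apply: filterS => z hz Dz; have {}hz := hz Dz.
have : inner (rk_sec H y - rk_sec H z) h < inner (rk_sec H y - a) h - x.
  apply: le_lt_trans (inner_le_norm _ _) _.
  apply: le_lt_trans (_ : `|rk_sec H y - rk_sec H z| * (`|h| + 1) < _).
    by rewrite ler_wpM2l // lerDl.
  by rewrite -ltr_pdivlMr.
rewrite !innerBl; lra.
Qed.

End sections_measurable.

(** * The population regression operator *)
Section hilbert_expectation.
Context {d} {Omega : measurableType d} {R : realType} (P : probability Omega R).

Lemma hmeanE {U : hilbert R} (F : Omega -> U) h : bounded_rvec F ->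
  inner (hmean P F) h = expect P (fun w => inner (F w) h).
Proof.
move=> bF; have bFh g := bounded_rvec_inner g bF.
have EE g : 'E_P[fun w => inner (F w) g]%E = (expect P (fun w => inner (F w) g))%:E.
  by rewrite unlock EFin_expect.
rewrite /hmean; set Q := (X in xget _ X).
suff ex : exists m, Q m.
  have /= Qm := xgetPex 0 ex; have [_] := Qm h.
  by rewrite EE => hh; exact/esym/EFin_inj.
have [||m hm] := @riesz R U (fun g => expect P (fun w => inner (F w) g)).
- move=> a x y; transitivity (a * expect P (fun w => inner (F w) x) +
    expect P (fun w => inner (F w) y)); last by [].
  rewrite -expectZ // -expectD //; last exact: bounded_mfunZ.
  by congr expect; apply/funext => w; rewrite innerDr innerZr.
- have [_ [M FM]] := bF; exists M => x; apply: expect_norm_le => // w.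
  by apply: le_trans (inner_le _ _) _; rewrite ler_wpM2r.
exists m => g; split; first exact: bounded_mfun_integrable.
by rewrite EE hm.
Qed.

End hilbert_expectation.

Section regression_operator.
Context {R : realType} {U V : hilbert R} (S : U -> U) (C : V -> U).
Context (lam : nat -> R) (e : nat -> U).
Hypothesis (psdS : psd_op S) (eigS : eigen_system S lam e) (linC : linear C).
Hypothesis (rangeC : range C `<=` range S).

Let A := mp_inv S \o C.

Lemma ker_eigen z : S z = 0 -> forall j, inner z (e j) = 0.
Proof.
move=> Sz j; have [_ _ lam0 _ _] := eigS.
have := inner_eigen psdS eigS z j; rewrite Sz inner0l => /esym/eqP.
by rewrite mulf_eq0 gt_eqF //= => /eqP.
Qed.

(** The sum of the Fourier series of x, which converges by Bessel's inequality. *)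
Lemma ortho_component x : exists2 y, spanned_by e y &
  forall j, inner y (e j) = inner x (e j).
Proof.
have oe := eigen_ortho eigS.
have cv : cvgn (fun n => \sum_(i < n) inner x (e i) *: e i).
  apply: (@ortho_series_cvg _ _ e (fun i => inner x (e i)) (`|x| ^+ 2)) => // n.
  exact: bessel.
exists (limn (fun n => \sum_(i < n) inner x (e i) *: e i)).
  move=> f fe; have c1 := inner_cvgl (v := f) cv.
  rewrite innerC; suff c2 : inner (\sum_(i < n) inner x (e i) *: e i) f @[n --> \oo] --> (0 : R).
    by apply: cvg_unique c1 c2.
  apply: cvg_near_cst; exists 0%N => // n _; rewrite inner_suml big1 // => i _.
  by rewrite innerZl (innerC (e i)) fe mulr0.
move=> j; have c1 := inner_cvgl (v := e j) cv.
suff c2 : inner (\sum_(i < n) inner x (e i) *: e i) (e j) @[n --> \oo] --> inner x (e j).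
  by apply: cvg_unique c1 c2.
apply: cvg_near_cst; exists j.+1 => // n /= jn.
by rewrite (ortho_sum_inner (fun i => inner x (e i))) // jn mul1r ortho_coefE.
Qed.

(** A preimage of C g under S, stripped of its component orthogonal to the
    eigenvectors, is orthogonal to the kernel of S. *)
Lemma regressionP g : (forall z, S z = 0 -> inner (A g) z = 0) /\ S (A g) = C g.
Proof.
rewrite /A /= /mp_inv; set Q := (X in xget _ X).
suff ex : exists x, Q x by have := xgetPex 0 ex.
have [lS _ _ _] := psdS; have [_ _ _ _ ker] := eigS.
have [x0 _ Sx0] : range S (C g) by apply: rangeC; exists g.
have [y ye yx] := ortho_component x0.
exists y; split => [z Sz|].
  by rewrite innerC; apply: ye; exact: ker_eigen.
rewrite -Sx0; apply/subr0_eq; rewrite -(linB lS); apply: ker => j.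
by rewrite innerBl yx subrr.
Qed.

Lemma regression_spanned g : spanned_by e (A g).
Proof.
have [_ _ _ _ ker] := eigS; have [Ag _] := regressionP g.
by move=> f fe; rewrite innerC; apply: Ag; apply: ker.
Qed.

Lemma regression_linear : linear A.
Proof.
have [lS _ _ _] := psdS.
move=> a x y; have [k1 s1] := regressionP (a *: x + y).
have [k2 s2] := regressionP x; have [k3 s3] := regressionP y.
apply/subr0_eq/inner_eq0.
set z := _ - _.
have Sz : S z = 0.
  by rewrite /z (linB lS) s1 lS s2 s3 linC subrr.
by rewrite {1}/z innerBl innerPl k1 // k2 // k3 // mulr0 addr0 subrr.
Qed.

Lemma regression_coef (beta : R) (W : V -> U) g j : 0 < beta ->
  (forall g, C g = spectral_power lam e (1 + beta) (W g)) ->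
  inner (A g) (e j) = lam j `^ beta * inner (W g) (e j).
Proof.
move=> b0 CW; have [_ sA] := regressionP g; have [_ _ lam0 _ _] := eigS.
have l0 : lam j != 0 by rewrite gt_eqF.
apply: (mulfI l0); rewrite -(inner_eigen psdS eigS) sA CW.
rewrite (spectral_power_coef eigS); last by rewrite addr_ge0 // ltW.
by rewrite gt0_powRD // powRr1 ?(ltW (lam0 j)) // mulrA.
Qed.

End regression_operator.

Section closed_span.
Context {R : realType} {U : hilbert R}.

Lemma closure_normP (B : set U) x :
  closure B x <-> forall e, 0 < e -> exists2 y, B y & `|x - y| < e.
Proof.
split=> [cx e e0|h N /nbhs_ballP[e /= e0 eN]].
  have [y [By]] := cx _ (nbhsx_ballx x e e0).
  by rewrite -ball_normE /ball_ /=; exists y.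
have [y By xy] := h e e0; exists y; split => //; apply: eN.
by rewrite -ball_normE.
Qed.

Lemma lin_spanP (B : set U) a x y :
  lin_span B x -> lin_span B y -> lin_span B (a *: x + y).
Proof.
move=> [m [c [b [hb ->]]]] [m' [c' [b' [hb' ->]]]].
exists (m + m')%N, (fun i => match fintype.split i with inl k => a * c k | inr k => c' k end),
  (fun i => match fintype.split i with inl k => b k | inr k => b' k end); split.
  by move=> i; case: fintype.split => k.
rewrite big_split_ord scaler_sumr /=; congr (_ + _); apply: eq_bigr => i _.
  by rewrite (unsplitK (inl i)) scalerA.
by rewrite (unsplitK (inr i)).
Qed.

Lemma closed_subspace_span (B : set U) : closed_subspace (closure (lin_span B)).
Proof.
split; last exact: closed_closure.
  apply: subset_closure; exists 0%N, (fun=> 0), (fun=> 0); split; first by case.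
  by rewrite big_ord0.
move=> a x y /closure_normP cx /closure_normP cy; apply/closure_normP => e e0.
have a0 : 0 < `|a| + 1 by rewrite ltr_wpDl.
have e2 : 0 < e / 2 by rewrite divr_gt0.
have [x' Bx xx] := cx (e / 2 / (`|a| + 1)) (divr_gt0 e2 a0).
have [y' By yy] := cy (e / 2) e2.
exists (a *: x' + y'); first exact: lin_spanP.
have -> : a *: x + y - (a *: x' + y') = a *: (x - x') + (y - y').
  by rewrite opprD addrACA scalerBr.
apply: le_lt_trans (ler_normD _ _) _; rewrite [e]splitr; apply: ler_ltD => //.
rewrite normrZ; apply: le_trans (_ : (`|a| + 1) * `|x - x'| <= _).
  by rewrite ler_wpM2r // lerDl.
by rewrite mulrC -ler_pdivlMr // ltW.
Qed.

End closed_span.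

(** * Features of the sample and the rate of convergence *)
Lemma iid_copies_pairwise {d} {Omega : measurableType d} {R : realType}
    (P : probability Omega R) {d'} {T : measurableType d'} (D : set T)
    (Z : Omega -> T) (Zs : nat -> Omega -> T) :
  measurable_fun setT Z -> (forall i, measurable_fun setT (Zs i)) ->
  (forall w, D (Z w)) -> (forall i w, D (Zs i w)) -> iid_copies P Z Zs ->
  pairwise_iid P (Z : Omega -> trace_space D) Zs.
Proof.
move=> mZ mZs DZ DZs [lawZ indZ].
have pre (X : Omega -> T) A C : (forall w, D (X w)) -> A `&` D = C `&` D ->
    X @^-1` A = X @^-1` C.
  move=> DX eAC; apply/seteqP; split=> w /= h.
    by have [] : (C `&` D) (X w) by rewrite -eAC.
  by have [] : (A `&` D) (X w) by rewrite eAC.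
split.
- exact: measurable_to_trace.
- by move=> i; apply: measurable_to_trace.
- by move=> i A [C mC eAC]; rewrite !(pre _ _ _ _ eAC) // lawZ.
move=> i k ik A B [A' mA' AA] [B' mB' BB].
rewrite (pre _ _ _ (DZs i) AA) (pre _ _ _ (DZs k) BB).
pose C j := if j == i then A' else if j == k then B' else setT.
have mC j : measurable (C j) by rewrite /C; case: ifP => // _; case: ifP.
pose m := (maxn i k).+1.
have im : (i < m)%N by rewrite ltnS leq_maxl.
have km : (k < m)%N by rewrite ltnS leq_maxr.
have Ci : C i = A' by rewrite /C eqxx.
have Ck : C k = B' by rewrite /C eq_sym (negPf ik) eqxx.
have -> : Zs i @^-1` A' `&` Zs k @^-1` B' = \bigcap_(j < m) (Zs j @^-1` C j).
  apply/seteqP; split=> [w [wi wk] j _ /=|w h].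
    by rewrite /C; case: eqP => [->//|_]; case: eqP => [->|].
  by split; [have := h i im; rewrite Ci | have := h k km; rewrite Ck].
rewrite (indZ m C mC) (bigD1 (Ordinal im)) //= Ci (bigD1 (Ordinal km)) /=; last first.
  by rewrite -val_eqE /= eq_sym.
rewrite Ck big1 ?mule1 // => j /andP[]; rewrite -!val_eqE /= => ji jk.
by rewrite /C (negPf ji) (negPf jk) preimage_setT probability_setT.
Qed.

Section centered_features.
Context {d} {Omega : measurableType d} {R : realType} (P : probability Omega R).
Context {p : nat} {D : set 'rV[R]_p}.
Context {kappa : 'rV[R]_p -> 'rV[R]_p -> R} (H : rkhs D kappa).
Hypotheses (kc : continuous_kernel D kappa) (kb : bounded_kernel D kappa).

Lemma section_bounded : exists M, forall x, D x -> `|rk_sec H x| <= M.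
Proof.
have [C hC] := kb; exists (`|C| + 1) => x Dx.
rewrite -(@ler_pXn2r _ 2) ?nnegrE ?addr_ge0 // section_norm_sqr //.
apply: le_trans (ler_norm _) _; apply: le_trans (hC x x Dx Dx) _.
have := ler_norm C; have := normr_ge0 C; nra.
Qed.

(** Centred section at the coordinate pr z, extended by zero off the set where
    the kernels are meaningful. *)
Definition centered_section {T : Type} (E : set T) (pr : T -> 'rV[R]_p) (m : H) (z : T) : H :=
  if `[< E z >] then rk_sec H (pr z) - m else 0.

Lemma centered_sectionE {T : Type} (E : set T) (pr : T -> 'rV[R]_p) m z : E z ->
  centered_section E pr m z = rk_sec H (pr z) - m.
Proof. by move=> Ez; rewrite /centered_section asboolT. Qed.

Lemma centered_section_bounded_rvec {d'} {T : measurableType d'} (E : set T)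
    (pr : T -> borel 'rV[R]_p) m :
  measurable_fun setT pr -> (forall z, E z -> D (pr z)) ->
  bounded_rvec (centered_section E pr m : trace_space E -> H).
Proof.
move=> mpr ED; split.
  move=> h; apply: (@measurable_from_trace _ _ E R _ (fun z => inner (rk_sec H (pr z) - m) h)).
    by move=> z Ez; rewrite centered_sectionE.
  move=> x; have [N mN hN] := section_superlevel m h x kc.
  exists (pr @^-1` N); first by rewrite -[X in measurable X]setTI; exact: mpr.
  by move=> z Ez; apply: hN; exact: ED.
have [M hM] := section_bounded; exists (`|M| + `|m|) => z.
rewrite /centered_section; case: asboolP => Ez; last by rewrite normr0 addr_ge0.
apply: le_trans (ler_normB _ _) _; rewrite lerD2r.
by apply: le_trans (hM _ (ED _ Ez)) (ler_norm _).
Qed.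

Lemma feature_bounded_rvec (X : {RV P >-> borel 'rV[R]_p}) :
  (forall w, D (X w)) -> bounded_rvec (feature H X).
Proof.
move=> DX; have mX : measurable_fun setT X by exact: measurable_funPT.
have bF := @centered_section_bounded_rvec _ (borel 'rV[R]_p) D (fun x => x) 0
  (@measurable_id _ _ _) (fun z Dz => Dz).
have mT := measurable_to_trace mX DX.
have := bounded_rvec_comp mT bF; congr bounded_rvec; apply/funext => w.
by rewrite centered_sectionE // subr0.
Qed.

End centered_features.

Lemma cov_opE {d} {Omega : measurableType d} {R : realType} (P : probability Omega R)
    {U V : hilbert R} (F : Omega -> U) (G : Omega -> V) g h :
  bounded_rvec F -> bounded_rvec G ->
  inner (cov_op P F G g) h =
  expect P (fun w => inner (G w - hmean P G) g * inner (F w - hmean P F) h).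
Proof.
move=> bF bG; have cst (W : hilbert R) (m : W) := @bounded_rvec_cst _ Omega R W m.
have bF' := bounded_rvecB bF (cst _ (hmean P F)).
have bG' := bounded_rvecB bG (cst _ (hmean P G)).
rewrite /cov_op hmeanE; last exact: bounded_rvecZ (bounded_rvec_inner g bG') bF'.
by congr expect; apply/funext => w; rewrite /tensor innerZl.
Qed.

Theorem corollary3p6 (R : realType) (dO : measure_display)
    (Omega : measurableType dO) (P : probability Omega R) (p q d : nat)
    (OmegaX : set 'rV[R]_p) (OmegaY : set 'rV[R]_q)
    (kappaX : 'rV[R]_p -> 'rV[R]_p -> R) (kappaY : 'rV[R]_q -> 'rV[R]_q -> R)
    (HX : rkhs OmegaX kappaX) (HY : rkhs OmegaY kappaY)
    (X : {RV P >-> borel 'rV[R]_p}) (Y : {RV P >-> borel 'rV[R]_q})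
    (Xs : nat -> {RV P >-> borel 'rV[R]_p}) (Ys : nat -> {RV P >-> borel 'rV[R]_q})
    (lam : nat -> R) (e : nat -> HX) (alpha beta : R) (SXY : {linear HY -> HX})
    (eps : nat -> R) (phi : 'I_d -> HX) (phih : nat -> Omega -> 'I_d -> HX) :
  let SigmaXX := cov_op P (feature HX X) (feature HX X) in
  let SigmaXY := cov_op P (feature HX X) (feature HY Y) in
  let RXY := regression P (feature HX X) (feature HY Y) in
  let M := RXY \o adjoint RXY in
  let HX0 := centered_space HX X in
  let Rhat (n : nat) (w : Omega) := emp_regression n (eps n)
    (fun i => feature HX (Xs i) w) (fun i => feature HY (Ys i) w) in
  let Mhat n w := Rhat n w \o adjoint (Rhat n w) in
  let b := Num.min beta 1 in
  let r (n : nat) := n%:R `^ (- (1 / 2)) * eps n `^ (b - 1) + eps n `^ b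
    + n%:R^-1 * eps n `^ (- ((3 * alpha + 1) / (2 * alpha)))
    + n%:R `^ (- (1 / 2)) * eps n `^ (- ((alpha + 1) / (2 * alpha))) in
  (* kernels, random vectors and the i.i.d. sample *)
  pos_def_kernel OmegaX kappaX -> pos_def_kernel OmegaY kappaY ->
  (forall w, OmegaX (X w)) -> (forall w, OmegaY (Y w)) ->
  (forall i w, OmegaX (Xs i w)) -> (forall i w, OmegaY (Ys i w)) ->
  iid_copies P (fun w => (X w, Y w)) (fun i w => (Xs i w, Ys i w)) ->
  (* Assumption 1 *)
  dense_L2_mod_constants HX X -> dense_L2_mod_constants HY Y ->
  (* Assumption 2 *)
  bounded_kernel OmegaX kappaX -> continuous_kernel OmegaX kappaX ->
  bounded_kernel OmegaY kappaY -> continuous_kernel OmegaY kappaY ->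
  (* Assumption 3 *)
  range SigmaXY `<=` range SigmaXX ->
  (* Assumption 4 *)
  bounded_op RXY ->
  (* Assumption 5 *)
  dominated_cond_distr P X Y OmegaY ->
  (* Assumption 6 *)
  (exists f : 'I_d -> HX, cond_indep P X Y (sigma_of X f) /\
    forall (d' : nat) (g : 'I_d' -> HX),
      cond_indep P X Y (sigma_of X g) -> sigma_of X f `<=` sigma_of X g) ->
  (* Assumption 7 *)
  has_rank RXY d ->
  (* Assumption 9 *)
  1 < alpha -> eigen_system SigmaXX lam e ->
  (exists c : R, forall j : nat,
    lam j <= c * j.+1%:R `^ (- alpha) /\ j.+1%:R `^ (- alpha) <= c * lam j) ->
  (* Assumption 10 *)
  0 < beta -> bounded_op SXY ->
  (forall g : HY, SigmaXY g = spectral_power lam e (1 + beta) (SXY g)) ->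
  (forall n, 0 < eps n) -> eps @ \oo --> 0 ->
  distinct_nonzero_eigenvalues M ->
  seq_maximizers HX0 M phi ->
  (forall n w, (0 < n)%N -> seq_maximizers HX0 (Mhat n w) (phih n w)) ->
  forall j : 'I_d,
    bigOp P (fun n w =>
      `|phih n w j - Num.sg (inner (phih n w j) (phi j)) *: phi j|) r.
Proof.
move=> SigmaXX SigmaXY RXY M HX0 Rhat Mhat b r _ _ DX DY DXs DYs iid _ _ kbX kcX kbY kcY.
move=> ran bRXY _ _ rk alpha1 eig [c lamc] beta0 bS SE eps0 epscvg dist mphi mphih j.
have [u ou tu] := rkhs_countable_total HX kcX.
have [v ov tv] := rkhs_countable_total HY kcY.
have bFX := feature_bounded_rvec HX kcX kbX DX.
have bFY := feature_bounded_rvec HY kcY kbY DY.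
pose mX := hmean P (feature HX X); pose mY := hmean P (feature HY Y).
pose E : set (borel 'rV[R]_p * borel 'rV[R]_q)%type := [set z | OmegaX z.1 /\ OmegaY z.2].
pose Z w := (X w, Y w); pose Zs i w := (Xs i w, Ys i w).
have mZ : measurable_fun setT Z by apply: measurable_fun_pair; exact: measurable_funPT.
have mZs i : measurable_fun setT (Zs i).
  by apply: measurable_fun_pair; exact: measurable_funPT.
have EZ w : E (Z w) by split; [exact: DX | exact: DY].
have EZs i w : E (Zs i w) by split; [exact: DXs | exact: DYs].
have iidZ := iid_copies_pairwise mZ mZs EZ EZs iid.
pose F : trace_space E -> HX := centered_section E (fun z => z.1) mX.
pose G : trace_space E -> HY := centered_section E (fun z => z.2) mY.
have bF : bounded_rvec F.
  apply: centered_section_bounded_rvec => //; first exact: measurable_fst.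
  by move=> z [].
have bG : bounded_rvec G.
  apply: centered_section_bounded_rvec => //; first exact: measurable_snd.
  by move=> z [].
have FE w : F (Z w) = feature HX X w - mX by rewrite /F centered_sectionE.
have GE w : G (Z w) = feature HY Y w - mY by rewrite /G centered_sectionE.
have FsE i w : F (Zs i w) = feature HX (Xs i) w - mX by rewrite /F centered_sectionE.
have GsE i w : G (Zs i w) = feature HY (Ys i) w - mY by rewrite /G centered_sectionE.
have hS : weak_cov P Z F F SigmaXX.
  move=> g h; rewrite /SigmaXX cov_opE //; congr expect; apply/funext => w.
  by rewrite FE.
have hC : weak_cov P Z F G SigmaXY.
  move=> g h; rewrite /SigmaXY cov_opE //; congr expect; apply/funext => w.
  by rewrite FE GE.
have cF h : expect P (fun w => inner (F (Z w)) h) = 0.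
  have -> : (fun w => inner (F (Z w)) h) = (fun w => inner (feature HX X w) h - inner mX h).
    by apply/funext => w; rewrite FE innerBl.
  rewrite expectB; [|exact: bounded_rvec_inner|exact: bounded_mfun_cst].
  by rewrite expect_cst /mX hmeanE // subrr.
have psdS := weak_cov_psd iidZ bF hS.
have lC := weak_cov_linear iidZ bF bG hC.
have lR : linear RXY := regression_linear psdS eig lC ran.
have SR g : SigmaXX (RXY g) = SigmaXY g by case: (regressionP psdS eig ran g).
have spR g : spanned_by e (RXY g) := regression_spanned psdS eig ran g.
have RS g k : inner (RXY g) (e k) = lam k `^ beta * inner (SXY g) (e k).
  exact: (regression_coef psdS eig ran g k beta0 SE).
have lamc' k : lam k <= c * k.+1%:R `^ (- alpha) by case: (lamc k).
have [K0 Klin Kcl] : closed_subspace HX0 by exact: closed_subspace_span.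
have HX0sec x : OmegaX x -> HX0 (rk_sec HX x - mX).
  move=> Dx; apply: subset_closure; exists 1%N, (fun=> 1), (fun=> rk_sec HX x - mX).
  by split; [move=> _; exists x | rewrite big_ord1 scale1r].
have KR g : HX0 (RXY g).
  apply: closed_subspace_biorth => // f fK; apply: spR => k.
  have [_ ev lam0 _ _] := eig; have [_ _ sS _] := psdS.
  suff Sf : SigmaXX f = 0 by exact: (ker_eigen psdS eig Sf).
  apply: inner_ext => h; rewrite inner0l hS -[RHS](expect_cst P); congr expect.
  by apply/funext => w; rewrite FE innerC fK ?mul0r //; exact: HX0sec.
have lRhat n w : linear (Rhat n w).
  move=> a x y; rewrite /Rhat /emp_regression /=.
  have lE := emp_cov_linear n (fun i => feature HX (Xs i) w) (fun i => feature HY (Ys i) w).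
  by rewrite lE; apply: (resolvent_linear (emp_cov_psd n _) (eps0 n)).
have RhatE n w g : let f i := feature HX (Xs i) w in let h i := feature HY (Ys i) w in
    emp_cov n f f (Rhat n w g) + eps n *: Rhat n w g = emp_cov n f h g.
  exact: (resolventK (emp_cov_psd n _) (eps0 n)).
(* By the regularized equation, Rhat n w g is a combination of values of
   empirical covariances, hence of centred sections. *)
have KRhat n w g : HX0 (Rhat n w g).
  pose f i := feature HX (Xs i) w; pose h i := feature HY (Ys i) w.
  have Kemp (W : hilbert R) (y : nat -> W) x : HX0 (emp_cov n f y x).
    have [->|n0] := posnP n; first by rewrite /emp_cov big_ord0 scaler0.
    rewrite /emp_cov -[_ *: _]addr0; apply: (Klin) => //.
    apply: (subspace_sum Klin K0) => i.
    have -> : f i - emp_mean n f = (-1) *: emp_mean n (fun i => f i - mX) + (f i - mX).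
      by rewrite emp_mean_shift // scaleN1r opprB [RHS]addrC addrA subrK.
    apply: (Klin); last exact: HX0sec.
    rewrite /emp_mean -[_ *: _]addr0; apply: (Klin) => //.
    under eq_bigr do rewrite -[_ - mX]scale1r.
    by apply: (subspace_sum Klin K0) => k; exact: HX0sec.
  have -> : Rhat n w g = (- (eps n)^-1) *: emp_cov n f f (Rhat n w g) +
      ((eps n)^-1 *: emp_cov n f h g + 0).
    rewrite -RhatE addr0 scalerDr addrA scaleNr addNr add0r scalerA mulVf ?scale1r //.
    by rewrite gt_eqF.
  by apply: (Klin) => //; apply: Klin.
have [C1 C10 HC1] := regression_maximizers_stable Klin K0 lR bRXY KR rk dist mphi.
move=> eta eta0.
have [K Kpos HK] := regression_error_bound iidZ ou tu ov tv bF bG cF hS hC eig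
  alpha1 beta0 lamc' lR bRXY SR spR bS RS eta0.
exists (C1 * K).
have eps1 : \forall n \near \oo, eps n <= 1.
  move/cvgrPdist_lt : epscvg => /(_ 1 ltr01); apply: filterS => n.
  by rewrite sub0r normrN => h; apply: ltW; apply: le_lt_trans h; exact: ler_norm.
near=> n.
have n0 : (0 < n)%N by near: n; exact: nbhs_infty_gt.
have en1 : eps n <= 1 by near: n; exact: eps1.
have [Ev [mEv PEv hEv]] := HK n (eps n) n0 (eps0 n) en1.
exists Ev; split => // w /=; rewrite normr_id => big; apply: contrapT => nEv.
move: big; apply/negP; rewrite -leNgt -mulrA.
apply: (HC1 (Rhat n w)) => //; first exact: mphih.
  rewrite mulr_ge0 ?(ltW Kpos) // /r !addr_ge0 ?mulr_ge0 ?powR_ge0 ?invr_ge0 ?ler0n //.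
move=> y; apply: (hEv w nEv) => /=.
have -> : (fun i => F (Zs i w)) = (fun i => feature HX (Xs i) w - mX).
  by apply/funext => i; rewrite FsE.
have -> : (fun i => G (Zs i w)) = (fun i => feature HY (Ys i) w - mY).
  by apply/funext => i; rewrite GsE.
by rewrite !emp_cov_shift //; exact: RhatE.
Unshelve. all: by end_near.
Qed.
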